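(* (1) Let $\gamma>0$ and $M\in\mathcal{M}_\gamma$. Then there exist $\varepsilon'>0$ and $K>0$ such that for all $\varepsilon\in(0,\varepsilon']$ and all $\theta\in\varepsilon^{-1}Q'$ $$\Bigl\|\bigl(M-\varepsilon^{-1}A_{\varepsilon\theta}\bigr)^{-1}-\bigl(\mathrm{av}(M)-\varepsilon^{-1}A_{\varepsilon\theta}\bigr)^{-1}\Bigr\|_{\mathbb{L}([L^2(0,1)]^2)}\le K\varepsilon .$$ (2) Let $\alpha\in(0,1]$, $\nu_0>0$, $c>0$, and let $\widehat C,\widehat D\in L^\infty(\mathbb{R};\mathbb{R}_{\ge 0})$ be $1$-periodic with $\widehat C(x)+\widehat D(x)\nu_0^\alpha\ge c$ for a.e. $x\in\mathbb{R}$. Let $\mu\ge\nu_0$ and $\gamma>0$ be such that for all $\nu>\mu$ and all $\xi\in\mathbb{R}$ the matrix function $$M_\xi=(\mathrm{i}\xi+\nu)\begin{pmatrix}1&0\\0&\bigl(\widehat C+\widehat D(\mathrm{i}\xi+\nu)^\alpha\bigr)^{-1}\end{pmatrix}$$ belongs to $\mathcal{M}_\gamma$ (such $\mu,\gamma$ exist), and let $\nu>\mu$. Then there is $\kappa>0$, independent of $\xi$ and of $\varepsilon'$, such that for every $\xi\in\mathbb{R}$ the estimate in (1) for $M=M_\xi$ holds with a constant $K$ satisfying $$K\le\kappa(\xi^2+1).$$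
   Context: $L^\infty_\#(\mathbb{R})$ is the space of (complex-valued) $f\in L^\infty(\mathbb{R})$ with $f(\cdot+1)=f(\cdot)$. For $\gamma>0$, $\mathcal{M}_\gamma$ is the set of $M\in[L^\infty_\#(\mathbb{R})]^{2\times2}$ with $\operatorname{Re}M(x)\ge\gamma 1_{2\times2}$ for a.e. $x\in\mathbb{R}$, where $\operatorname{Re}M=(M+M^* )/2$. For $M\in\mathcal{M}_\gamma$, $\mathrm{av}(M)=\int_0^1M\in\mathbb{C}^{2\times2}$. Elements of $\mathcal{M}_\gamma$ and constant matrices act on $[L^2(0,1)]^2$ as multiplication operators. $Q'=[-\pi,\pi)$. $\mathbb{L}(H)$ denotes the bounded linear operators on $H$. The operator $\partial_\#:f\mapsto f'$ in $L^2(0,1)$ has domain $H^1_\#(0,1)=\{f\in H^1(0,1):f(0)=f(1)\}$. For $\tau\in Q'$, $$A_\tau=\begin{pmatrix}0&\partial_\#+\mathrm{i}\tau\\ \partial_\#+\mathrm{i}\tau&0\end{pmatrix}$$ in $[L^2(0,1)]^2$ with domain $[H^1_\#(0,1)]^2$. The power $z^\alpha$ for $\operatorname{Re}z>0$ is the principal branch. *)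

(* Defs.v *)
From HB Require Import structures.
From mathcomp Require Import all_boot all_order all_algebra.
From mathcomp Require Import spectral generic_quotient ring_quotient.
From mathcomp Require Import all_classical all_reals all_analysis.
From mathcomp Require Import measurable_realfun ess_sup_inf.
From mathcomp Require Import complex ring.

Set Implicit Arguments.
Unset Strict Implicit.
Unset Printing Implicit Defensive.

Import Order.TTheory GRing.Theory Num.Theory.
Import numFieldNormedType.Exports.

Local Open Scope classical_set_scope.
Local Open Scope ring_scope.
Local Open Scope complex_scope.
Local Open Scope sesquilinear_scope.

Notation cRe := complex.Re.
Notation cIm := complex.Im.
Notation cnorm := ComplexField.Normc.normc.

Section ComplexFunctions.
Context {R : realType}.
Local Notation mu := (@lebesgue_measure R).

Definition I01 : set R := `]0, 1[%classic.

Definition cmeasurable (D : set R) (f : R -> R[i]) :=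
  measurable_fun D (fun x : R => cRe (f x)) /\
  measurable_fun D (fun x : R => cIm (f x)).

Definition cintegral (D : set R) (f : R -> R[i]) : R[i] :=
  (\int[mu]_(x in D) cRe (f x)) +i* (\int[mu]_(x in D) cIm (f x)).

(* As for every element of an L^oo space here, the value on a null set is
   irrelevant, so periodicity is only required almost everywhere. *)
Definition ae_periodic {T : Type} (f : R -> T) :=
  \forall x \ae mu, f (x + 1) = f x.

Definition Linfty_per (f : R -> R[i]) :=
  [/\ cmeasurable setT f, finite_norm mu +oo (fun x => cnorm (f x))
    & ae_periodic f].

(* On the half-plane 0 < Re z, where it is used, atan (Im z / Re z) is the
   principal argument of z. *)
Definition cpow_right (z : R[i]) (a : R) : R[i] :=
  let t := a * atan (cIm z / cRe z) in
  (cnorm z `^ a * cos t) +i* (cnorm z `^ a * sin t).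

End ComplexFunctions.

Section Matrices.
Context {R : realType}.
Local Notation mu := (@lebesgue_measure R).

(* In the partial order of R[i], 0 <= z means that z is real and
   nonnegative. *)
Definition psdmx n (A : 'M[R[i]]_n) :=
  forall v : 'cV[R[i]]_n, 0 <= (v ^t* *m A *m v) 0 0.

Definition Remx n (A : 'M[R[i]]_n) : 'M[R[i]]_n := 2^-1 *: (A + A ^t*).

Definition Mclass (gamma : R) (M : R -> 'M[R[i]]_2) :=
  (forall i j, Linfty_per (fun x => M x i j)) /\
  \forall x \ae mu, psdmx (Remx (M x) - (gamma%:C)%:M).

Definition av (M : R -> 'M[R[i]]_2) : 'M[R[i]]_2 :=
  \matrix_(i, j) cintegral I01 (fun x => M x i j).

End Matrices.

Section L2functions.
Context {R : realType}.
Local Notation mu := (@lebesgue_measure R).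

(* Elements are functions on the whole line; only their restrictions to (0, 1)
   matter, and the quotient below identifies functions that agree almost
   everywhere there. *)
Definition sqintegrable : {pred R -> R[i]} :=
  mem [set f : R -> R[i] | cmeasurable I01 f /\
    (\int[mu]_(x in I01) (cnorm (f x) ^+ 2)%:E < +oo)%E].

Lemma sqr_cnorm (z : R[i]) : cnorm z ^+ 2 = cRe z ^+ 2 + cIm z ^+ 2.
Proof. by case: z => a b /=; rewrite sqr_sqrtr// addr_ge0 ?sqr_ge0. Qed.

Let mI01 : measurable (I01 : set R).
Proof. exact: measurable_itv. Qed.

Lemma measurable_sqr_cnorm (f : R -> R[i]) : cmeasurable I01 f ->
  measurable_fun I01 (fun x : R => (cnorm (f x) ^+ 2)%:E).
Proof.
move=> [mr mi]; apply/measurable_EFinP.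
under eq_fun do rewrite sqr_cnorm.
by apply: measurable_funD; exact: measurable_funX.
Qed.

Lemma sqintegrable_submod_closed : submod_closed sqintegrable.
Proof.
split.
  rewrite inE; split; first by split; exact: measurable_cst.
  rewrite integral0_eq// => x _.
  by rewrite sqr_cnorm/= expr0n/= addr0.
move=> a f g; rewrite !inE => -[[mfr mfi] If] -[[mgr mgi] Ig].
have Rafg x : cRe (a * f x + g x) =
    cRe a * cRe (f x) - cIm a * cIm (f x) + cRe (g x).
  by move: (f x) (g x) => [? ?] [? ?]; case: (a).
have Iafg x : cIm (a * f x + g x) =
    cRe a * cIm (f x) + cIm a * cRe (f x) + cIm (g x).
  by move: (f x) (g x) => [? ?] [? ?]; case: (a).
have mh : cmeasurable I01 (a *: f + g).
  split; [under eq_fun do rewrite Rafg | under eq_fun do rewrite Iafg].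
    apply: measurable_funD => //; apply: measurable_funB;
      exact: measurable_funM.
  apply: measurable_funD => //; apply: measurable_funD; exact: measurable_funM.
split=> //.
pose k := 2 * cnorm a ^+ 2.
have k0 : 0 <= k by rewrite mulr_ge0// sqr_ge0.
have mF : measurable_fun I01 (fun x : R => (k%:E * (cnorm (f x) ^+ 2)%:E)%E).
  by apply: measurable_funeM; exact: measurable_sqr_cnorm.
have mG : measurable_fun I01 (fun x : R => (2%:E * (cnorm (g x) ^+ 2)%:E)%E).
  by apply: measurable_funeM; exact: measurable_sqr_cnorm.
apply: (@le_lt_trans _ _ (\int[mu]_(x in I01)
    (k%:E * (cnorm (f x) ^+ 2)%:E + 2%:E * (cnorm (g x) ^+ 2)%:E))%E).
  apply: ge0_le_integral => //.
  - by move=> x _; rewrite lee_fin sqr_ge0.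
  - exact: measurable_sqr_cnorm.
  - exact: emeasurable_funD.
  move=> x _; rewrite -!EFinM -EFinD lee_fin /k.
  have -> : (a *: f + g) x = a * f x + g x by [].
  rewrite (_ : 2 * cnorm a ^+ 2 * cnorm (f x) ^+ 2 =
    2 * cnorm (a * f x) ^+ 2); last first.
    by rewrite ComplexField.Normc.normcM exprMn -mulrA.
  move: (a * f x) (g x) => [p q] [r s].
  rewrite !sqr_cnorm/= -subr_ge0.
  rewrite (_ : _ - _ = (p - r) ^+ 2 + (q - s) ^+ 2) ?addr_ge0 ?sqr_ge0//.
  by ring.
rewrite ge0_integralD//.
- rewrite !ge0_integralZl ?lee_fin//.
  + by rewrite lte_add_pinfty// lte_mul_pinfty ?lee_fin.
  + exact: measurable_sqr_cnorm.
  + by move=> x _; rewrite lee_fin sqr_ge0.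
  + exact: measurable_sqr_cnorm.
  + by move=> x _; rewrite lee_fin sqr_ge0.
- by move=> x _; rewrite -EFinM lee_fin mulr_ge0 ?sqr_ge0.
- by move=> x _; rewrite -EFinM lee_fin mulr_ge0 ?sqr_ge0.
Qed.

HB.instance Definition _ :=
  GRing.isSubmodClosed.Build _ _ sqintegrable sqintegrable_submod_closed.

End L2functions.

Record L2fun (R : realType) := MkL2fun {
  L2fun_val :> R -> R[i];
  L2fun_valP : L2fun_val \in sqintegrable }.

Section L2space.
Context {R : realType}.
Local Notation mu := (@lebesgue_measure R).

HB.instance Definition _ := [isSub for @L2fun_val R].
HB.instance Definition _ := [Choice of L2fun R by <:].
HB.instance Definition _ := [SubChoice_isSubLmodule of L2fun R by <:].

Definition L2null : {pred L2fun R} :=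
  mem [set f : L2fun R | \forall x \ae mu, I01 x -> f x = 0].

Lemma L2null_submod_closed : submod_closed L2null.
Proof.
split; first by rewrite inE; apply: aeW => x _.
move=> a f g; rewrite !inE => f0 g0.
have F : Filter (almost_everywhere mu) by exact: ae_filter_ringOfSetsType.
apply: (filterS2 _ _ f0 g0) => x /= {}f0 {}g0 xI.
change (a * f x + g x = 0).
by rewrite f0// g0// mulr0 addr0.
Qed.

HB.instance Definition _ :=
  GRing.isSubmodClosed.Build _ _ L2null L2null_submod_closed.

End L2space.

Definition L2 (R : realType) : Type := Quotient.quot (@L2null R).

Section L2lmodule.
Context {R : realType}.
Local Open Scope quotient_scope.
Local Notation mu := (@lebesgue_measure R).
Implicit Types (u v : L2 R) (f g : L2fun R) (a b : R[i]).

HB.instance Definition _ := Choice.on (L2 R).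
HB.instance Definition _ := EqQuotient.on (L2 R).
HB.instance Definition _ := GRing.Zmodule.on (L2 R).

Definition L2_class f : L2 R := \pi f.

Definition L2_fun u : R -> R[i] := L2fun_val (repr u).

Lemma L2_classK u : L2_class (repr u) = u.
Proof. exact: reprK. Qed.

Lemma L2_classP f g :
  L2_class f = L2_class g <-> \forall x \ae mu, I01 x -> f x = g x.
Proof.
have F : Filter (almost_everywhere mu) by exact: ae_filter_ringOfSetsType.
split=> [/eqP|fg].
  rewrite -Quotient.idealrBE inE /= => fg0.
  apply: filterS fg0 => x /= + xI => /(_ xI).
  by move=> /eqP; rewrite subr_eq0 => /eqP.
apply/eqP; rewrite -Quotient.idealrBE inE /=.
apply: filterS fg => x /= + xI => /(_ xI) fg.
change (f x - g x = 0).
by rewrite fg subrr.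
Qed.

Definition L2_scale a u : L2 R := L2_class (a *: repr u).

Lemma L2_class_scale a f : L2_scale a (L2_class f) = L2_class (a *: f).
Proof.
apply/eqP; rewrite -Quotient.idealrBE -scalerBr.
by apply: rpredZ; rewrite Quotient.idealrBE reprK.
Qed.

Lemma L2_classD f g : L2_class (f + g) = L2_class f + L2_class g.
Proof. exact: Quotient.pi_add. Qed.

Lemma L2_scaleA a b u : L2_scale a (L2_scale b u) = L2_scale (a * b) u.
Proof. by rewrite -(L2_classK u) !L2_class_scale scalerA. Qed.

Lemma L2_scale1 : left_id 1 L2_scale.
Proof. by move=> u; rewrite -(L2_classK u) L2_class_scale scale1r. Qed.

Lemma L2_scaleDr : right_distributive L2_scale +%R.
Proof.
move=> a u v; rewrite -(L2_classK u) -(L2_classK v).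
by rewrite -L2_classD !L2_class_scale scalerDr L2_classD.
Qed.

Lemma L2_scaleDl u : {morph L2_scale^~ u : a b / a + b}.
Proof.
by move=> a b /=; rewrite -(L2_classK u) !L2_class_scale scalerDl L2_classD.
Qed.

HB.instance Definition _ := GRing.Zmodule_isLmodule.Build R[i] (L2 R)
  L2_scaleA L2_scale1 L2_scaleDr L2_scaleDl.

Definition L2norm u : R :=
  Num.sqrt (\int[mu]_(x in I01) (cnorm (L2_fun u x) ^+ 2)).

End L2lmodule.
Coercion L2_fun : L2 >-> Funclass.

Notation L2sq R := (L2 R * L2 R)%type.

Section Operators.
Context {R : realType}.
Local Notation mu := (@lebesgue_measure R).

Definition L2sq_norm (u : L2sq R) : R :=
  Num.sqrt (L2norm u.1 ^+ 2 + L2norm u.2 ^+ 2).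

Definition L2sq_col (u : L2sq R) (x : R) : 'cV[R[i]]_2 :=
  \col_i (if i == 0 then u.1 x else u.2 x).

Definition opnorm (T : L2sq R -> L2sq R) : \bar R :=
  ereal_sup [set (L2sq_norm (T u))%:E | u in [set u | L2sq_norm u <= 1]].

Definition test_function (phi : R -> R) :=
  [/\ forall x, derivable phi x 1, continuous (derive1 phi) &
    exists a b : R, [/\ 0 < a, b < 1 &
      forall x, phi x != 0 -> a <= x <= b]].

(* g = u' weakly on (0, 1), tested against C^1_c(0, 1). *)
Definition weak_deriv (u g : L2 R) := forall phi, test_function phi ->
  cintegral I01 (fun x => u x * (derive1 phi x)%:C) =
  - cintegral I01 (fun x => g x * (phi x)%:C).

Definition H1 : set (L2 R) := [set u | exists g, weak_deriv u g].

(* u(0) = u(1) refers to the continuous representative of u on [0, 1]. *)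
Definition H1per : set (L2 R) := [set u | H1 u /\
  exists w : R -> R[i], [/\
    {within `[0, 1], continuous (fun x : R => cRe (w x))},
    {within `[0, 1], continuous (fun x : R => cIm (w x))},
    (\forall x \ae mu, I01 x -> u x = w x) & w 0 = w 1]].

(* Unbounded operators are represented by their graphs, as sets of pairs
   (argument, value). *)
Definition dper : set (L2 R * L2 R) :=
  [set p | H1per p.1 /\ weak_deriv p.1 p.2].

Definition dper_shift (tau : R) : set (L2 R * L2 R) :=
  [set p | exists2 g, dper (p.1, g) & p.2 = g + (0 +i* tau) *: p.1].

Definition Aop (tau : R) : set (L2sq R * L2sq R) :=
  [set p | dper_shift tau (p.1.2, p.2.1) /\ dper_shift tau (p.1.1, p.2.2)].

Definition mulop (M : R -> 'M[R[i]]_2) : set (L2sq R * L2sq R) :=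
  [set p | \forall x \ae mu,
    I01 x -> L2sq_col p.2 x = M x *m L2sq_col p.1 x].

(* S - c T, on the intersection of the domains *)
Definition opsubZ {V : lmodType R[i]} (S : set (V * V)) (c : R[i])
    (T : set (V * V)) : set (V * V) :=
  [set p | exists f g, [/\ S (p.1, f), T (p.1, g) & p.2 = f - c *: g]].

(* The operator with graph G is a bijection from its domain onto [L^2(0,1)]^2
   and its inverse is the bounded operator S. *)
Definition is_bounded_inverse (G : set (L2sq R * L2sq R))
    (S : {linear L2sq R -> L2sq R}) :=
  (opnorm S < +oo)%E /\ forall u f, G (u, f) <-> u = S f.

Definition fibre_op (M : R -> 'M[R[i]]_2) (eps theta : R) :=
  opsubZ (mulop M) (eps^-1)%:C (Aop (eps * theta)).

Definition Qprime : set R := `[- pi, pi[%classic.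

Definition resolvent_estimate (M : R -> 'M[R[i]]_2) (eps' K : R) :=
  forall eps theta : R, 0 < eps <= eps' ->
  [set eps^-1 * t | t in Qprime] theta ->
  exists S S0 : {linear L2sq R -> L2sq R},
    [/\ is_bounded_inverse (fibre_op M eps theta) S,
        is_bounded_inverse (fibre_op (cst (av M)) eps theta) S0 &
        (opnorm (S \- S0)%R <= (K * eps)%:E)%E].

Definition Mxi (C D : R -> R) (alpha nu xi : R) (x : R) : 'M[R[i]]_2 :=
  let z := nu +i* xi in
  z *: diag_mx (\row_i (if i == 0 then 1
                        else ((C x)%:C + (D x)%:C * cpow_right z alpha)^-1)).

End Operators.

(* Main.v *)
Require Import Defs.
From HB Require Import structures.
From mathcomp Require Import all_boot all_order all_algebra.
From mathcomp Require Import all_classical all_reals all_analysis.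
From mathcomp Require Import measurable_realfun ess_sup_inf.
From mathcomp Require Import spectral complex ring lra.

Set Implicit Arguments.
Unset Strict Implicit.
Unset Printing Implicit Defensive.

Import Order.TTheory GRing.Theory Num.Theory.
Import numFieldNormedType.Exports.

Local Open Scope classical_set_scope.
Local Open Scope ring_scope.
Local Open Scope complex_scope.

(** The inverses exist because the coefficient is coercive and [A_tau] is
    skew-symmetric: testing the equation [M u - A_tau u / eps = f] with [u]
    removes the differential term and gives [gamma |u| <= |f|], hence uniqueness
    and a bound on the inverse. Skew-symmetry is integration by parts for
    periodic functions; to have it for the weak derivative, that derivative is
    identified with the primitives of square integrable functions of mean zero
    ([const_of_wderiv0], the lemma of du Bois-Reymond, and [perprimP]).
    Solutions come from a fixed point: for a large constant [l] the operator
    [l - A_0 / eps] decouples into two first order equations with constant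
    coefficients, which are solved by variation of constants ([periodic_ode],
    [base_solver]), and the rest [M - l] is small compared with [l] by
    coercivity ([coercive_solvable]). The term [i theta] of [A_tau / eps] is
    bounded and skew-symmetric, so it is moved into the multiplier
    ([fibre_solvable]).

    The estimate rests on one spectral fact. A periodic function [v] of mean
    zero satisfies [12 |v| ^ 2 <= |v'| ^ 2] ([poincare]), and [pi < sqrt 12], so
    that [|v' + i tau v| >= (sqrt 12 - pi) |v|] for every quasi-momentum [tau] in
    [[- pi, pi]] ([shift_poincare]). Hence in the equation for [u0] with the
    averaged coefficient [M0], where [A_tau u0] is of order [eps], the part of
    [u0] of mean zero is of order [eps] as well: up to such terms [u0] is its own
    mean [P u0]. Now [u - u0] solves the equation for [M] with right-hand side
    [(M0 - M) u0], which is thus [(M0 - M) P u0] up to order [eps]. This need not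
    be small, but it has mean zero, as [M0] is the average of [M] and [P u0] is
    constant. Solving an equation with constant coefficients for it gives a
    corrector [z] of mean zero, which the spectral bound makes of order [eps]
    ([corrector]), and [u - u0 - z] has a right-hand side of order [eps]
    ([homogenization_estimate]). All constants are explicit: if the real and
    imaginary parts of the entries of [M] are bounded by [b], then the constant
    of the estimate is a quadratic polynomial in [b / gamma], and every
    [eps > 0] is allowed.

    For the fractional coefficients it remains to bound [M_xi] from above and
    from below. With [z = nu + i xi], the real part of [C + D z ^ alpha] is
    bounded below, because the argument of [z ^ alpha] stays away from [pi / 2]
    if [alpha < 1], while for [alpha = 1] its real part is [nu] ([Re_pow_ge]); so
    the entries of [M_xi] are at most of order [1 + |xi|] ([Mxi_bound]), and the
    quadratic dependence on [b] gives the growth in [xi] ([Mxi_rate]). That [mu = nu0] is admissible for some [gamma]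
    follows from an explicit formula for the real part of
    [z / (C + D z ^ alpha)] ([Mxi_coercive]). *)

(** * Integrals over the unit interval *)

Section Unit_interval.
Context {R : realType}.
Local Notation mu := (@lebesgue_measure R).
Local Notation I01 := (@I01 R).

Implicit Types (f g h : R -> R) (P Q : R -> Prop).

Lemma aeS P Q : (forall x, P x -> Q x) ->
  (\forall x \ae mu, P x) -> \forall x \ae mu, Q x.
Proof.
have F : Filter (almost_everywhere mu) by exact: ae_filter_ringOfSetsType.
exact: filterS.
Qed.

Lemma aeS2 P Q (S : R -> Prop) : (forall x, P x -> Q x -> S x) ->
  (\forall x \ae mu, P x) -> (\forall x \ae mu, Q x) -> \forall x \ae mu, S x.
Proof.
have F : Filter (almost_everywhere mu) by exact: ae_filter_ringOfSetsType.
exact: filterS2.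
Qed.

Definition L1 (f : R -> R) := mu.-integrable I01 (EFin \o f).

Definition sqL2 (f : R -> R) := measurable_fun I01 f /\ L1 (fun x => f x ^+ 2).

Definition int01 (f : R -> R) : R := \int[mu]_(x in I01) f x.

Lemma aeI P Q : (\forall x \ae mu, I01 x -> P x) ->
  (\forall x \ae mu, I01 x -> Q x) -> \forall x \ae mu, I01 x -> P x /\ Q x.
Proof. by apply: aeS2 => x a b Ix; split; [exact: a|exact: b]. Qed.

Lemma mI01 : @measurable _ (measurableTypeR R) I01.
Proof. exact: measurable_itv. Qed.
Hint Resolve mI01 : core.

Lemma I01P (x : R) : I01 x <-> 0 < x < 1.
Proof. by rewrite /I01 /= in_itv. Qed.

Lemma I01_cc (x : R) : I01 x -> 0 <= x <= 1.
Proof. by move=> /I01P/andP[/ltW-> /ltW->]. Qed.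

Lemma I01_measure : mu I01 = 1%E.
Proof. by rewrite lebesgue_measure_itv/= lte_fin ltr01 -EFinD subr0. Qed.

Lemma L1_measurable f : L1 f -> measurable_fun I01 f.
Proof. by move=> /(measurable_int mu) /measurable_EFinP. Qed.

Lemma L1D f g : L1 f -> L1 g -> L1 (fun x => f x + g x).
Proof. by move=> Lf Lg; exact: (integrableD mI01 Lf Lg). Qed.

Lemma L1B f g : L1 f -> L1 g -> L1 (fun x => f x - g x).
Proof. by move=> Lf Lg; exact: (integrableB mI01 Lf Lg). Qed.

Lemma L1Z a f : L1 f -> L1 (fun x => a * f x).
Proof. by move=> Lf; exact: (integrableZl mI01 a Lf). Qed.

Lemma L1N f : L1 f -> L1 (fun x => - f x).
Proof. by move=> /(L1Z (-1)); under eq_fun do rewrite mulN1r. Qed.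

Lemma L1_le f g : measurable_fun I01 f -> L1 g ->
  (forall x, I01 x -> `|f x| <= g x) -> L1 f.
Proof.
move=> mf Lg fg; apply: (le_integrable mI01 _ _ Lg); first exact/measurable_EFinP.
by move=> x Ix /=; rewrite lee_fin (le_trans (fg _ Ix))// ler_norm.
Qed.

Lemma L1_ae f g : measurable_fun I01 g -> (\forall x \ae mu, I01 x -> f x = g x) ->
  L1 f -> L1 g.
Proof.
move=> mg fg /integrableP[mf fi]; apply/integrableP; split; first exact/measurable_EFinP.
apply: le_lt_trans fi; rewrite le_eqVlt; apply/orP; left; apply/eqP.
apply: ae_eq_integral => //.
- by apply: measurableT_comp => //; exact/measurable_EFinP.
- by apply: measurableT_comp.
- by move: fg; apply: aeS => x fg Ix /=; rewrite fg.
Qed.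

Lemma L1_cst a : L1 (fun=> a).
Proof.
apply/integrableP; split; first exact/measurable_EFinP.
by under eq_integral do rewrite /=; rewrite integral_cst// [X in (_ * X)%E]I01_measure mule1 ltry.
Qed.

Lemma L1_bounded f a : measurable_fun I01 f -> (forall x, I01 x -> `|f x| <= a) -> L1 f.
Proof. by move=> mf fa; exact: (L1_le mf (L1_cst a)). Qed.

Lemma int01D f g : L1 f -> L1 g -> int01 (fun x => f x + g x) = int01 f + int01 g.
Proof. by move=> Lf Lg; rewrite /int01 RintegralD. Qed.

Lemma int01B f g : L1 f -> L1 g -> int01 (fun x => f x - g x) = int01 f - int01 g.
Proof. by move=> Lf Lg; rewrite /int01 RintegralB. Qed.

Lemma int01Z a f : L1 f -> int01 (fun x => a * f x) = a * int01 f.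
Proof. by move=> Lf; rewrite /int01 RintegralZl. Qed.

Lemma int01N f : L1 f -> int01 (fun x => - f x) = - int01 f.
Proof.
move=> Lf; rewrite -mulN1r -int01Z//; congr int01.
by apply/funext => x; rewrite mulN1r.
Qed.

Lemma int01_cst a : int01 (fun=> a) = a.
Proof. by rewrite /int01 Rintegral_cst// [X in fine X]I01_measure mulr1. Qed.

Lemma eq_int01 f g : (forall x, I01 x -> f x = g x) -> int01 f = int01 g.
Proof. by move=> fg; apply: eq_Rintegral => x /set_mem; exact: fg. Qed.

Lemma ae_int01 f g : measurable_fun I01 f -> measurable_fun I01 g ->
  (\forall x \ae mu, I01 x -> f x = g x) -> int01 f = int01 g.
Proof.
move=> mf mg fg; rewrite /int01 /Rintegral; congr fine.
apply: ae_eq_integral => //; [exact/measurable_EFinP..|].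
by move: fg; apply: aeS => x fg Ix /=; rewrite fg.
Qed.

Lemma int01_ge0 f : (forall x, I01 x -> 0 <= f x) -> 0 <= int01 f.
Proof. by move=> f0; exact: Rintegral_ge0. Qed.

Lemma le_int01 f g : L1 f -> L1 g -> (\forall x \ae mu, I01 x -> f x <= g x) ->
  int01 f <= int01 g.
Proof.
move=> Lf Lg fg.
rewrite -subr_ge0 -int01B// (@ae_int01 _ (fun x => `|g x - f x|)).
- by apply: int01_ge0 => x _; exact: normr_ge0.
- by apply: L1_measurable; exact: L1B.
- by apply: measurableT_comp => //; apply: L1_measurable; exact: L1B.
- by move: fg; apply: aeS => x fg Ix; rewrite ger0_norm// subr_ge0 fg.
Qed.

Lemma le_norm_int01 f : L1 f -> `|int01 f| <= int01 (fun x => `|f x|).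
Proof. by move=> Lf; exact: le_normr_Rintegral. Qed.

Lemma L1_norm f : L1 f -> L1 (fun x => `|f x|).
Proof. by move=> Lf; exact: integrable_norm. Qed.

Lemma sqL2M f g : sqL2 f -> sqL2 g -> L1 (fun x => f x * g x).
Proof.
move=> [mf f2] [mg g2].
apply: (@L1_le _ (fun x => f x ^+ 2 + g x ^+ 2)).
- exact: measurable_funM.
- exact: L1D.
- move=> x _; rewrite ler_norml; apply/andP; split; nra.
Qed.

Lemma sqL2_cst a : sqL2 (fun=> a).
Proof. by split; [exact: measurable_cst|exact: L1_cst]. Qed.

Lemma sqL2_L1 f : sqL2 f -> L1 f.
Proof.
move=> f2; have := sqL2M f2 (sqL2_cst 1).
by under eq_fun do rewrite mulr1.
Qed.

Lemma sqL2Z a f : sqL2 f -> sqL2 (fun x => a * f x).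
Proof.
move=> [mf f2]; split; first exact: measurable_funM.
under eq_fun do rewrite exprMn.
exact: L1Z.
Qed.

Lemma sqL2N f : sqL2 f -> sqL2 (fun x => - f x).
Proof.
by move=> /(sqL2Z (-1)); under eq_fun do rewrite mulN1r.
Qed.

Lemma sqL2D f g : sqL2 f -> sqL2 g -> sqL2 (fun x => f x + g x).
Proof.
move=> sf sg; have fg := sqL2M sf sg.
case: sf sg => [mf f2] [mg g2]; split; first exact: measurable_funD.
rewrite (_ : (fun _ => _) = (fun x => f x ^+ 2 + (f x * g x + f x * g x) + g x ^+ 2)).
  by apply: L1D => //; apply: L1D => //; exact: L1D.
by apply/funext => x; ring.
Qed.

Lemma sqL2B f g : sqL2 f -> sqL2 g -> sqL2 (fun x => f x - g x).
Proof. by move=> sf sg; apply: sqL2D => //; exact: sqL2N. Qed.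

Lemma sqL2_ae f g : measurable_fun I01 g -> (\forall x \ae mu, I01 x -> f x = g x) ->
  sqL2 f -> sqL2 g.
Proof.
move=> mg fg [mf f2]; split => //; apply: L1_ae f2.
  exact: measurable_funX.
by move: fg; apply: aeS => x fg Ix; rewrite fg.
Qed.

Lemma sqL2_le f g : measurable_fun I01 f -> sqL2 g ->
  (forall x, I01 x -> `|f x| <= `|g x|) -> sqL2 f.
Proof.
move=> mf [mg g2] fg; split => //; apply: L1_le g2 _.
  exact: measurable_funX.
move=> x Ix; rewrite ger0_norm ?sqr_ge0// -[leLHS]real_normK ?num_real//.
by rewrite -[leRHS]real_normK ?num_real// ler_sqr ?nnegrE// fg.
Qed.

(** Truncating [h] at level [a] changes it on a null set only and makes the
    bound hold everywhere, so that [sqL2_le] applies. *)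
Lemma sqL2_mul h f a : measurable_fun I01 h ->
  (\forall x \ae mu, I01 x -> `|h x| <= a) -> sqL2 f ->
  sqL2 (fun x => h x * f x).
Proof.
move=> mh ha sf.
have mh' : measurable_fun I01 (fun x => Num.max (- a) (Num.min a (h x))).
  by apply: measurable_maxr => //; exact: measurable_minr.
apply: (@sqL2_ae (fun x => Num.max (- a) (Num.min a (h x)) * f x)).
- by apply: measurable_funM => //; exact: sf.1.
- move: ha; apply: aeS => x ha Ix; have {}ha := ha Ix.
  have a0 : 0 <= a by exact: le_trans ha.
  move: ha; rewrite ler_norml => /andP[h1 h2].
  by rewrite min_r// max_r.
- apply: (sqL2_le _ (sqL2Z a sf)).
    by apply: measurable_funM => //; exact: sf.1.
  move=> x Ix; rewrite !normrM ler_wpM2r//.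
  rewrite ler_norml ge_max le_max.
  have := ler_norm a; have := ler_norm (- a); rewrite normrN => ? ?.
  rewrite ge_min; apply/andP; split; [apply/orP; left; lra|].
  by apply/andP; split => //; apply/orP; left.
Qed.

(** The quadratic polynomial [t |-> int01 ((f - t g) ^ 2)] is nonnegative. *)
Lemma cauchy_schwarz01 f g : sqL2 f -> sqL2 g ->
  int01 (fun x => f x * g x) ^+ 2 <=
  int01 (fun x => f x ^+ 2) * int01 (fun x => g x ^+ 2).
Proof.
move=> sf sg; have Lfg := sqL2M sf sg.
set p := int01 (fun x => f x * g x); set F := int01 (fun x => f x ^+ 2).
set G := int01 (fun x => g x ^+ 2).
have key t : 0 <= F - t * (2 * p) + t ^+ 2 * G.
  rewrite (_ : _ + _ = int01 (fun x => (f x - t * g x) ^+ 2)); last first.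
    rewrite (_ : (fun _ => _) =
      (fun x => (f x ^+ 2 - (t * 2) * (f x * g x)) + t ^+ 2 * (g x ^+ 2))); last first.
      by apply/funext => x; ring.
    have [Lf2 Lg2] := (sf.2, sg.2).
    rewrite int01D ?int01B ?int01Z//; last first.
    - exact: L1Z.
    - by apply: L1B => //; exact: L1Z.
    - exact: L1Z.
    - by rewrite -/p -/F -/G; ring.
  by apply: int01_ge0 => x _; exact: sqr_ge0.
have F0 : 0 <= F by apply: int01_ge0 => x _; exact: sqr_ge0.
have : 0 <= G by apply: int01_ge0 => x _; exact: sqr_ge0.
rewrite le_eqVlt => /predU1P[G0|G0].
  rewrite -G0 mulr0; have [->|p0] := eqVneq p 0; first by rewrite expr0n.
  (* with [G = 0] the polynomial is affine, and negative at this point *)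
  have := key ((F + 1) / (2 * p)).
  rewrite -G0 mulr0 addr0 divfK ?mulf_neq0 ?pnatr_eq0//; lra.
have := key (p / G).
rewrite (_ : _ + _ = (F * G - p ^+ 2) / G); last by field; rewrite gt_eqF.
by rewrite pmulr_lge0 ?invr_gt0// subr_ge0.
Qed.

End Unit_interval.

(** * Primitives and integration by parts *)

Section Fubini.
Context {R : realType}.
Local Notation mu := (@lebesgue_measure R).
Implicit Types g h : R -> R.

(** Both sides integrate [h x * g t] over the half-plane [t <= x]. *)
Lemma integral_triangle g h :
  mu.-integrable setT (EFin \o g) -> mu.-integrable setT (EFin \o h) ->
  let G x := \int[mu]_(t in `]-oo, x]) g t in
  let H t := \int[mu]_(x in `[t, +oo[) h x in
  [/\ mu.-integrable setT (EFin \o (fun x => h x * G x)),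
      mu.-integrable setT (EFin \o (fun t => g t * H t)) &
      \int[mu]_x (h x * G x) = \int[mu]_t (g t * H t)].
Proof.
move=> ig ih G H.
have mg : measurable_fun setT g.
  by apply/measurable_EFinP; exact: measurable_int ig.
have mh : measurable_fun setT h.
  by apply/measurable_EFinP; exact: measurable_int ih.
pose T := measurableTypeR R.
pose D : set (T * T) := [set z | z.2 <= z.1].
have mD : measurable D.
  rewrite /D -[X in measurable X]setTI.
  have msnd : measurable_fun setT (snd : T * T -> R) by exact: measurable_snd.
  by apply: (measurable_fun_ler msnd measurable_fst) => //; exact: measurableT.
pose K (z : T * T) : \bar R := (h z.1 * g z.2 * \1_D z)%:E.
have mK : measurable_fun setT K.
  apply/measurable_EFinP; apply: measurable_funM; last exact: measurable_indic.
  by apply: measurable_funM; exact: measurableT_comp.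
have D1 x t : \1_D (x, t) = \1_(`]-oo, x]%classic : set T) t :> R.
  by rewrite !indicE; congr ((nat_of_bool _)%:R); apply/idP/idP; rewrite !inE/= in_itv.
have D2 x t : \1_D (x, t) = \1_(`[t, +oo[%classic : set T) x :> R.
  by rewrite !indicE; congr ((nat_of_bool _)%:R); apply/idP/idP; rewrite !inE/= in_itv/= andbT.
have restr (f : R -> R) (A : set T) a : measurable A ->
    mu.-integrable setT (EFin \o f) ->
    (\int[mu]_t (a * f t * \1_A t)%:E)%E = (a * \int[mu]_(t in A) f t)%:E.
  move=> mA fi; have fiA : mu.-integrable A (EFin \o f) by exact: integrableS fi.
  rewrite EFinM /Rintegral fineK; last exact: integrable_fin_num.
  rewrite -integralZl// [RHS]integral_mkcond; apply: eq_integral => t _.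
  rewrite patchE indicE; case: (t \in A); rewrite ?mulr1 ?mulr0//.
have FE : fubini_F mu K = EFin \o (fun x => h x * G x).
  by apply/funext => x; rewrite /fubini_F/= -restr//; apply: eq_integral => t _.
have GE : fubini_G mu K = EFin \o (fun t => g t * H t).
  apply/funext => t; rewrite /fubini_G/= -restr//; apply: eq_integral => x _.
  by rewrite (mulrC (g t)) -D2.
have iK : (mu \x mu)%E.-integrable setT K.
  apply/integrable12ltyP => //.
  have ig' : (\int[mu]_t `|g t|%:E < +oo)%E by case/integrableP : ig.
  have ih' : (\int[mu]_t `|h t|%:E < +oo)%E by case/integrableP : ih.
  have mgn : measurable_fun setT (fun t => `|g t|%:E).
    by apply/measurable_EFinP; exact: measurableT_comp.
  have mhn : measurable_fun setT (fun t => `|h t|%:E).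
    by apply/measurable_EFinP; exact: measurableT_comp.
  pose c := \int[mu]_t `|g t|.
  have cE : (\int[mu]_t `|g t|%:E)%E = c%:E.
    by rewrite /c /Rintegral fineK// ge0_fin_numE// integral_ge0.
  apply: (@le_lt_trans _ _ (\int[mu]_x (c%:E * `|h x|%:E))%E); last first.
    rewrite ge0_integralZl//; last first.
    - by rewrite lee_fin /c fine_ge0// integral_ge0.
    by rewrite lte_mul_pinfty// lee_fin /c fine_ge0// integral_ge0.
  apply: ge0_le_integral => //.
  - by move=> x _; exact: integral_ge0.
  - apply: (@measurable_fun_fubini_tonelli_F _ _ _ _ _ _ (abse \o K)).
      exact: measurableT_comp.
    by move=> z; exact: abse_ge0.
  - by apply: measurable_funeM.
  - move=> x _; rewrite -cE -ge0_integralZr//.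
    apply: ge0_le_integral => //.
    + apply: measurableT_comp => //; apply: measurableT_comp => //.
    + exact: emeasurable_funM.
    + move=> t _; rewrite /K/= lee_fin !normrM [leRHS]mulrC ler_piMr ?mulr_ge0//.
      by rewrite indicE; case: (_ \in _); rewrite ?normr1 ?normr0.
split.
- by rewrite -FE; exact: integrable_fubini_F.
- rewrite -GE; apply/integrableP; split; first by apply: measurable_fubini_G => //; exact: iK.
  move: (iK) => /(integrable21ltyP _ _ mK); apply: le_lt_trans.
  apply: ge0_le_integral => //.
  + by apply: measurableT_comp => //; apply: measurable_fubini_G => //; exact: iK.
  + apply: (@measurable_fun_fubini_tonelli_G _ _ _ _ _ _ (abse \o K)).
      exact: measurableT_comp.
    by move=> z; exact: abse_ge0.
  + move=> t _; apply: le_abse_integral => //.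
    exact: measurableT_comp.
- rewrite /Rintegral; congr fine.
  rewrite -[LHS]/(\int[mu]_x (EFin \o (fun x => (h x * G x)%R)) x)%E -FE.
  rewrite -[RHS]/(\int[mu]_x (EFin \o (fun x => (g x * H x)%R)) x)%E -GE.
  by rewrite integral12_prod_meas1// integral21_prod_meas1.
Qed.

End Fubini.

Section Primitive.
Context {R : realType}.
Local Notation mu := (@lebesgue_measure R).
Local Notation I01 := (@I01 R).
Implicit Types g h : R -> R.

(** [g] is cut off outside of the unit interval, where it is arbitrary; this
    makes the primitive a function on the whole line. *)
Definition prim g x : R := \int[mu]_(t in `[0, x]) (g \_ I01) t.

Lemma L1_patch g : L1 g <-> mu.-integrable setT (EFin \o (g \_ I01)).
Proof.
rewrite /L1 (integrable_mkcond _ mI01).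
by rewrite restrict_EFin.
Qed.

Lemma int01_patch g : int01 g = \int[mu]_x (g \_ I01) x.
Proof. exact: Rintegral_mkcond. Qed.

Lemma primE g x : prim g x = \int[mu]_(t in `]-oo, x]) (g \_ I01) t.
Proof.
rewrite /prim Rintegral_mkcond [RHS]Rintegral_mkcond; apply: eq_Rintegral => t _.
rewrite !patchE; case: (boolP (t \in I01)) => [|_]; last by rewrite !if_same.
by rewrite !mem_setE !in_itv/= => /andP[/ltW-> _].
Qed.

(** Integration by parts for primitives of integrable functions, which need
    not be differentiable: the unit square is split along its diagonal. *)
Lemma prim_parts g h : L1 g -> L1 h ->
  [/\ L1 (fun x => h x * prim g x), L1 (fun x => g x * prim h x) &
  int01 (fun x => h x * prim g x) + int01 (fun x => g x * prim h x)
  = int01 g * int01 h].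
Proof.
move=> Lg Lh.
have /= ig := (L1_patch _).1 Lg; have /= ih := (L1_patch _).1 Lh.
have patchM (f k : R -> R) : (fun x => (f \_ I01) x * k x) = (fun x => f x * k x) \_ I01.
  by apply/funext => x; rewrite !patchE; case: ifPn => // _; rewrite mul0r.
have [] := integral_triangle ig ih.
rewrite !patchM => A1 A2 E; have La := (L1_patch _).2 A1; have Lb := (L1_patch _).2 A2.
have HE t : \int[mu]_(x in `[t, +oo[) (h \_ I01) x = int01 h - prim h t.
  have ihN : mu.-integrable [set` `]-oo, +oo[] (EFin \o (h \_ I01)).
    by rewrite set_itvNyy.
  rewrite primE int01_patch -set_itvNyy.
  rewrite (Rintegral_itvB ihN); [|by []|by []].
  rewrite Rintegral_itv_obnd_cbnd; first by [].
  exact: integrableS measurableT _ _ ih.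
have GE x : \int[mu]_(t in `]-oo, x]) (g \_ I01) t = prim g x by rewrite primE.
have {}La : L1 (fun x => h x * prim g x) by move: La; under eq_fun do rewrite GE.
have {}Lb : L1 (fun x => g x * (int01 h - prim h x)) by move: Lb; under eq_fun do rewrite HE.
have L3 : L1 (fun x => g x * prim h x).
  rewrite (_ : (fun _ => _) = (fun x => int01 h * g x - g x * (int01 h - prim h x))).
    by apply: L1B Lb; exact: L1Z.
  by apply/funext => x; ring.
clear ig ih; split; [exact: La|exact: L3|].
have -> : int01 (fun x => h x * prim g x) = int01 (fun x => int01 h * g x - g x * prim h x).
  rewrite [LHS]int01_patch [RHS]int01_patch.
  rewrite (_ : (fun x => h x * prim g x) =
    (fun x => h x * \int[mu]_(t in `]-oo, x]) (g \_ I01) t)); last first.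
    by apply/funext => x; rewrite GE.
  rewrite E; apply: eq_Rintegral => x _.
  rewrite !patchE; case: ifPn => _; last by [].
  by rewrite /= HE; ring.
rewrite (int01B (L1Z (int01 h) Lg) L3) (int01Z _ Lg); ring.
Qed.

Lemma prim_continuous g : L1 g -> {within `[0, 1], continuous (prim g)}.
Proof.
move=> Lg; apply: parameterized_integral_continuous => //.
by have := (L1_patch _).1 Lg; exact: integrableS.
Qed.

Lemma prim0 g : prim g 0 = 0.
Proof. by rewrite /prim set_itv1 Rintegral_set1. Qed.

Lemma prim1 g : L1 g -> prim g 1 = int01 g.
Proof.
move=> Lg; rewrite primE /int01 Rintegral_mkcond [RHS]Rintegral_mkcond.
apply: eq_Rintegral => t _; rewrite !patchE; case: (boolP (t \in I01)) => [|_]; last by rewrite !if_same.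
by rewrite !mem_setE !in_itv/= => /andP[_ /ltW->].
Qed.

Lemma prim_bound g x : L1 g -> `|prim g x| <= int01 (fun t => `|g t|).
Proof.
move=> Lg; rewrite primE; have /= ig := (L1_patch _).1 Lg.
have igx : mu.-integrable `]-oo, x] (EFin \o (g \_ I01)) by exact: integrableS ig.
apply: (le_trans (le_normr_Rintegral _ igx)) => //.
rewrite Rintegral_mkcond int01_patch.
have ig' := (L1_patch _).1 (L1_norm Lg).
apply: le_Rintegral => //.
  rewrite -restrict_EFin; apply/integrable_restrict => //=.
  by rewrite setTI; exact: integrable_norm.
move=> t _; rewrite !patchE; case: ifPn => _; case: ifPn => _; rewrite ?normr0//.
exact: normr_ge0.
Qed.

End Primitive.

(** * Test functions and weak derivatives *)

Section Weak_derivative.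
Context {R : realType}.
Local Notation mu := (@lebesgue_measure R).
Local Notation I01 := (@I01 R).
Implicit Types g h f u w k phi psi : R -> R.

Lemma cont01_bounded f : {within `[0, 1], continuous f} ->
  exists a, forall x, x \in `[0, 1] -> `|f x| <= a.
Proof.
move=> cf; have := continuous_compact cf (@segment_compact _ 0 1).
move=> /compact_bounded[M [_ Mf]]; exists (M + 1) => x x01.
by apply: (Mf (M + 1)); [rewrite ltrDl|exists x].
Qed.

Lemma cont01_sqL2 f : {within `[0, 1], continuous f} -> sqL2 f.
Proof.
move=> cf; have [a fa] := cont01_bounded cf.
have mf : measurable_fun I01 f.
  have mf01 : measurable_fun (`[0, 1]%classic : set R) f by exact: subspace_continuous_measurable_fun.
  by apply: measurable_funS mf01 => //; exact: subset_itv_oo_cc.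
apply: (sqL2_le mf (sqL2_cst a)) => x Ix.
have x01 : x \in `[0, 1] by rewrite in_itv/= I01_cc.
by apply: le_trans (fa _ x01) _; exact: ler_norm.
Qed.

Lemma cont_sqL2 f : continuous f -> sqL2 f.
Proof. by move=> cf; apply: cont01_sqL2; exact: continuous_subspaceT. Qed.

Lemma test_continuous phi : test_function phi -> continuous phi.
Proof. by move=> [d _ _] x; apply: differentiable_continuous; apply/derivable1_diffP. Qed.

Lemma test_boundary phi : test_function phi -> phi 0 = 0 /\ phi 1 = 0.
Proof.
move=> [_ _ [a [b [a0 b1 ab]]]]; split; apply/eqP; apply/negPn/negP => /ab/andP[].
  by rewrite leNgt a0.
by move=> _; rewrite leNgt b1.
Qed.

Lemma prim_derive1 f x : (forall y, derivable f y 1) -> continuous (derive1 f) ->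
  0 <= x <= 1 -> prim (derive1 f) x = f x - f 0.
Proof.
move=> d c /andP[]; rewrite le_eqVlt => /predU1P[<- _|x0 x1].
  by rewrite prim0 subrr.
have cf : continuous f.
  by move=> y; apply: differentiable_continuous; apply/derivable1_diffP.
have mf' : measurable_fun (`]0, x[%classic : set R) (derive1 f).
  by apply: measurable_funTS; exact: continuous_measurable_fun.
have E : (\int[mu]_(t in `[0%R, x]) (derive1 f t)%:E = (f x)%:E - (f 0)%:E)%E.
  apply: continuous_FTC2; first exact: x0.
  - exact: continuous_subspaceT.
  - split; first by move=> y _; exact: d.
      by apply: cvg_at_right_filter; exact: cf.
    by apply: cvg_at_left_filter; exact: cf.
  - by [].
rewrite /prim /Rintegral.
rewrite (@eq_integral_itv_bounded _ 0 x (derive1 f) (derive1 f \_ I01)) ?E//.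
- apply: measurable_funTS; apply/measurable_EFinP.
  by have /(measurable_int mu) := (L1_patch _).1 (sqL2_L1 (cont_sqL2 c)).
- move=> t; rewrite in_itv/= => /andP[t0 tx].
  rewrite patchE mem_set//; apply/I01P; rewrite t0/=.
  exact: lt_le_trans x1.
Qed.

Lemma test_prim phi x : test_function phi -> 0 <= x <= 1 ->
  phi x = prim (derive1 phi) x.
Proof.
move=> tphi x01; have [d c _] := tphi.
by rewrite prim_derive1// (test_boundary tphi).1 subr0.
Qed.

Lemma test_int phi : test_function phi -> int01 (derive1 phi) = 0.
Proof.
move=> tphi; rewrite -prim1; last first.
  by have [_ c _] := tphi; apply: sqL2_L1; exact: cont_sqL2.
by rewrite -test_prim ?ler01 ?lexx// (test_boundary tphi).2.
Qed.

(** Test functions are produced by prescribing their derivative. *)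
Lemma test_of_mean0 psi a b : 0 < a -> b < 1 -> continuous psi ->
  (forall x, psi x != 0 -> a <= x <= b) -> int01 psi = 0 ->
  test_function (prim psi) /\ derive1 (prim psi) = psi.
Proof.
move=> a0 b1 cpsi sp int0.
have psiE : psi \_ I01 = psi.
  apply/funext => x; rewrite patchE; case: ifPn => // /negP xI.
  apply/esym/eqP/negPn/negP => /sp/andP[ax xb]; apply: xI.
  by apply/mem_set/I01P; rewrite (lt_le_trans a0 ax) (le_lt_trans xb b1).
have Lpsi : L1 psi by apply: sqL2_L1; exact: cont_sqL2.
have ipsi : mu.-integrable setT (EFin \o psi).
  by rewrite -psiE; apply/(L1_patch psi).
have primpsi : prim psi = (fun x => \int[mu]_(t in `]-oo, x]) psi t).
  by apply/funext => x; rewrite primE psiE.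
have H x : derivable (prim psi) x 1 /\ (derive1 (prim psi)) x = psi x.
  rewrite primpsi; apply: (@continuous_FTC1 _ psi -oo%O x (x + 1)) => //.
  - by rewrite ltrDl.
  - exact: integrableS ipsi.
  - by rewrite ltNyr.
  - exact: cpsi.
have dE : derive1 (prim psi) = psi by apply/funext => x; have [] := H x.
split => //; split; first by move=> x; have [] := H x.
  by rewrite dE.
exists a, b; split => // x; apply: contraNT; rewrite negb_and -!ltNge => xab.
apply/eqP; rewrite primpsi; case/orP : xab => xab.
  rewrite /Rintegral integral0_eq// => t; rewrite /= in_itv/= => tx.
  congr EFin; apply/eqP/negPn/negP => /sp/andP[at_ _].
  by move: (le_lt_trans (le_trans at_ tx) xab); rewrite ltxx.
have int0' : \int[mu]_t psi t = 0 by rewrite -int0 int01_patch psiE.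
have := @Rintegral_itvB R psi -oo%O +oo%O x.
rewrite set_itvNyy => /(_ ipsi erefl erefl); rewrite int0' sub0r => E.
apply: oppr_inj; rewrite {}E oppr0.
rewrite /Rintegral integral0_eq// => t; rewrite /= in_itv/= andbT => xt.
congr EFin; apply/eqP/negPn/negP => /sp/andP[_ tb].
by move: (lt_trans (le_lt_trans tb xab) xt); rewrite ltxx.
Qed.

Lemma int01_gt0 f x0 : (forall x, I01 x -> 0 <= f x) -> L1 f -> I01 x0 ->
  {for x0, continuous f} -> 0 < f x0 -> 0 < int01 f.
Proof.
move=> f0 Lf Ix0 cf fx0.
have : \forall x \near x0, I01 x /\ f x0 / 2 < f x.
  near=> x; split; near: x.
    by apply: open_nbhs_nbhs; split => //; exact: interval_open.
  have /cvgr_gt := cf; apply.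
  by rewrite ltr_pdivrMr// ltr_pMr// ltr1n.
move=> [e /= e0 xe].
pose A : set R := `](x0 - e), (x0 + e)[%classic.
have sA x : A x -> I01 x /\ f x0 / 2 < f x.
  by rewrite /A/= in_itv/= => Ax; apply: xe; rewrite /ball_/= distrC ltr_distl.
have mA : @measurable _ (measurableTypeR R) A by exact: measurable_itv.
have gE : int01 (fun x => f x0 / 2 * \1_A x) = f x0 / 2 * (2 * e).
  rewrite int01Z; last first.
    apply: L1_bounded (1) _ _; first exact: measurable_indic.
    by move=> x _; rewrite indicE; case: (_ \in _); rewrite ?normr1 ?normr0.
  congr (_ * _); rewrite /int01 /Rintegral integral_indic//; last exact: mI01.
  rewrite (_ : A `&` I01 = A); last first.
    by apply/seteqP; split => [x []//|x Ax]; split => //; have [] := sA x Ax.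
  rewrite /A [X in fine X]lebesgue_measure_itv/= lte_fin ltrBlDr -addrA ltrDl addr_gt0//.
  by rewrite -EFinD/=; ring.
have lb : 0 < f x0 / 2 * (2 * e).
  by rewrite mulr_gt0// ?mulr_gt0// divr_gt0.
apply: (lt_le_trans lb); rewrite -gE; apply: le_int01 => //.
  apply: L1Z; apply: L1_bounded (1) _ _; first exact: measurable_indic.
  by move=> x _; rewrite indicE; case: (_ \in _); rewrite ?normr1 ?normr0.
apply: aeW => x Ix; rewrite indicE; case: (boolP (x \in A)) => [/set_mem xA|_].
  by rewrite mulr1 ltW//; have [] := sA x xA.
by rewrite mulr0 f0.
Unshelve. all: by end_near. Qed.

End Weak_derivative.

Section Weak_primitive.
Context {R : realType}.
Local Notation mu := (@lebesgue_measure R).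
Local Notation I01 := (@I01 R).
Implicit Types g h f u v w k phi psi : R -> R.

Definition wderiv u g := forall phi, test_function phi ->
  int01 (fun x => u x * derive1 phi x) = - int01 (fun x => g x * phi x).

Lemma sqL2_bounded_mul h f : {within `[0, 1], continuous h} -> L1 f ->
  L1 (fun x => f x * h x).
Proof.
move=> ch Lf; have [mh _] := cont01_sqL2 ch.
have [a ha] := cont01_bounded ch.
apply: (@L1_le _ _ (fun x => a * `|f x|)).
- by apply: measurable_funM => //; exact: L1_measurable.
- by apply: L1Z; exact: L1_norm.
- move=> x Ix; rewrite normrM mulrC ler_wpM2r// ha//.
  by rewrite in_itv/=; exact: I01_cc.
Qed.

Lemma prim_wderiv c g : L1 g -> wderiv (fun x => c + prim g x) g.
Proof.
move=> Lg phi tphi; have [_ cphi' _] := tphi.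
have Lphi' := sqL2_L1 (cont_sqL2 cphi').
have [L1' L2' E] := prim_parts Lg Lphi'.
rewrite (_ : (fun x => _ * _) =
    (fun x => c * derive1 phi x + derive1 phi x * prim g x)); last first.
  by apply/funext => x; ring.
rewrite int01D//; last exact: L1Z.
rewrite int01Z// test_int// mulr0 add0r.
rewrite (eq_int01 (f := fun x => g x * phi x) (g := fun x => g x * prim (derive1 phi) x)); last first.
  by move=> x Ix /=; rewrite (test_prim tphi (I01_cc Ix)).
by apply/eqP; rewrite -subr_eq0 opprK E test_int// mulr0.
Qed.

(** The lemma of du Bois-Reymond. As [k] is continuous it may enter the test
    function: on [[a, b]] test with a primitive of [(k - c) * chi], where [chi]
    is a bump and the constant [c] makes the mean vanish; this gives
    [int01 ((k - c) ^ 2 * chi) = 0]. *)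
Lemma const_of_wderiv0 k : {within `[0, 1], continuous k} ->
  wderiv k (fun=> 0) -> forall x, 0 <= x <= 1 -> k x = k 0.
Proof.
move=> ck k0.
have Lk := cont01_sqL2 ck.
have ck' x : 0 < x < 1 -> {for x, continuous k}.
  move=> x01; have /continuous_within_itvP[//|c _ _] := ck.
  by apply: c; rewrite in_itv.
have Hab a b x y : 0 < a -> b < 1 -> a < x < b -> a < y < b -> k x = k y.
  move=> a0 b1 xab yab.
  pose p t : R := (t - a) * (b - t); pose chi t := p t + `|p t|.
  have cchi : continuous chi.
    move=> t; have cp : {for t, continuous p}.
      apply: continuousM.
        by apply: continuousB; [exact: cvg_id|exact: cvg_cst].
      by apply: continuousB; [exact: cvg_cst|exact: cvg_id].
    by apply: continuousD => //; apply: continuous_comp => //; exact: norm_continuous.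
  have chi0 t : 0 <= chi t by rewrite /chi addrC -lerBlDr sub0r -normrN ler_norm.
  have chi_gt0 t : a < t < b -> 0 < chi t.
    move=> /andP[ta tb]; rewrite /chi ltr_wpDr//.
    by rewrite mulr_gt0// subr_gt0.
  have chi_out t : ~~ (a <= t <= b) -> chi t = 0.
    rewrite negb_and -!ltNge => tab; rewrite /chi ler0_norm ?subrr// /p.
    by case/orP : tab => h; nra.
  have Ix t : a < t < b -> I01 t.
    by move=> /andP[ta tb]; apply/I01P; rewrite (lt_trans a0 ta) (lt_trans tb b1).
  have Lchi := cont_sqL2 cchi.
  have Ichi : 0 < int01 chi.
    by apply: (int01_gt0 (x0 := x)) => //; [exact: sqL2_L1|exact: Ix|exact: cchi|exact: chi_gt0].
  have Lkchi := sqL2M Lk Lchi.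
  pose c := int01 (fun t => k t * chi t) / int01 chi.
  pose psi t := (k t - c) * chi t.
  have psi_out t : psi t != 0 -> a <= t <= b.
    by apply: contraNT => /chi_out; rewrite /psi => ->; rewrite mulr0.
  have Lpsi : L1 psi.
    rewrite /psi; under eq_fun do rewrite mulrBl.
    by apply: L1B => //; apply: L1Z; exact: sqL2_L1.
  have psi0 : int01 psi = 0.
    rewrite /psi (_ : (fun t => _) = (fun t => k t * chi t - c * chi t)); last first.
      by apply/funext => t; ring.
    rewrite int01B//; last by apply: L1Z; exact: sqL2_L1.
    by rewrite int01Z ?divfK ?subrr ?gt_eqF//; exact: sqL2_L1.
  have cpsi : continuous psi.
    move=> t; have [tab|tab] := boolP (a <= t <= b).
      have t01 : 0 < t < 1.
        by move/andP : tab => [ta tb]; rewrite (lt_le_trans a0 ta) (le_lt_trans tb b1).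
      suff : {for t, continuous psi} by [].
      apply: continuousM; last exact: cchi.
      by apply: continuousB; [exact: ck'|exact: cvg_cst].
    have psit : psi t = 0 by rewrite /psi chi_out// mulr0.
    have psi_near : \forall s \near t, psi s = 0.
      have : \forall s \near t, ~~ (a <= s <= b).
        move: tab; rewrite negb_and -!ltNge => /orP[ta|bt].
          have : \forall s \near t, s < a.
            by apply: open_nbhs_nbhs; split => //; exact: open_lt.
          by apply: filterS => s sa; rewrite negb_and -!ltNge sa.
        have : \forall s \near t, b < s.
          by apply: open_nbhs_nbhs; split => //; exact: open_gt.
        by apply: filterS => s sa; rewrite negb_and -!ltNge sa orbT.
      by apply: filterS => s /chi_out; rewrite /psi => ->; rewrite mulr0.
    rewrite /continuous_at psit; apply: cvg_near_cst.
    exact: psi_near.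
  have [tpsi dpsi] := test_of_mean0 a0 b1 cpsi psi_out psi0.
  have := k0 _ tpsi; rewrite dpsi.
  rewrite (eq_int01 (f := fun x => 0 * _) (g := fun=> 0)); last by move=> t _; rewrite mul0r.
  rewrite int01_cst oppr0 => kpsi.
  have Lkpsi : L1 (fun t => k t * psi t).
    by apply: sqL2M => //; exact: cont_sqL2.
  have int0 : int01 (fun t => (k t - c) * psi t) = 0.
    rewrite (_ : (fun t => _) = (fun t => k t * psi t - c * psi t)); last first.
      by apply/funext => t; ring.
    by rewrite int01B ?int01Z// ?kpsi ?psi0 ?mulr0 ?subrr//; exact: L1Z.
  have kc t : a < t < b -> k t = c.
    move=> tab; apply/eqP; rewrite -subr_eq0; apply/negPn/negP => ktc.
    suff : 0 < int01 (fun t => (k t - c) * psi t) by rewrite int0 ltxx.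
    apply: (int01_gt0 (x0 := t)).
    - by move=> s _; rewrite /psi mulrA -expr2 mulr_ge0// sqr_ge0.
    - under eq_fun do rewrite mulrBl.
      by apply: L1B => //; exact: L1Z.
    - exact: Ix.
    - apply: continuousM; last exact: cpsi.
      apply: continuousB; last exact: cvg_cst.
      by apply: ck'; apply/I01P; exact: Ix.
    - by rewrite /psi mulrA -expr2 mulr_gt0 ?chi_gt0// exprn_even_gt0.
  by rewrite (kc x)// (kc y).
have Hin x y : 0 < x < 1 -> 0 < y < 1 -> k x = k y.
  move=> /andP[x0 x1] /andP[y0 y1].
  pose a := Num.min x y / 2; pose b := (1 + Num.max x y) / 2.
  have m0 : 0 < Num.min x y by rewrite lt_min x0.
  have M1 : Num.max x y < 1 by rewrite gt_max x1.
  have [mx my] : Num.min x y <= x /\ Num.min x y <= y by rewrite !ge_min !lexx orbT.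
  have [Mx My] : x <= Num.max x y /\ y <= Num.max x y by rewrite !le_max !lexx orbT.
  apply: (Hab a b); rewrite /a /b; first lra; first lra.
    by apply/andP; split; lra.
  by apply/andP; split; lra.
have half : 0 < (2^-1 : R) < 1 by apply/andP; split; lra.
have /continuous_within_itvP[//|_ ck0 ck1] := ck.
have k0E : k 0 = k 2^-1.
  apply: (@cvg_unique _ _ (k @ 0^'+)) => //.
  apply: cvg_near_cst; near=> t; rewrite (Hin t 2^-1)//.
  have t0 : 0 < t by [].
  have t1 : t < 1 by near: t; exact: nbhs_right_lt.
  by rewrite t0.
have k1E : k 1 = k 2^-1.
  apply: (@cvg_unique _ _ (k @ 1^'-)) => //.
  apply: cvg_near_cst; near=> t; rewrite (Hin t 2^-1)//.
  have t0 : 0 < t by near: t; exact: nbhs_left_gt.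
  have t1 : t < 1 by [].
  by rewrite t0.
move=> x /andP[]; rewrite le_eqVlt => /predU1P[<-//|x0].
rewrite le_eqVlt => /predU1P[->|x1]; first by rewrite k0E k1E.
by rewrite k0E; apply: Hin => //; rewrite x0.
Unshelve. all: by end_near. Qed.

End Weak_primitive.

Section Periodic_primitive.
Context {R : realType}.
Local Notation mu := (@lebesgue_measure R).
Local Notation I01 := (@I01 R).
Implicit Types g h f u v w k phi psi : R -> R.

Lemma add_prim_continuous (c : R) g : L1 g ->
  {within `[0, 1], continuous (fun x => c + prim g x)}.
Proof.
by move=> Lg y; apply: continuousD; [exact: cvg_cst|exact: (prim_continuous Lg)].
Qed.

Lemma within_continuousM f g : {within `[0, 1], continuous f} ->
  {within `[0, 1], continuous g} -> {within `[0, 1], continuous (fun x => f x * g x)}.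
Proof. by move=> cf cg y; apply: continuousM; [exact: cf|exact: cg]. Qed.

Lemma wderiv_prim w g : {within `[0, 1], continuous w} -> L1 g -> wderiv w g ->
  forall x, 0 <= x <= 1 -> w x = w 0 + prim g x.
Proof.
move=> cw Lg wg x x01; apply/eqP; rewrite -subr_eq; apply/eqP.
have cp := prim_continuous Lg.
have ck : {within `[0, 1], continuous (fun x => w x - prim g x)}.
  by move=> y; apply: continuousB; [exact: cw|exact: cp].
rewrite (const_of_wderiv0 ck) ?prim0 ?subr0// => phi tphi.
have [_ /cont_sqL2 sphi' _] := tphi.
rewrite (eq_int01 (f := fun x => 0 * _) (g := fun=> 0)); last by move=> t _; rewrite mul0r.
rewrite int01_cst oppr0.
rewrite (_ : (fun _ => _) =
    (fun x => w x * derive1 phi x - (0 + prim g x) * derive1 phi x)); last first.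
  by apply/funext => y; rewrite add0r mulrBl.
rewrite int01B.
- by rewrite wg// (prim_wderiv 0 Lg)// subrr.
- by apply: sqL2M => //; exact: cont01_sqL2.
- under eq_fun do rewrite add0r.
  by apply: sqL2M => //; exact: cont01_sqL2.
Qed.

(** The graph of the derivative with periodic boundary conditions: by the
    first clause the primitive in the second one is periodic. *)
Definition perprim u g := int01 g = 0 /\
  exists c, \forall x \ae mu, I01 x -> u x = c + prim g x.

Lemma wderiv_ae u v g : sqL2 u -> sqL2 v ->
  (\forall x \ae mu, I01 x -> u x = v x) -> wderiv u g -> wderiv v g.
Proof.
move=> su sv uv ug phi tphi; rewrite -ug//; have [_ /cont_sqL2 sphi' _] := tphi.
apply: ae_int01; [by apply: L1_measurable; exact: sqL2M..|].
by apply: aeS uv => x uv Ix; rewrite uv.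
Qed.

(** The weak formulation of the derivative, with a periodic continuous
    representative, is equivalent to the one by primitives. *)
Lemma perprimP u g : sqL2 u -> L1 g ->
  (wderiv u g /\ exists w, [/\ {within `[0, 1], continuous w},
     \forall x \ae mu, I01 x -> u x = w x & w 0 = w 1]) <-> perprim u g.
Proof.
move=> su Lg; split.
  move=> [ug [w [cw uw w01]]].
  have wg : wderiv w g by apply: wderiv_ae uw ug => //; exact: cont01_sqL2.
  have wE := wderiv_prim cw Lg wg; split.
    rewrite -prim1//; apply: (addrI (w 0)).
    by rewrite -wE ?ler01 ?lexx// addr0.
  exists (w 0); apply: aeS uw => x uw Ix.
  by rewrite uw// wE//; exact: I01_cc.
move=> [g0 [c uc]].
have cw := add_prim_continuous (c := c) Lg.
split.
  apply: (@wderiv_ae (fun x => c + prim g x)) => //; first exact: cont01_sqL2.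
    by apply: aeS uc => x uc Ix; rewrite uc.
  exact: prim_wderiv.
by exists (fun x => c + prim g x); split => //; rewrite prim0 prim1// g0.
Qed.

Lemma prim_sqL2 g : L1 g -> sqL2 (prim g).
Proof. by move=> Lg; apply: cont01_sqL2; exact: prim_continuous. Qed.

(** Integration by parts; the boundary terms cancel by periodicity. *)
Lemma perprim_skew u v g h : sqL2 u -> sqL2 v -> sqL2 g -> sqL2 h ->
  perprim u g -> perprim v h ->
  int01 (fun x => u x * h x) = - int01 (fun x => g x * v x).
Proof.
move=> su sv sg sh [g0 [c uc]] [h0 [d vd]].
have [Lg Lh] := (sqL2_L1 sg, sqL2_L1 sh).
have [L1' L2' E] := prim_parts Lg Lh.
rewrite (@ae_int01 _ _ (fun x => c * h x + h x * prim g x)); last first.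
- by apply: aeS uc => x uc Ix; rewrite uc//; ring.
- by apply: L1_measurable; apply: L1D => //; exact: L1Z.
- by apply: L1_measurable; exact: sqL2M.
rewrite [in RHS](@ae_int01 _ _ (fun x => d * g x + g x * prim h x)); last first.
- by apply: aeS vd => x vd Ix; rewrite vd//; ring.
- by apply: L1_measurable; apply: L1D => //; exact: L1Z.
- by apply: L1_measurable; exact: sqL2M.
rewrite (int01D (L1Z c Lh) L1') (int01D (L1Z d Lg) L2').
rewrite (int01Z c Lh) (int01Z d Lg) g0 h0 !mulr0 !add0r.
by apply/eqP; rewrite -subr_eq0 opprK E g0 mul0r.
Qed.

Lemma perprim_sup u g : sqL2 u -> sqL2 g -> perprim u g ->
  \forall x \ae mu, I01 x ->
    `|u x| <= `|int01 u| + 2 * int01 (fun x => `|g x|).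
Proof.
move=> su sg [g0 [c uc]]; have Lg := sqL2_L1 sg.
have Lp := sqL2_L1 (prim_sqL2 Lg).
have uE : int01 u = c + int01 (prim g).
  rewrite (@ae_int01 _ _ (fun x => c + prim g x))//.
  - by rewrite int01D// ?int01_cst//; exact: L1_cst.
  - exact: su.1.
  - by apply: L1_measurable; apply: L1D => //; exact: L1_cst.
have pb : `|int01 (prim g)| <= int01 (fun x => `|g x|).
  apply: le_trans (le_norm_int01 Lp) _.
  rewrite -[leRHS]int01_cst; apply: le_int01; [exact: L1_norm|exact: L1_cst|].
  by apply: aeW => x _; exact: prim_bound.
apply: aeS uc => x uc Ix; rewrite uc//.
have -> : c = int01 u - int01 (prim g) by rewrite uE addrK.
have := prim_bound x Lg.
have := ler_normD (int01 u - int01 (prim g)) (prim g x).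
have := ler_normB (int01 u) (int01 (prim g)).
lra.
Qed.

Lemma prim_indic f (x : R) : L1 f -> 0 <= x <= 1 ->
  int01 (fun y => f y * ((y <= x)%R)%:R) = prim f x.
Proof.
move=> Lf /andP[x0 x1]; rewrite primE int01_patch [RHS]Rintegral_mkcond.
apply: eq_Rintegral => t _; rewrite !patchE.
have -> : (t \in [set` `]-oo, x]]) = (t <= x) by rewrite mem_setE [LHS]in_itv.
by case: (t \in I01); case: (t <= x); rewrite /= ?mulr1 ?mulr0.
Qed.

Lemma prim_cst (c x : R) : 0 <= x <= 1 -> prim (fun=> c) x = c * x.
Proof.
move=> x01; pose F (y : R) := c * y.
have dF (y : R) : is_derive y (1 : R) F c.
  by apply: is_derive_eq; rewrite scaler1.
have F' : derive1 F = fun=> c.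
  by apply/funext => y; rewrite derive1E; apply: derive_val.
rewrite -F' prim_derive1// ?F' /F ?mulr0 ?subr0//.
by move=> y; exact: cvg_cst.
Qed.

Lemma prim_id (x : R) : 0 <= x <= 1 -> prim id x = x ^+ 2 / 2.
Proof.
move=> x01; pose F (y : R) := y ^+ 2 / 2.
have dF (y : R) : is_derive y (1 : R) F y.
  by apply: is_derive_eq; rewrite /GRing.scale/=; field.
have F' : derive1 F = id.
  by apply/funext => y; rewrite derive1E; apply: derive_val.
rewrite -F' prim_derive1// ?F' /F ?expr0n/= ?mul0r ?subr0//.
by move=> y; exact: cvg_id.
Qed.

Lemma prim_sqr (x : R) : 0 <= x <= 1 -> prim (fun y => y ^+ 2) x = x ^+ 3 / 3.
Proof.
move=> x01; pose F (y : R) := y ^+ 3 / 3.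
have dF (y : R) : is_derive y (1 : R) F (y ^+ 2).
  by apply: is_derive_eq; rewrite /GRing.scale/=; field.
have F' : derive1 F = fun y => y ^+ 2.
  by apply/funext => y; rewrite derive1E; apply: derive_val.
rewrite -F' prim_derive1// ?F' /F ?expr0n/= ?mul0r ?subr0//.
by move=> y; exact: exprn_continuous.
Qed.

End Periodic_primitive.

(** * The Poincare inequality and periodic solutions of a linear equation *)

Section Poincare.
Context {R : realType}.
Local Notation mu := (@lebesgue_measure R).
Local Notation I01 := (@I01 R).
Implicit Types g h f u v w k phi psi : R -> R.

Lemma int01_id : int01 (fun x : R => x) = 2^-1.
Proof.
have Lid : L1 (fun x : R => x) by apply: sqL2_L1; apply: cont_sqL2 => x; exact: cvg_id.
by rewrite -prim1// prim_id ?ler01 ?lexx// expr1n mul1r.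
Qed.

Lemma int01_sqr : int01 (fun x : R => x ^+ 2) = 3^-1.
Proof.
have Lid : L1 (fun x : R => x ^+ 2).
  by apply: sqL2_L1; apply: cont_sqL2 => x; exact: exprn_continuous.
by rewrite -prim1// prim_sqr ?ler01 ?lexx// expr1n mul1r.
Qed.

Lemma measurable_le_cst (x : R) :
  measurable_fun I01 (fun y : R => ((y <= x)%R)%:R : R).
Proof.
rewrite (_ : (fun y => _) = \1_(`]-oo, x]%classic : set R)); first exact: measurable_indic.
apply/funext => y; rewrite indicE; congr ((nat_of_bool _)%:R).
by rewrite mem_setE [RHS]in_itv.
Qed.

Lemma L1_cut f (x : R) : L1 f -> L1 (fun y => f y * ((y <= x)%R)%:R).
Proof.
move=> Lf; apply: (L1_le _ (L1_norm Lf)) => [|y _].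
  by apply: measurable_funM; [exact: L1_measurable|exact: measurable_le_cst].
by rewrite normrM ler_piMr//; case: (y <= x); rewrite ?normr0 ?normr1.
Qed.

(** The first Bernoulli polynomial, extended periodically, at [y - x]. *)
Definition saw (x y : R) : R := y + ((y <= x)%R)%:R - (2^-1 + x).

Lemma saw_sqL2 x : sqL2 (saw x).
Proof.
apply: sqL2B; last exact: sqL2_cst.
apply: sqL2D.
  by apply: cont_sqL2 => y; exact: cvg_id.
apply: (sqL2_le _ (sqL2_cst 1)) => [|y _]; last first.
  by case: (y <= x); rewrite ?normr0 ?normr1.
exact: measurable_le_cst.
Qed.

Lemma int01_saw_sqr x : 0 <= x <= 1 -> int01 (fun y => saw x y ^+ 2) = 12^-1.
Proof.
move=> x01.
have Lid : L1 (fun x : R => x) by apply: sqL2_L1; apply: cont_sqL2 => y; exact: cvg_id.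
have Lsq : L1 (fun x : R => x ^+ 2).
  by apply: sqL2_L1; apply: cont_sqL2 => y; exact: exprn_continuous.
have Lind f : L1 f -> L1 (fun y => f y * ((y <= x)%R)%:R) by exact: L1_cut.
pose c := 2^-1 + x.
rewrite (_ : (fun y => _) = (fun y => (y ^+ 2 + (- (2 * c)) * y + c ^+ 2) +
   ((1 - 2 * c) * (1 * ((y <= x)%R)%:R) + 2 * (y * ((y <= x)%R)%:R)))); last first.
  apply/funext => y; rewrite /saw -/c; case: (y <= x) => /=; ring.
have Lc := L1_cst.
have i1 : int01 (fun y : R => 1 * ((y <= x)%R)%:R) = x.
  by rewrite (prim_indic (L1_cst 1))// prim_cst// mul1r.
rewrite int01D ?int01D ?int01D ?(int01Z (1 - _)) ?i1 ?int01Z ?prim_indic ?int01_cst ?prim_id ?int01_id ?int01_sqr//.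
- by rewrite /c; field.
all: by repeat first [exact: Lc | exact: Lsq | apply: Lind | apply: L1Z | apply: L1B | apply: L1D | exact: Lid].
Qed.

Lemma prim_saw g x : L1 g -> int01 g = 0 -> 0 <= x <= 1 ->
  int01 (fun y => g y * saw x y) = prim g x - int01 (prim g).
Proof.
move=> Lg g0 x01.
have [L1' L2' E] := prim_parts Lg (L1_cst 1).
have Lind : L1 (fun y => g y * ((y <= x)%R)%:R) by exact: L1_cut.
have Lgy : L1 (fun y => g y * y).
  by apply: sqL2_bounded_mul => //; apply: continuous_subspaceT => y; exact: cvg_id.
have gyE : int01 (fun y => g y * y) = - int01 (prim g).
  apply/eqP; rewrite -subr_eq0 opprK addrC; apply/eqP.
  rewrite -[RHS](mul0r (int01 (fun=> 1))) -g0 -E; congr (_ + _).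
    by congr int01; apply/funext => y; rewrite mul1r.
  by apply: eq_int01 => y Iy; rewrite prim_cst ?mul1r//; exact: I01_cc.
rewrite (_ : (fun y => _) =
    (fun y => g y * y + g y * ((y <= x)%R)%:R - (2^-1 + x) * g y)); last first.
  by apply/funext => y; rewrite /saw; ring.
rewrite int01B ?int01D ?int01Z ?prim_indic//; last 2 first.
- exact: L1D.
- exact: L1Z.
by rewrite g0 gyE mulr0 subr0 addrC.
Qed.

(** A mean zero [u] is the integral of [g] against the kernel [saw], whose
    square has integral [12^-1]. The best constant would be [(2 pi)^-2]; this
    one is good enough because [pi ^ 2 < 12]. *)
Lemma poincare u g : sqL2 u -> sqL2 g -> perprim u g -> int01 u = 0 ->
  int01 (fun x => u x ^+ 2) <= 12^-1 * int01 (fun x => g x ^+ 2).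
Proof.
move=> su sg [g0 [c uc]] u0; have Lg := sqL2_L1 sg.
have Lp := sqL2_L1 (prim_sqL2 Lg).
have cE : c = - int01 (prim g).
  apply/eqP; rewrite -subr_eq0 opprK -u0; apply/eqP.
  rewrite -[in LHS](int01_cst c) -int01D//; last exact: L1_cst.
  apply: ae_int01.
  - by apply: L1_measurable; apply: L1D => //; exact: L1_cst.
  - exact: su.1.
  - by apply: aeS uc => x uc Ix; rewrite uc.
rewrite -[leRHS]int01_cst; apply: le_int01; [exact: su.2|exact: L1_cst|].
apply: aeS uc => x uc Ix; have x01 := I01_cc Ix.
rewrite uc// cE addrC -prim_saw// mulrC -(int01_saw_sqr x01).
by apply: cauchy_schwarz01 => //; exact: saw_sqL2.
Qed.

End Poincare.

Section Periodic_ode.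
Context {R : realType}.
Local Notation mu := (@lebesgue_measure R).
Local Notation I01 := (@I01 R).
Implicit Types g h f u v w k phi psi : R -> R.

(** Variation of constants, [v x = e ^ (r x) (v0 + prim h x)] with
    [h x = e ^ (- r x) g x]; as [r <> 0] the constant [v0] can be chosen such
    that [v 0 = v 1]. The equation holds weakly because [e ^ (r x) phi] is a
    test function whenever [phi] is. *)
Lemma periodic_ode (r : R) g : r != 0 -> sqL2 g ->
  exists2 v, sqL2 v & perprim v (fun x => r * v x + g x).
Proof.
move=> r0 sg.
pose E (x : R) := expR (r * x); pose E' (x : R) := expR (- r * x).
have dE (x : R) : is_derive x (1 : R) E (r * E x).
  by apply: is_derive_eq; rewrite /GRing.scale/= mulr1 mulrC.
have derE x : derivable E x 1 by [].
have cE : continuous E.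
  by move=> x; apply: differentiable_continuous; apply/derivable1_diffP.
have cE' : continuous E'.
  by move=> x; apply: continuous_comp; [apply: continuousM; [exact: cvg_cst|exact: cvg_id]|exact: continuous_expR].
have EE' x : E x * E' x = 1 by rewrite /E /E' -expRD mulNr subrr expR0.
pose h x := g x * E' x.
have Lg := sqL2_L1 sg.
have Lh : L1 h by apply: sqL2_bounded_mul => //; exact: continuous_subspaceT.
pose v0 := E 1 * int01 h / (1 - E 1).
have E1 : 1 - E 1 != 0.
  by rewrite subr_eq0 eq_sym /E mulr1; apply: contra r0 => /eqP; rewrite -expR0 => /expR_inj ->.
pose W x := v0 + prim h x.
pose v x := E x * W x.
have cW : {within `[0, 1], continuous W}.
  exact: add_prim_continuous.
have cv : {within `[0, 1], continuous v}.
  exact: (within_continuousM (continuous_subspaceT cE) cW).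
have sv := cont01_sqL2 cv.
exists v => //; apply/perprimP => //.
  by apply: L1D => //; apply: L1Z; exact: sqL2_L1.
split; last first.
  exists v; split => //; first exact: aeW.
  rewrite /v /W prim0 prim1// addr0 /E mulr0 expR0 mul1r mulr1 -/(E 1).
  rewrite (_ : expR r = E 1); last by rewrite /E mulr1.
  by rewrite /v0; field.
move=> phi tphi; have [dphi cphi' [a [b [a0 b1 ab]]]] := tphi.
have cphi := test_continuous tphi.
pose psi x := E x * phi x.
have dpsi (x : R) : is_derive x (1 : R) psi (r * psi x + E x * derive1 phi x).
  have dphix : is_derive x (1 : R) phi (derive1 phi x).
    by rewrite derive1E; apply: DeriveDef.
  apply: is_derive_eq.
  by rewrite /GRing.scale/= /psi; ring.
have psi' : derive1 psi = fun x => r * psi x + E x * derive1 phi x.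
  by apply/funext => y; rewrite derive1E; apply: derive_val.
have cpsi : continuous psi.
  by rewrite /psi => x; apply: continuousM; [exact: cE|exact: cphi].
have tpsi : test_function psi.
  split.
  - by move=> x; apply: ex_derive.
  - rewrite psi' => x; apply: cvgD; first by apply: cvgM; [exact: cvg_cst|exact: cpsi].
    by apply: cvgM; [exact: cE|exact: cphi'].
  - exists a, b; split => // x; rewrite mulf_eq0 negb_or => /andP[_]; exact: ab.
have sW := cont01_sqL2 cW.
have spsi := cont_sqL2 cpsi.
have Lvphi' : L1 (fun x => v x * derive1 phi x).
  by apply: sqL2M => //; exact: cont_sqL2.
have := prim_wderiv v0 Lh tpsi; rewrite psi' -/W.
rewrite (_ : (fun x => _ * (_ + _)) =
    (fun x => r * (W x * psi x) + v x * derive1 phi x)); last first.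
  by apply/funext => x; rewrite /v /psi -/(W x); ring.
rewrite int01D//; last by apply: L1Z; exact: sqL2M.
rewrite int01Z; last exact: sqL2M.
move=> H.
rewrite (_ : (fun x => (r * v x + g x) * phi x) =
   (fun x => r * (W x * psi x) + h x * psi x)); last first.
  apply/funext => x; rewrite /h /psi (_ : g x * _ * _ = g x * phi x * (E x * E' x)); last ring.
  by rewrite EE' /v; ring.
rewrite int01D; last 2 first.
- by apply: L1Z; exact: sqL2M.
- by apply: sqL2_bounded_mul => //; exact: continuous_subspaceT.
rewrite int01Z; last exact: sqL2M.
by rewrite opprD -H; ring.
Qed.

End Periodic_ode.

(** * The Hilbert space of complex functions *)

(** Only real inner products are used: the real part of the complex one. *)
Section Prehilbert.
Context {R : realType} {V : lmodType R[i]} (ip : V -> V -> R).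
Context (ipC : forall u v, ip u v = ip v u)
        (ipD : forall u v w, ip (u + v) w = ip u w + ip v w)
        (ipZ : forall (a : R) u v, ip (a%:C *: u) v = a * ip u v)
        (ip_ge0 : forall u, 0 <= ip u u).
Implicit Types (u v w : V) (a : R).

Definition ipnorm u := Num.sqrt (ip u u).
Local Notation N := ipnorm.

Lemma ipDr u v w : ip u (v + w) = ip u v + ip u w.
Proof. by rewrite ipC ipD !(ipC u). Qed.

Lemma ipZr a u v : ip u (a%:C *: v) = a * ip u v.
Proof. by rewrite ipC ipZ ipC. Qed.

Lemma scaleN1C u : - u = (-1)%:C *: u.
Proof. by rewrite rmorphN1 scaleN1r. Qed.

Lemma ipNl u v : ip (- u) v = - ip u v.
Proof. by rewrite scaleN1C ipZ mulN1r. Qed.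

Lemma ipNr u v : ip u (- v) = - ip u v.
Proof. by rewrite ipC ipNl ipC. Qed.

Lemma ipBl u v w : ip (u - v) w = ip u w - ip v w.
Proof. by rewrite ipD ipNl. Qed.

Lemma ipBr u v w : ip u (v - w) = ip u v - ip u w.
Proof. by rewrite ipDr ipNr. Qed.

Lemma ip0l u : ip 0 u = 0.
Proof. by rewrite -(subrr u) ipBl subrr. Qed.

Lemma ipnorm_ge0 u : 0 <= N u.
Proof. exact: sqrtr_ge0. Qed.

Lemma sqr_ipnorm u : N u ^+ 2 = ip u u.
Proof. exact: sqr_sqrtr (ip_ge0 u). Qed.

Lemma ip_cauchy_schwarz u v : ip u v <= N u * N v.
Proof.
have key (t : R) : 0 <= ip u u - 2 * t * ip u v + t ^+ 2 * ip v v.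
  have := ip_ge0 (u - t%:C *: v).
  rewrite ipBl !ipBr !ipZr !ipZ (ipC v u).
  by congr (_ <= _); ring.
rewrite -!sqr_ipnorm in key; move: (ipnorm_ge0 u) (ipnorm_ge0 v).
rewrite [in X in _ -> X]le_eqVlt => u0 /predU1P[v0|v0].
  rewrite -v0 mulr0 leNgt; apply/negP => p0.
  have := key ((N u ^+ 2 + 1) / (2 * ip u v)).
  rewrite -v0 expr0n/= mulr0 addr0 [2 * _]mulrC -mulrA divfK ?mulf_neq0 ?pnatr_eq0 ?gt_eqF//.
  lra.
have := key (N u / N v); rewrite exprMn exprVn divfK ?sqrf_eq0 ?gt_eqF//.
rewrite (_ : _ + _ = (N u * N v - ip u v) * (2 * N u / N v)); last by field; rewrite gt_eqF.
move: u0; rewrite le_eqVlt => /predU1P[u0|u0].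
  have : ip u v ^+ 2 <= 0.
    have := key (ip u v / N v ^+ 2); rewrite -u0 expr0n/=.
    rewrite (_ : _ + _ = - (ip u v ^+ 2 / N v ^+ 2)); last by field; rewrite gt_eqF.
    by rewrite oppr_ge0 pmulr_lle0// invr_gt0 exprn_gt0.
  by rewrite -u0 mul0r => h _; nra.
by rewrite pmulr_lge0 ?subr_ge0// divr_gt0// mulr_gt0.
Qed.

Lemma ipnormZ a u : N (a%:C *: u) = `|a| * N u.
Proof. by rewrite /N ipZ ipZr mulrA -expr2 sqrtrM ?sqr_ge0// sqrtr_sqr. Qed.

Lemma ipnormN u : N (- u) = N u.
Proof. by rewrite scaleN1C ipnormZ normrN normr1 mul1r. Qed.

Lemma ipnorm_im (t : R) u :
  (forall s v w, ip ((0 +i* s) *: v) w = - ip v ((0 +i* s) *: w)) ->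
  N ((0 +i* t) *: u) = `|t| * N u.
Proof.
move=> ip_im; have E : ip ((0 +i* t) *: u) ((0 +i* t) *: u) = t ^+ 2 * ip u u.
  rewrite ip_im scalerA ipC.
  rewrite (_ : (0 +i* t) * (0 +i* t) = (- t ^+ 2)%:C); last first.
    by apply/eqP; rewrite eq_complex /=; apply/andP; split; apply/eqP; ring.
  by rewrite ipZ mulNr opprK.
by rewrite /N E sqrtrM ?sqr_ge0// sqrtr_sqr.
Qed.

Lemma ipnormD u v : N (u + v) <= N u + N v.
Proof.
rewrite -ler_sqr ?nnegrE ?addr_ge0 ?ipnorm_ge0//.
rewrite sqr_ipnorm ipD !ipDr (ipC v u) -!sqr_ipnorm.
have := ip_cauchy_schwarz u v; lra.
Qed.

Lemma ipnormB u v : N (u - v) <= N u + N v.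
Proof. by rewrite (le_trans (ipnormD _ _))// ipnormN. Qed.

Lemma ipnorm_le u a : 0 <= a -> ip u u <= a ^+ 2 -> N u <= a.
Proof.
move=> a0 ua; rewrite -ler_sqr ?nnegrE ?ipnorm_ge0 ?sqr_ipnorm; first exact: ua.
  exact: isT.
exact: a0.
Qed.

End Prehilbert.

Section L2_real_parts.
Context {R : realType}.
Local Notation mu := (@lebesgue_measure R).
Local Notation I01 := (@I01 R).
Implicit Types (u v w : L2 R).

Lemma L2fun_sqL2 (f : L2fun R) :
  sqL2 (fun x => cRe (f x)) /\ sqL2 (fun x => cIm (f x)).
Proof.
have := L2fun_valP f; rewrite inE => -[[mr mi] fi].
have If : L1 (fun x => cnorm (f x) ^+ 2).
  apply/integrableP; split; first exact: measurable_sqr_cnorm.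
  by under eq_integral => x _ do rewrite /= ger0_norm ?sqr_ge0//.
split; split => //.
- apply: L1_le If _; first exact: measurable_funX.
  by move=> x _; rewrite sqr_cnorm ger0_norm ?sqr_ge0// lerDl sqr_ge0.
- apply: L1_le If _; first exact: measurable_funX.
  by move=> x _; rewrite sqr_cnorm ger0_norm ?sqr_ge0// lerDr sqr_ge0.
Qed.

Lemma Re_sqL2 u : sqL2 (fun x => cRe (u x)).
Proof. exact: (L2fun_sqL2 _).1. Qed.

Lemma Im_sqL2 u : sqL2 (fun x => cIm (u x)).
Proof. exact: (L2fun_sqL2 _).2. Qed.

Lemma L2_fun_class (f : L2fun R) : \forall x \ae mu, I01 x -> L2_class f x = f x.
Proof. by apply/(L2_classP _ _).1; rewrite L2_classK. Qed.

Lemma L2_ext u v : (\forall x \ae mu, I01 x -> u x = v x) <-> u = v.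
Proof.
have H := L2_classP (repr u) (repr v).
by rewrite !L2_classK in H; split=> [h|h]; [exact: H.2 h|exact: H.1 h].
Qed.

Lemma L2_of (f : R -> R[i]) : sqL2 (fun x => cRe (f x)) -> sqL2 (fun x => cIm (f x)) ->
  exists u : L2 R, \forall x \ae mu, I01 x -> u x = f x.
Proof.
move=> sr si.
have Pf : f \in sqintegrable.
  rewrite inE; split; first by split; [exact: sr.1|exact: si.1].
  have := L1D sr.2 si.2; under eq_fun do rewrite -sqr_cnorm.
  move=> /integrableP[_]; apply: le_lt_trans.
  rewrite le_eqVlt; apply/orP; left; apply/eqP; apply: eq_integral => x _ /=.
  by rewrite ger0_norm ?sqr_ge0.
by exists (L2_class (MkL2fun Pf)); exact: L2_fun_class.
Qed.

Lemma L2_addE u v : \forall x \ae mu, I01 x -> L2_fun (u + v) x = u x + v x.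
Proof.
have := L2_fun_class (repr u + repr v); rewrite L2_classD !L2_classK.
exact.
Qed.

Lemma L2_scaleE (a : R[i]) u : \forall x \ae mu, I01 x -> L2_fun (a *: u) x = a * u x.
Proof. exact: L2_fun_class. Qed.

Lemma L2_subE u v : \forall x \ae mu, I01 x -> L2_fun (u - v) x = u x - v x.
Proof.
rewrite -scaleN1r.
apply: aeS2 (L2_addE u (-1 *: v)) (L2_scaleE (-1) v) => x H H' Ix.
by rewrite H// H'// mulN1r.
Qed.

Definition rip u v : R :=
  int01 (fun x => cRe (u x) * cRe (v x) + cIm (u x) * cIm (v x)).

Lemma rip_L1 u v : L1 (fun x => cRe (u x) * cRe (v x) + cIm (u x) * cIm (v x)).
Proof.
by apply: L1D; apply: sqL2M; (exact: Re_sqL2 || exact: Im_sqL2).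
Qed.

Lemma ripC u v : rip u v = rip v u.
Proof. by congr int01; apply/funext => x; rewrite mulrC (mulrC (cIm _)). Qed.

Lemma ripD u v w : rip (u + v) w = rip u w + rip v w.
Proof.
rewrite /rip -int01D; [|exact: rip_L1..].
apply: ae_int01; [apply: L1_measurable; exact: rip_L1| |].
  by apply: L1_measurable; apply: L1D; exact: rip_L1.
apply: aeS (L2_addE u v) => x uv Ix; rewrite uv//.
by case: (u x) (v x) => [a b] [c d] /=; ring.
Qed.

Lemma ripZ (a : R) u v : rip (a%:C *: u) v = a * rip u v.
Proof.
rewrite /rip -int01Z; last exact: rip_L1.
apply: ae_int01; [apply: L1_measurable; exact: rip_L1| |].
  by apply: L1_measurable; apply: L1Z; exact: rip_L1.
apply: aeS (L2_scaleE (a%:C) u) => x uv Ix; rewrite uv//.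
by case: (u x) => [b c] /=; ring.
Qed.

Lemma rip_ge0 u : 0 <= rip u u.
Proof. by apply: int01_ge0 => x _; rewrite -!expr2 addr_ge0// sqr_ge0. Qed.

Lemma rip_im (t : R) u v : rip ((0 +i* t) *: u) v = - rip u ((0 +i* t) *: v).
Proof.
rewrite /rip -int01N; last exact: rip_L1.
apply: ae_int01; [apply: L1_measurable; exact: rip_L1| |].
  by apply: L1_measurable; apply: L1N; exact: rip_L1.
apply: aeS2 (L2_scaleE (0 +i* t) u) (L2_scaleE (0 +i* t) v) => x uE vE Ix.
rewrite uE// vE//.
by case: (u x) (v x) => [a b] [c d] /=; ring.
Qed.

Lemma L2normE u : L2norm u = ipnorm rip u.
Proof.
rewrite /L2norm /ipnorm /rip /int01; congr (Num.sqrt (Rintegral _ _ _)).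
by apply/funext => x; rewrite sqr_cnorm !expr2.
Qed.

Lemma int01_eq0 (f : R -> R) : L1 f -> (forall x, I01 x -> 0 <= f x) ->
  int01 f = 0 -> \forall x \ae mu, I01 x -> f x = 0.
Proof.
move=> Lf f0 If.
have mf : measurable_fun I01 (EFin \o f) by exact: measurable_int Lf.
have : (\int[mu]_(x in I01) `|(EFin \o f) x| = 0)%E.
  transitivity (\int[mu]_(x in I01) (EFin \o f) x)%E.
    by apply: eq_integral => x /set_mem Ix; rewrite /= ger0_norm// f0.
  have := If; rewrite /int01 /Rintegral => If'.
  rewrite -[LHS]fineK; last by apply: integrable_fin_num => //; exact: mI01.
  by congr EFin; exact: If'.
move/(ae_eq_integral_abs mu (mI01 (R:=R)) mf); apply: aeS => x h Ix.
by have [] := h Ix.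
Qed.

Lemma rip_eq0 u : rip u u = 0 -> u = 0.
Proof.
move=> u0; apply/L2_ext.
have := int01_eq0 (rip_L1 u u) _ u0.
have h : forall x, I01 x -> 0 <= cRe (u x) * cRe (u x) + cIm (u x) * cIm (u x).
  by move=> x _; rewrite -!expr2 addr_ge0// sqr_ge0.
move=> /(_ h).
have z := L2_scaleE 0 u; rewrite scale0r in z.
apply: aeS2 z => x z0 ux Ix; rewrite z0// mul0r; move: (ux Ix).
case: (u x) => [a b] /= ab; have [-> ->] : a = 0 /\ b = 0 by split; nra.
by [].
Qed.

End L2_real_parts.

(** * The periodic derivative of complex functions *)

Section Periodic_derivative.
Context {R : realType}.
Local Notation mu := (@lebesgue_measure R).
Local Notation I01 := (@I01 R).
Implicit Types (u v w g h : L2 R) (f k : R -> R).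

Lemma ae_prim f k (x : R) : L1 f -> L1 k -> (\forall x \ae mu, I01 x -> f x = k x) ->
  0 <= x <= 1 -> prim f x = prim k x.
Proof.
move=> Lf Lk fk x01; rewrite -!prim_indic//.
apply: ae_int01; [by apply: L1_measurable; exact: L1_cut..|].
by apply: aeS fk => y fk Iy; rewrite fk.
Qed.

Lemma prim_lin a b f k (x : R) : L1 f -> L1 k -> 0 <= x <= 1 ->
  prim (fun y => a * f y + b * k y) x = a * prim f x + b * prim k x.
Proof.
move=> Lf Lk x01; rewrite -!prim_indic//; last by apply: L1D; exact: L1Z.
rewrite -!int01Z ?L1_cut// -int01D; [|by apply: L1Z; exact: L1_cut..].
by congr int01; apply/funext => y; ring.
Qed.

Lemma perprim_lin a b (u v g h u' g' : R -> R) : L1 g -> L1 h -> L1 g' ->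
  (\forall x \ae mu, I01 x -> u' x = a * u x + b * v x) ->
  (\forall x \ae mu, I01 x -> g' x = a * g x + b * h x) ->
  perprim u g -> perprim v h -> perprim u' g'.
Proof.
move=> Lg Lh Lg' uE gE [g0 [c uc]] [h0 [d vd]].
have Lgh : L1 (fun x => a * g x + b * h x) by apply: L1D; exact: L1Z.
split.
  rewrite (ae_int01 (L1_measurable Lg') (L1_measurable Lgh) gE).
  by rewrite int01D ?int01Z ?g0 ?h0 ?mulr0 ?addr0//; exact: L1Z.
exists (a * c + b * d).
have H : \forall x \ae mu, I01 x -> u x = c + prim g x /\ v x = d + prim h x.
  by apply: aeS2 uc vd => x A B Ix; split; [exact: A|exact: B].
apply: aeS2 uE H => x uE H Ix; have [uc' vd'] := H Ix.
rewrite uE// uc' vd'.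
have x01 := I01_cc Ix.
by rewrite (ae_prim Lg' Lgh gE x01) prim_lin//; ring.
Qed.

Lemma weak_derivP u g : weak_deriv u g <->
  wderiv (fun x => cRe (u x)) (fun x => cRe (g x)) /\
  wderiv (fun x => cIm (u x)) (fun x => cIm (g x)).
Proof.
have RE (w : L2 R) phi : \int[mu]_(x in I01) cRe (w x * (phi x)%:C) = int01 (fun x => cRe (w x) * phi x).
  by apply: eq_int01 => x _; case: (w x) => a b /=; ring.
have IE (w : L2 R) phi : \int[mu]_(x in I01) cIm (w x * (phi x)%:C) = int01 (fun x => cIm (w x) * phi x).
  by apply: eq_int01 => x _; case: (w x) => a b /=; ring.
split=> [ug|[ur ui] phi tphi].
  split => phi tphi; have := ug phi tphi; rewrite /cintegral.
    by move=> /(congr1 (@complex.Re R)) /=; rewrite !RE.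
  by move=> /(congr1 (@complex.Im R)) /=; rewrite !IE.
apply/eqP; rewrite eq_complex /cintegral /= !RE !IE.
by rewrite ur// ui// !eqxx.
Qed.

Lemma dperP u g : dper (u, g) <->
  perprim (fun x => cRe (u x)) (fun x => cRe (g x)) /\
  perprim (fun x => cIm (u x)) (fun x => cIm (g x)).
Proof.
have [su si] := (Re_sqL2 u, Im_sqL2 u).
have [Lr Li] := (sqL2_L1 (Re_sqL2 g), sqL2_L1 (Im_sqL2 g)).
split.
  move=> [[_ [w [cr ci uw w01]]] /weak_derivP[/= ur ui]]; split; apply/perprimP => //.
    split => //; exists (fun x => cRe (w x)); split => //; last by rewrite w01.
    by apply: aeS uw => x uw Ix; rewrite uw.
  split => //; exists (fun x => cIm (w x)); split => //; last by rewrite w01.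
  by apply: aeS uw => x uw Ix; rewrite uw.
move=> [/(perprimP su Lr)[ur [wr [cr uwr wr01]]] /(perprimP si Li)[ui [wi [ci uwi wi01]]]].
have ug : weak_deriv u g by apply/weak_derivP.
split => //; split; first by exists g.
exists (fun x => wr x +i* wi x); split => //; last by rewrite wr01 wi01.
apply: aeS2 uwr uwi => x a b Ix /=; move: (a Ix) (b Ix).
by case: (u x) => [p q] /= -> ->.
Qed.

Lemma dperD u v g h : dper (u, g) -> dper (v, h) -> dper (u + v, g + h).
Proof.
move=> /dperP[ur ui] /dperP[vr vi]; apply/dperP; split.
  apply: (perprim_lin (a := 1) (b := 1)) ur vr;
    do ?[exact: sqL2_L1 (Re_sqL2 _)].
    by apply: aeS (L2_addE u v) => x H Ix; rewrite H// raddfD/= !mul1r.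
  by apply: aeS (L2_addE g h) => x H Ix; rewrite H// raddfD/= !mul1r.
apply: (perprim_lin (a := 1) (b := 1)) ui vi;
  do ?[exact: sqL2_L1 (Im_sqL2 _)].
  by apply: aeS (L2_addE u v) => x H Ix; rewrite H// raddfD/= !mul1r.
by apply: aeS (L2_addE g h) => x H Ix; rewrite H// raddfD/= !mul1r.
Qed.

Lemma dperZ (z : R[i]) u g : dper (u, g) -> dper (z *: u, z *: g).
Proof.
have ReM (p q : R[i]) : cRe (p * q) = cRe p * cRe q + (- cIm p) * cIm q.
  by case: p q => [a b] [c d] /=; ring.
have ImM (p q : R[i]) : cIm (p * q) = cIm p * cRe q + cRe p * cIm q.
  by case: p q => [a b] [c d] /=; ring.
move=> /dperP[ur ui]; apply/dperP; split.
  apply: (perprim_lin (a := cRe z) (b := - cIm z)) ur ui;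
    do ?[exact: sqL2_L1 (Re_sqL2 _) | exact: sqL2_L1 (Im_sqL2 _)].
    by apply: aeS (L2_scaleE z u) => x H Ix; rewrite H// ReM.
  by apply: aeS (L2_scaleE z g) => x H Ix; rewrite H// ReM.
apply: (perprim_lin (a := cIm z) (b := cRe z)) ur ui;
  do ?[exact: sqL2_L1 (Re_sqL2 _) | exact: sqL2_L1 (Im_sqL2 _)].
  by apply: aeS (L2_scaleE z u) => x H Ix; rewrite H// ImM.
by apply: aeS (L2_scaleE z g) => x H Ix; rewrite H// ImM.
Qed.

Lemma dper_skew u v g h : dper (u, g) -> dper (v, h) -> rip u h = - rip g v.
Proof.
move=> /dperP[ur ui] /dperP[vr vi].
rewrite /rip !int01D; do ?[apply: sqL2M; (exact: Re_sqL2 || exact: Im_sqL2)].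
rewrite (perprim_skew _ _ _ _ ur vr); do ?[exact: Re_sqL2].
by rewrite (perprim_skew _ _ _ _ ui vi) ?opprD//; exact: Im_sqL2.
Qed.

End Periodic_derivative.

Section Uniform_limit.
Context {R : realType}.
Local Notation mu := (@lebesgue_measure R).
Local Notation I01 := (@I01 R).
Implicit Types (f : nat -> R -> R).

(** The increments are truncated at [C * q ^ n], which makes the series converge
    at every point. *)
Lemma sqL2_uniform_limit f (C q : R) : 0 <= C -> 0 <= q < 1 ->
  (forall n, sqL2 (f n)) ->
  (forall n, \forall x \ae mu, I01 x -> `|f n.+1 x - f n x| <= C * q ^+ n) ->
  exists2 l, sqL2 l & forall n, \forall x \ae mu, I01 x ->
    `|l x - f n x| <= C / (1 - q) * q ^+ n.
Proof.
move=> C0 /andP[q0 q1] sf fq.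
have q1' : 0 < 1 - q by rewrite subr_gt0.
pose e n x := Num.max (- (C * q ^+ n)) (Num.min (C * q ^+ n) (f n.+1 x - f n x)).
have Cq n : 0 <= C * q ^+ n by rewrite mulr_ge0// exprn_ge0.
have eb n x : `|e n x| <= C * q ^+ n.
  by rewrite ler_norml /e le_max lexx/= ge_max ge_min lexx/= andbT; have := Cq n; lra.
have eE n : \forall x \ae mu, I01 x -> e n x = f n.+1 x - f n x.
  apply: aeS (fq n) => x H Ix; have := H Ix; rewrite ler_norml => /andP[a b].
  by rewrite /e min_r// max_r.
have me n : measurable_fun I01 (e n).
  apply: measurable_maxr => //; apply: measurable_minr => //.
  by apply: measurable_funB; [exact: (sf _).1|exact: (sf _).1].
pose s n x := f 0%N x + \sum_(k < n) e k x.
have sS n x : s n.+1 x = s n x + e n x by rewrite /s big_ord_recr/= addrA.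
have sE n : \forall x \ae mu, I01 x -> s n x = f n x.
  elim: n => [|n IH]; first by apply: aeW => x _; rewrite /s big_ord0 addr0.
  apply: aeS2 IH (eE n) => x IH eE' Ix; rewrite sS IH// eE'//; ring.
have sb n k x : `|s (n + k)%N x - s n x| <= C / (1 - q) * q ^+ n * (1 - q ^+ k).
  elim: k => [|k IH]; first by rewrite addn0 subrr normr0 expr0 subrr mulr0.
  rewrite addnS sS addrAC; apply: le_trans (ler_normD _ _) _.
  apply: le_trans (lerD IH (eb _ _)) _.
  rewrite le_eqVlt; apply/orP; left; apply/eqP; rewrite exprD exprS.
  by field; rewrite gt_eqF.
have sb' n m x : (n <= m)%N -> `|s m x - s n x| <= C / (1 - q) * q ^+ n.
  move=> nm; rewrite -(subnKC nm); apply: le_trans (sb _ _ _) _.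
  have K0 : 0 <= C / (1 - q) * q ^+ n.
    by rewrite mulr_ge0 ?exprn_ge0// divr_ge0// ltW.
  by apply: ler_piMr => //; rewrite lerBlDr lerDl exprn_ge0.
have s_cvg x : cvgn (s^~ x).
  have cs : cvgn (series (e^~ x)).
    apply: normed_cvg.
    apply: (@series_le_cvg _ _ (geometric C q)) => [n|n|n|].
    - exact: normr_ge0.
    - exact: geometric_ge0.
    - exact: eb.
    by apply: is_cvg_geometric_series; rewrite ger0_norm.
  rewrite (_ : s^~ x = fun n => f 0%N x + series (e^~ x) n); last first.
    by apply/funext => n; rewrite /s /series /= big_mkord.
  by apply: is_cvgD => //; exact: is_cvg_cst.
pose l x := limn (s^~ x).
have lb n x : `|l x - s n x| <= C / (1 - q) * q ^+ n.
  have h : `|s m x - s n x| @[m --> \oo] --> `|l x - s n x|.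
    by apply: cvg_norm; apply: cvgB; [exact: s_cvg|exact: cvg_cst].
  apply: (cvgr_to_le h).
  by near=> m; apply: sb'; near: m; exact: nbhs_infty_ge.
have ml : measurable_fun I01 l.
  apply: (@measurable_fun_cvg _ _ _ _ s) => [m|x _]; last exact: s_cvg.
  apply: measurable_funD; first exact: (sf 0%N).1.
  by apply: measurable_sum => k; exact: me.
exists l; last by move=> n; apply: aeS (sE n) => x sE' Ix; rewrite -sE'.
rewrite (_ : l = fun x => s 0%N x + (l x - s 0%N x)); last first.
  by apply/funext => x; rewrite addrC subrK.
have s0 : s 0%N = f 0%N by apply/funext => x; rewrite /s big_ord0 addr0.
apply: sqL2D; first by rewrite s0.
apply: (sqL2_le _ (sqL2_cst (C / (1 - q)))).
  by apply: measurable_funB => //; rewrite s0; exact: (sf 0%N).1.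
move=> x _; apply: le_trans (lb 0%N x) _; rewrite expr0 mulr1; exact: ler_norm.
Unshelve. all: by end_near. Qed.

End Uniform_limit.

(** * Pairs of functions *)

Section L2sq_inner.
Context {R : realType}.
Local Notation mu := (@lebesgue_measure R).
Local Notation I01 := (@I01 R).
Implicit Types (u v w g h : L2sq R).

Definition sip u v : R := rip u.1 v.1 + rip u.2 v.2.

Lemma sipC u v : sip u v = sip v u.
Proof. by rewrite /sip ripC (ripC u.2). Qed.

Lemma sipD u v w : sip (u + v) w = sip u w + sip v w.
Proof. by rewrite /sip /= !ripD; ring. Qed.

Lemma sipZ (a : R) u v : sip (a%:C *: u) v = a * sip u v.
Proof. by rewrite /sip /= !ripZ mulrDr. Qed.

Lemma sip_ge0 u : 0 <= sip u u.
Proof. by rewrite addr_ge0// rip_ge0. Qed.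

Lemma sip_im (t : R) u v : sip ((0 +i* t) *: u) v = - sip u ((0 +i* t) *: v).
Proof. by rewrite /sip /= !rip_im opprD. Qed.

Definition nrm u := ipnorm sip u.

Lemma L2sq_normE u : L2sq_norm u = nrm u.
Proof.
rewrite /L2sq_norm /nrm /ipnorm /sip !L2normE.
by rewrite !(sqr_ipnorm (@rip_ge0 R)).
Qed.

Definition nrm_ge0 u : 0 <= nrm u := ipnorm_ge0 sip u.
Definition sqr_nrm u : nrm u ^+ 2 = sip u u := sqr_ipnorm sip_ge0 u.
Definition nrmD u v : nrm (u + v) <= nrm u + nrm v :=
  ipnormD sipC sipD sipZ sip_ge0 u v.
Definition nrmB u v : nrm (u - v) <= nrm u + nrm v :=
  ipnormB sipC sipD sipZ sip_ge0 u v.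
Definition nrmN u : nrm (- u) = nrm u := ipnormN sipC sipZ u.
Definition nrmZ (a : R) u : nrm (a%:C *: u) = `|a| * nrm u :=
  ipnormZ sipC sipZ a u.
Definition sip_le u v : sip u v <= nrm u * nrm v :=
  ip_cauchy_schwarz sipC sipD sipZ sip_ge0 u v.

Lemma sipBl u v w : sip (u - v) w = sip u w - sip v w.
Proof. exact: (ipBl sipD sipZ). Qed.

Lemma sipBr u v w : sip u (v - w) = sip u v - sip u w.
Proof. by rewrite sipC sipBl !(sipC u). Qed.

Lemma nrm_le u (a : R) : 0 <= a -> sip u u <= a ^+ 2 -> nrm u <= a.
Proof. exact: (ipnorm_le sip_ge0). Qed.

Lemma nrm_eq0 u : nrm u = 0 -> u = 0.
Proof.
move=> u0; have : sip u u = 0 by rewrite -sqr_nrm u0 expr0n.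
move=> /eqP; rewrite /sip paddr_eq0 ?rip_ge0// => /andP[/eqP /rip_eq0 u1 /eqP /rip_eq0 u2].
by case: u u1 u2 {u0} => [a b] /= -> ->.
Qed.

Lemma nrm1 u : ipnorm (@rip R) u.1 <= nrm u.
Proof. by apply: ler_wsqrtr; rewrite lerDl rip_ge0. Qed.

Lemma nrm2 u : ipnorm (@rip R) u.2 <= nrm u.
Proof. by apply: ler_wsqrtr; rewrite lerDr rip_ge0. Qed.

Lemma nrm_sqr u : nrm u ^+ 2 = ipnorm (@rip R) u.1 ^+ 2 + ipnorm (@rip R) u.2 ^+ 2.
Proof. by rewrite sqr_nrm !(sqr_ipnorm (@rip_ge0 R)). Qed.

Lemma nrm_le_sum u : nrm u <= ipnorm (@rip R) u.1 + ipnorm (@rip R) u.2.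
Proof.
have [h1 h2] := (ipnorm_ge0 (@rip R) u.1, ipnorm_ge0 (@rip R) u.2).
apply: nrm_le; first exact: addr_ge0.
rewrite /sip -!(sqr_ipnorm (@rip_ge0 R)); nra.
Qed.

(** The graph of the operator [A_0]. *)
Definition pergraph u g := dper (u.2, g.1) /\ dper (u.1, g.2).

Lemma pergraphD u v g h : pergraph u g -> pergraph v h -> pergraph (u + v) (g + h).
Proof. by move=> [a b] [c d]; split; apply: dperD. Qed.

Lemma pergraphZ (z : R[i]) u g : pergraph u g -> pergraph (z *: u) (z *: g).
Proof. by move=> [a b]; split; apply: dperZ. Qed.

Lemma pergraphB u v g h : pergraph u g -> pergraph v h -> pergraph (u - v) (g - h).
Proof.
by move=> ug vh; rewrite -[- v]scaleN1r -[- h]scaleN1r; apply/pergraphD/pergraphZ.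
Qed.

Lemma pergraph_skew u g : pergraph u g -> sip g u = 0.
Proof.
move=> [a b]; have := dper_skew a b; rewrite /sip => h.
by rewrite [X in _ + X]ripC h subrr.
Qed.

End L2sq_inner.

Section Base_solver.
Context {R : realType}.
Local Notation mu := (@lebesgue_measure R).
Local Notation I01 := (@I01 R).
Local Notation N := (ipnorm (@rip R)).

Lemma dper_ode (r : R) (f : L2 R) : r != 0 ->
  exists v : L2 R, dper (v, r%:C *: v + f).
Proof.
move=> r0.
have [vr svr pr] := periodic_ode r0 (Re_sqL2 f).
have [vi svi pi_] := periodic_ode r0 (Im_sqL2 f).
have [v vE] := @L2_of R (fun x => vr x +i* vi x) svr svi.
exists v; apply/dperP.
have rvf : \forall x \ae mu, I01 x -> L2_fun (r%:C *: v + f) x = r%:C * v x + f x.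
  apply: aeS2 (L2_addE (r%:C *: v) f) (L2_scaleE r%:C v) => x a b Ix.
  by rewrite a// b.
have Lr : L1 (fun x => r * vr x + cRe (f x)).
  by apply: L1D; [apply: L1Z; exact: sqL2_L1|exact: sqL2_L1 (Re_sqL2 _)].
have Li : L1 (fun x => r * vi x + cIm (f x)).
  by apply: L1D; [apply: L1Z; exact: sqL2_L1|exact: sqL2_L1 (Im_sqL2 _)].
split.
  refine (perprim_lin (a := 1) (b := 0) Lr Lr (sqL2_L1 (Re_sqL2 _)) _ _ pr pr).
    by apply: aeS vE => x vE Ix; rewrite vE//= mul1r mul0r addr0.
  apply: aeS2 vE rvf => x vE rE Ix; rewrite rE// vE// mul1r mul0r addr0.
  by case: (f x) => a b /=; ring.
refine (perprim_lin (a := 1) (b := 0) Li Li (sqL2_L1 (Im_sqL2 _)) _ _ pi_ pi_).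
  by apply: aeS vE => x vE Ix; rewrite vE//= mul1r mul0r addr0.
apply: aeS2 vE rvf => x vE rE Ix; rewrite rE// vE// mul1r mul0r addr0.
by case: (f x) => a b /=; ring.
Qed.

Lemma dper_resolvent (l s : R) (k : L2 R) : l != 0 -> s != 0 ->
  exists v : L2 R, dper (v, s%:C *: (l%:C *: v - k)).
Proof.
move=> l0 s0; have [|v dv] := @dper_ode (s * l) (- (s%:C *: k)); first exact: mulf_neq0.
exists v; move: dv; congr (dper (_, _)).
by rewrite scalerBr scalerA rmorphM.
Qed.

(** The system decouples into one scalar equation for the sum [p] of the
    components and one for their difference [q]; [k] and [m] are the halves of
    the sum and of the difference of the right-hand sides. *)
Lemma base_solver (l e : R) (h : L2sq R) : 0 < l -> 0 < e ->
  exists u : L2sq R, pergraph u (e%:C *: (l%:C *: u - h)).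
Proof.
move=> l0 e0.
have two : (2^-1 + 2^-1 : R[i]) = 1 by rewrite -mulr2n -(mulr_natl 2^-1) divff// pnatr_eq0.
pose k := 2^-1 *: (h.1 + h.2); pose m := 2^-1 *: (h.1 - h.2).
have h1 : h.1 = k + m.
  rewrite /k /m -scalerDr addrACA subrr addr0 scalerDr -scalerDl two scale1r//.
have h2 : h.2 = k - m.
  rewrite /k /m -scalerBr opprB [h.1 + h.2]addrC addrACA subrr addr0 scalerDr -scalerDl two scale1r//.
have [p dp] := @dper_resolvent l e k (lt0r_neq0 l0) (lt0r_neq0 e0).
have [|q dq] := @dper_resolvent l (- e) m (lt0r_neq0 l0); first by rewrite oppr_eq0 gt_eqF.
exists (p + q, p - q); split => /=.
  have := dperD dp (dperZ (-1) dq); rewrite !scaleN1r.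
  congr (dper (_, _)); rewrite rmorphN scaleNr opprK h1 -scalerDr; congr (_ *: _).
  by rewrite scalerDr opprD addrACA.
have := dperD dp dq.
congr (dper (_, _)); rewrite rmorphN scaleNr h2 -scalerBr; congr (_ *: _).
by rewrite scalerBr !opprD !opprK addrACA.
Qed.

Lemma int01_norm_le (f : R -> R) : sqL2 f ->
  int01 (fun x => `|f x|) ^+ 2 <= int01 (fun x => f x ^+ 2).
Proof.
move=> sf.
have sn : sqL2 (fun x => `|f x|).
  apply: (sqL2_le _ sf) => [|x _]; last by rewrite normr_id.
  by apply: measurableT_comp => //; exact: sf.1.
have := cauchy_schwarz01 sn (sqL2_cst 1).
rewrite (_ : (fun x => `|f x| * 1) = fun x => `|f x|); last by apply/funext => x; rewrite mulr1.
rewrite int01_cst expr1n mulr1 => /le_trans; apply.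
by rewrite le_eqVlt; apply/orP; left; apply/eqP/eq_int01 => x _; rewrite real_normK// num_real.
Qed.

Lemma int01_Re_le (u : L2 R) : int01 (fun x => `|cRe (u x)|) <= N u.
Proof.
have i0 : 0 <= int01 (fun x => `|cRe (u x)|) by apply: int01_ge0.
rewrite -ler_sqr ?nnegrE ?ipnorm_ge0// (sqr_ipnorm (@rip_ge0 R)).
apply: le_trans (int01_norm_le (Re_sqL2 u)) _.
apply: le_int01; [exact: (Re_sqL2 u).2|exact: rip_L1|].
by apply: aeW => x _; rewrite -!expr2 lerDl sqr_ge0.
Qed.

Lemma int01_Im_le (u : L2 R) : int01 (fun x => `|cIm (u x)|) <= N u.
Proof.
have i0 : 0 <= int01 (fun x => `|cIm (u x)|) by apply: int01_ge0.
rewrite -ler_sqr ?nnegrE ?ipnorm_ge0// (sqr_ipnorm (@rip_ge0 R)).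
apply: le_trans (int01_norm_le (Im_sqL2 u)) _.
apply: le_int01; [exact: (Im_sqL2 u).2|exact: rip_L1|].
by apply: aeW => x _; rewrite -!expr2 lerDr sqr_ge0.
Qed.

(** A bound in the supremum norm, by which the limit of a sequence of solutions
    can be taken pointwise. *)
Lemma dper_sup (u g : L2 R) : dper (u, g) ->
  \forall x \ae mu, I01 x ->
    `|cRe (u x)| <= N u + 2 * N g /\ `|cIm (u x)| <= N u + 2 * N g.
Proof.
move=> /dperP[ur ui].
apply: aeS2 (perprim_sup (Re_sqL2 u) (Re_sqL2 g) ur)
  (perprim_sup (Im_sqL2 u) (Im_sqL2 g) ui) => x a b Ix.
split.
  apply: le_trans (a Ix) _; apply: lerD; last by rewrite ler_pM2l// int01_Re_le.
  apply: le_trans (le_norm_int01 (sqL2_L1 (Re_sqL2 u))) _; exact: int01_Re_le.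
apply: le_trans (b Ix) _; apply: lerD; last by rewrite ler_pM2l// int01_Im_le.
apply: le_trans (le_norm_int01 (sqL2_L1 (Im_sqL2 u))) _; exact: int01_Im_le.
Qed.

Lemma L2_limit (v : nat -> L2 R) (C q : R) : 0 <= C -> 0 <= q < 1 ->
  (forall n, \forall x \ae mu, I01 x ->
    `|cRe (v n.+1 x) - cRe (v n x)| <= C * q ^+ n /\
    `|cIm (v n.+1 x) - cIm (v n x)| <= C * q ^+ n) ->
  exists l, forall n, N (l - v n) <= 2 * (C / (1 - q) * q ^+ n).
Proof.
move=> C0 q01 vq; have /andP[q0 q1] := q01.
have [|lr slr lrE] := @sqL2_uniform_limit R (fun n x => cRe (v n x)) C q C0 q01
    (fun n => Re_sqL2 (v n)).
  by move=> n; apply: aeS (vq n) => x H Ix; have [] := H Ix.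
have [|li sli liE] := @sqL2_uniform_limit R (fun n x => cIm (v n x)) C q C0 q01
    (fun n => Im_sqL2 (v n)).
  by move=> n; apply: aeS (vq n) => x H Ix; have [] := H Ix.
have [l lE] := @L2_of R (fun x => lr x +i* li x) slr sli.
exists l => n; set b := C / (1 - q) * q ^+ n.
have b0 : 0 <= b by rewrite mulr_ge0 ?exprn_ge0// divr_ge0// subr_ge0 ltW.
apply: (ipnorm_le (@rip_ge0 R)); first by rewrite mulr_ge0.
rewrite -[leRHS]int01_cst; apply: le_int01; [exact: rip_L1|exact: L1_cst|].
have dE : \forall x \ae mu, I01 x -> L2_fun (l - v n) x = (lr x +i* li x) - v n x.
  by apply: aeS2 (L2_subE l (v n)) lE => x H lE Ix; rewrite H// lE.
have bE := aeI (lrE n) (liE n).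
apply: aeS2 dE bE => x dE H Ix.
have := H Ix; rewrite dE//; case: (v n x) => [c d] /=; rewrite !ler_norml -/b.
by move=> [/andP[? ?] /andP[? ?]]; nra.
Qed.

End Base_solver.

(** * Existence for coercive multipliers *)

Lemma subrBACA (V : zmodType) (x y z t : V) : x - y - (z - t) = (x - z) - (y - t).
Proof. by rewrite !opprD !opprK addrACA. Qed.

Section Coercive.
Context {R : realType}.
Local Notation mu := (@lebesgue_measure R).
Local Notation I01 := (@I01 R).
Implicit Types (u v w g h d f : L2sq R) (l e q : R).

(** [pergraph w (e * (l * w - d))] says that [(l - e^-1 A_0) w = d]; as [A_0] is
    skew-symmetric, testing with [w] gives the bound. *)
Lemma resolvent_bound l e w d : 0 < l -> 0 < e ->
  pergraph w (e%:C *: (l%:C *: w - d)) -> l * nrm w <= nrm d.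
Proof.
move=> l0 e0 /pergraph_skew.
rewrite sipZ sipBl sipZ => /eqP.
rewrite mulf_eq0 gt_eqF//= subr_eq0 -sqr_nrm => /eqP H.
have := sip_le d w; rewrite -H expr2 mulrA.
have := nrm_ge0 w; rewrite le_eqVlt => /predU1P[<- _|w0].
  by rewrite mulr0 nrm_ge0.
by rewrite ler_pM2r.
Qed.

Lemma pergraph_diff l e u v h d :
  pergraph u (e%:C *: (l%:C *: u - h)) -> pergraph v (e%:C *: (l%:C *: v - d)) ->
  pergraph (u - v) (e%:C *: (l%:C *: (u - v) - (h - d))).
Proof.
move=> uh vd; have := pergraphB uh vd.
congr (pergraph _ _); rewrite -scalerBr; congr (_ *: _).
by rewrite scalerBr subrBACA.
Qed.

Lemma pergraph_sup w g (a : R) : pergraph w g -> nrm w + 2 * nrm g <= a ->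
  \forall x \ae mu, I01 x ->
    (`|cRe (w.1 x)| <= a /\ `|cIm (w.1 x)| <= a) /\
    (`|cRe (w.2 x)| <= a /\ `|cIm (w.2 x)| <= a).
Proof.
move=> [/dper_sup D2 /dper_sup D1] wga.
have [w1 w2] := (nrm1 w, nrm2 w); have [g1 g2] := (nrm1 g, nrm2 g).
apply: aeS2 D1 D2 => x H1 H2 Ix; have [a1 b1] := H1 Ix; have [a2 b2] := H2 Ix.
have le2 (s p : R) : s <= nrm w -> p <= nrm g -> s + 2 * p <= a.
  by move=> sw pg; apply: le_trans wga; apply: lerD => //; rewrite ler_pM2l.
split; split.
- exact: le_trans a1 (le2 _ _ w1 g2).
- exact: le_trans b1 (le2 _ _ w1 g2).
- exact: le_trans a2 (le2 _ _ w2 g1).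
- exact: le_trans b2 (le2 _ _ w2 g1).
Qed.

Lemma L2sq_limit (v : nat -> L2sq R) (C q : R) : 0 <= C -> 0 <= q < 1 ->
  (forall n, \forall x \ae mu, I01 x ->
    (`|cRe (L2_fun (v n.+1 - v n).1 x)| <= C * q ^+ n /\
     `|cIm (L2_fun (v n.+1 - v n).1 x)| <= C * q ^+ n) /\
    (`|cRe (L2_fun (v n.+1 - v n).2 x)| <= C * q ^+ n /\
     `|cIm (L2_fun (v n.+1 - v n).2 x)| <= C * q ^+ n)) ->
  exists z, forall n, nrm (z - v n) <= 4 * (C / (1 - q)) * q ^+ n.
Proof.
move=> C0 q01 vq.
have [|l1 E1] := @L2_limit R (fun n => (v n).1) C q C0 q01.
  move=> n; apply: aeS2 (vq n) (L2_subE (v n.+1).1 (v n).1) => x H H' Ix.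
  by have [] := H Ix; rewrite /= H'// !raddfB.
have [|l2 E2] := @L2_limit R (fun n => (v n).2) C q C0 q01.
  move=> n; apply: aeS2 (vq n) (L2_subE (v n.+1).2 (v n).2) => x H H' Ix.
  by have [_] := H Ix; rewrite /= H'// !raddfB.
exists (l1, l2) => n; apply: le_trans (nrm_le_sum _) _ => /=.
have := E1 n; have := E2 n; lra.
Qed.

Lemma geometric_le0 (a K q : R) : 0 <= q < 1 -> (forall n, a <= K * q ^+ n) -> a <= 0.
Proof.
move=> /andP[q0 q1] aK.
have h : K * q ^+ n @[n --> \oo] --> (0 : R).
  rewrite -[X in _ --> X](mulr0 K); apply: cvgM; first exact: cvg_cst.
  by apply: cvg_expr; rewrite ger0_norm.
by apply: (cvgr_to_ge h); apply: nearW => n; exact: aK.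
Qed.

(** With [l] large, [T - l] has norm at most [q * l] for some [q < 1], while the
    inverse [S] of [l - e^-1 A_0] has norm at most [l^-1]. So [S \o Phi], with
    [Phi u = f - (T - l) u], is a contraction, and its fixed points are the
    solutions. The iterates converge geometrically in [L^2], hence uniformly
    because [S] is bounded into the supremum norm; the fixed point is their
    pointwise limit. *)
Lemma coercive_solvable (T : L2sq R -> L2sq R) (B gamma e : R) :
  0 < gamma -> 0 < e ->
  (forall u v, T (u - v) = T u - T v) -> (forall u, nrm (T u) <= B * nrm u) ->
  (forall u, gamma * nrm u ^+ 2 <= sip (T u) u) ->
  forall f, exists u g, pergraph u g /\ T u - (e^-1)%:C *: g = f.
Proof.
move=> gamma0 e0 TB Tb Tc f.
pose l := B ^+ 2 / gamma + 2 * gamma.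
have lg : gamma < l.
  by rewrite /l ltr_wpDl ?divr_ge0 ?sqr_ge0 ?(ltW gamma0)//; lra.
have l0 : 0 < l by exact: lt_trans lg.
pose kappa := 2 * l * gamma - B ^+ 2.
have kappaE : kappa = B ^+ 2 + 4 * gamma ^+ 2.
  by rewrite /kappa /l; field; rewrite gt_eqF.
have kappa0 : 0 < kappa.
  by rewrite kappaE ltr_wpDl ?sqr_ge0// mulr_gt0// exprn_gt0.
have lk : 0 <= l ^+ 2 - kappa.
  have lE : l ^+ 2 - kappa = (l - gamma) ^+ 2 - gamma ^+ 2 + B ^+ 2.
    by rewrite /kappa; ring.
  rewrite lE addr_ge0 ?sqr_ge0// subr_ge0 ler_sqr ?nnegrE ?subr_ge0 ?(ltW lg) ?(ltW gamma0)//.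
  by rewrite /l (_ : _ - gamma = B ^+ 2 / gamma + gamma) ?lerDr ?divr_ge0 ?sqr_ge0 ?(ltW gamma0)//; ring.
pose q := Num.sqrt (l ^+ 2 - kappa) / l.
have q0 : 0 <= q by rewrite divr_ge0// ?sqrtr_ge0// ltW.
have q1 : q < 1.
  rewrite ltr_pdivrMr// mul1r -ltr_sqr ?nnegrE ?sqrtr_ge0 ?(ltW l0)//.
  by rewrite sqr_sqrtr// gtrBl.
have q01 : 0 <= q < 1 by rewrite q0.
have contr u : nrm (T u - l%:C *: u) <= q * l * nrm u.
  apply: nrm_le; first by rewrite mulr_ge0 ?nrm_ge0// mulr_ge0// ltW.
  have s2 : (q * l * nrm u) ^+ 2 = (l ^+ 2 - kappa) * nrm u ^+ 2.
    by rewrite /q divfK ?gt_eqF// exprMn sqr_sqrtr.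
  rewrite {}s2 sipBl !sipBr !sipZ [sip (T u) (_ *: _)]sipC [sip u (_ *: _)]sipC !sipZ.
  rewrite (sipC u (T u)) -!sqr_nrm.
  have h2 := Tc u; have h1 : nrm (T u) ^+ 2 <= B ^+ 2 * nrm u ^+ 2.
    by rewrite -exprMn; have := Tb u; have := nrm_ge0 (T u); nra.
  rewrite /kappa; move: h1 h2; set a := nrm u ^+ 2; set b := sip _ _; set c := nrm _ ^+ 2.
  by move=> h1 h2; nra.
have [S SE] := choice (fun h => @base_solver R l e h l0 e0).
pose Phi u := f - (T u - l%:C *: u).
have PhiB u v : nrm (Phi u - Phi v) <= q * l * nrm (u - v).
  rewrite (_ : Phi u - Phi v = - (T (u - v) - l%:C *: (u - v))).
    by rewrite nrmN; exact: contr.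
  by rewrite /Phi TB scalerBr [LHS]subrBACA subrr sub0r; congr (- _); exact: subrBACA.
have SB u v : pergraph (S u - S v) (e%:C *: (l%:C *: (S u - S v) - (u - v))).
  exact: pergraph_diff.
have Sb u v : l * nrm (S u - S v) <= nrm (u - v).
  exact: resolvent_bound (SB u v).
have SPhi u v : nrm (S (Phi u) - S (Phi v)) <= q * nrm (u - v).
  rewrite -(ler_pM2l l0); apply: le_trans (Sb _ _) _; apply: le_trans (PhiB _ _) _.
  by rewrite le_eqVlt; apply/orP; left; apply/eqP; ring.
pose v n := iter n (S \o Phi) (S (Phi 0)).
have vS n : v n.+1 = S (Phi (v n)) by [].
pose d0 := nrm (v 1%N - v 0%N).
have dn n : nrm (v n.+1 - v n) <= q ^+ n * d0.
  elim: n => [|n IH]; first by rewrite expr0 mul1r.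
  rewrite vS [in X in _ - X]vS; apply: le_trans (SPhi _ _) _.
  by rewrite exprS -mulrA ler_wpM2l.
pose C := (l^-1 + 4 * e) * (l * d0).
have d00 : 0 <= d0 by exact: nrm_ge0.
have A0 : 0 <= l^-1 + 4 * e.
  by apply: addr_ge0; [rewrite invr_ge0 ltW|rewrite mulr_ge0// ltW].
have C0 : 0 <= C by apply: mulr_ge0 => //; apply: mulr_ge0 => //; exact: ltW.
have [|z zE] := @L2sq_limit (fun n => v n.+1) C q C0 q01.
  move=> n; apply: (pergraph_sup (SB (Phi (v n.+1)) (Phi (v n)))).
  rewrite nrmZ gtr0_norm//.
  have h1 := Sb (Phi (v n.+1)) (Phi (v n)).
  have h2 := PhiB (v n.+1) (v n).
  set w := S _ - S _ in h1 *; set d := Phi _ - Phi _ in h1 h2 *.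
  have h3 := nrmB (l%:C *: w) d; rewrite nrmZ gtr0_norm// in h3.
  have h4 : nrm d <= l * d0 * q ^+ n.
    apply: le_trans h2 _; rewrite (_ : l * d0 * _ = l * (q ^+ n * d0)); last by ring.
    rewrite [q * l]mulrC -mulrA ler_pM2l//.
    apply: le_trans (_ : q * (q ^+ n * d0) <= _); first by rewrite ler_wpM2l.
    by apply: ler_piMl; [apply: mulr_ge0 => //; exact: exprn_ge0|exact: ltW].
  have h5 : nrm w <= l^-1 * nrm d by rewrite ler_pdivlMl.
  apply: (@le_trans _ _ ((l^-1 + 4 * e) * nrm d)); first by nra.
  rewrite /C -[leRHS]mulrA; exact: ler_wpM2l.
pose K := 4 * (C / (1 - q)).
have K0 : 0 <= K by rewrite mulr_ge0// divr_ge0// subr_ge0 ltW.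
have fix_z : S (Phi z) = z.
  apply/eqP; rewrite -subr_eq0; apply/eqP/nrm_eq0/eqP.
  rewrite eq_le nrm_ge0 andbT; apply: (geometric_le0 (K := 2 * K) q01) => n.
  rewrite -(subrKA (v n.+2)); apply: le_trans (nrmD _ _) _.
  have := zE n; have := zE n.+1; rewrite -/K => E1 E2.
  have E3 : nrm (v n.+2 - z) <= K * q ^+ n.
    rewrite -nrmN opprB; apply: le_trans E1 _.
    by rewrite ler_wpM2l// exprS ler_piMl ?exprn_ge0// ltW.
  have E4 : nrm (S (Phi z) - v n.+2) <= K * q ^+ n.
    rewrite vS; apply: le_trans (SPhi _ _) _.
    apply: le_trans (_ : q * (K * q ^+ n) <= _); first by rewrite ler_wpM2l.
    by apply: ler_piMl; [apply: mulr_ge0 => //; exact: exprn_ge0|exact: ltW].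
  apply: le_trans (lerD E4 E3) _; rewrite -mulrDl.
  by rewrite le_eqVlt; apply/orP; left; apply/eqP; ring.
exists z, (e%:C *: (l%:C *: z - Phi z)); split; first by have := SE (Phi z); rewrite fix_z.
rewrite scalerA -rmorphM mulVf ?gt_eqF// scale1r /Phi.
by rewrite opprB opprB -[X in _ + X]addrA [_ - T z - _]addrAC subrr sub0r addrCA subrr addr0.
Qed.
End Coercive.

(** * Matrix multipliers *)

Section Quadratic_form.
Local Open Scope sesquilinear_scope.
Context {R : realType}.
Implicit Types (p q z w : R[i]) (A : 'M[R[i]]_2).

Definition nsq z : R := cRe z ^+ 2 + cIm z ^+ 2.

Definition redot z w : R := cRe z * cRe w + cIm z * cIm w.

Definition qform A p q : R :=
  redot (A 0 0 * p + A 0 1 * q) p + redot (A 1 0 * p + A 1 1 * q) q.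

Lemma psdmxP (gamma : R) A : psdmx (Remx A - (gamma%:C)%:M) <->
  forall p q, gamma * (nsq p + nsq q) <= qform A p q.
Proof.
have half : (2^-1 : R[i]) = (2^-1 : R)%:C by rewrite fmorphV rmorphMn rmorph1.
have E (v : 'cV[R[i]]_2) : (v ^t* *m (Remx A - (gamma%:C)%:M) *m v) 0 0 =
    (qform A (v 0 0) (v 1 0) - gamma * (nsq (v 0 0) + nsq (v 1 0)))%:C.
  rewrite !mxE !big_ord_recl !big_ord0 /=.
  rewrite !mxE !big_ord_recl !big_ord0 /= !mxE /= half.
  have -> : lift ord0 ord0 = 1 :> 'I_2 by apply/val_inj.
  have -> : ord0 = 0 :> 'I_2 by apply/val_inj.
  rewrite !mulr1n !mulr0n /qform /redot /nsq.
  case: (v 0 0) (v 1 0) => [p1 p2] [q1 q2].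
  case: (A 0 0) (A 0 1) (A 1 0) (A 1 1) => [a1 a2] [b1 b2] [c1 c2] [d1 d2].
  by apply/eqP; rewrite eq_complex /=; apply/andP; split; apply/eqP; field.
split=> [psd p q|qf v].
  pose v : 'cV[R[i]]_2 := \col_i (if i == 0 then p else q).
  have := psd v; rewrite E !mxE /= lecR subr_ge0.
  exact.
by rewrite E lecR subr_ge0.
Qed.

End Quadratic_form.

Section Multiplier.
Context {R : realType}.
Local Notation mu := (@lebesgue_measure R).
Local Notation I01 := (@I01 R).
Implicit Types (M : R -> 'M[R[i]]_2) (u v w : L2sq R) (b gamma : R).

(** What is used of the class of coefficients. Its real quadratic form is real
    linear in the entries, so that it passes to averages. *)
Definition bounded_coercive b gamma M := [/\
  forall i j, cmeasurable I01 (fun x => M x i j),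
  forall i j, \forall x \ae mu, I01 x ->
    `|cRe (M x i j)| <= b /\ `|cIm (M x i j)| <= b &
  \forall x \ae mu, I01 x ->
    forall p q, gamma * (nsq p + nsq q) <= qform (M x) p q].

Lemma L2_mul (m : R -> R[i]) b (f : L2 R) : cmeasurable I01 m ->
  (\forall x \ae mu, I01 x -> `|cRe (m x)| <= b /\ `|cIm (m x)| <= b) ->
  exists g : L2 R, \forall x \ae mu, I01 x -> g x = m x * f x.
Proof.
move=> [mr mi] mb.
have mrb : \forall x \ae mu, I01 x -> `|cRe (m x)| <= b.
  by apply: aeS mb => x H Ix; have [] := H Ix.
have mib : \forall x \ae mu, I01 x -> `|cIm (m x)| <= b.
  by apply: aeS mb => x H Ix; have [] := H Ix.
apply: L2_of.
  rewrite (_ : (fun x => _) = fun x => cRe (m x) * cRe (f x) - cIm (m x) * cIm (f x)).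
    apply: sqL2B; apply: sqL2_mul; eauto; [exact: Re_sqL2|exact: Im_sqL2].
  by apply/funext => x; case: (m x) (f x) => [a1 a2] [b1 b2].
rewrite (_ : (fun x => _) = fun x => cRe (m x) * cIm (f x) + cIm (m x) * cRe (f x)).
  apply: sqL2D; apply: sqL2_mul; eauto; [exact: Im_sqL2|exact: Re_sqL2].
by apply/funext => x; case: (m x) (f x) => [a1 a2] [b1 b2].
Qed.

Lemma mulopP M u w : mulop M (u, w) <->
  (\forall x \ae mu, I01 x -> w.1 x = M x 0 0 * u.1 x + M x 0 1 * u.2 x) /\
  (\forall x \ae mu, I01 x -> w.2 x = M x 1 0 * u.1 x + M x 1 1 * u.2 x).
Proof.
have l01 : lift ord0 ord0 = 1 :> 'I_2 by apply/val_inj.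
have l0 : ord0 = 0 :> 'I_2 by apply/val_inj.
have E x (i : 'I_2) : (M x *m L2sq_col u x) i 0 = M x i 0 * u.1 x + M x i 1 * u.2 x.
  by rewrite !mxE !big_ord_recl big_ord0 /= !mxE l01 l0 addr0.
split=> [H|[H1 H2]].
  split; apply: aeS H => x H Ix; have := H Ix.
    by move=> /(congr1 (fun A : 'cV[R[i]]_2 => A 0 0)); rewrite E mxE.
  by move=> /(congr1 (fun A : 'cV[R[i]]_2 => A 1 0)); rewrite E mxE.
apply: aeS2 H1 H2 => x H1 H2 Ix.
apply/matrixP => i j; rewrite ord1 E mxE /=.
case: i => -[|[|//]] lti.
  by rewrite (_ : Ordinal lti = 0) ?eqxx ?H1//; exact/val_inj.
by rewrite (_ : Ordinal lti = 1) ?H2//; exact/val_inj.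
Qed.

Lemma mulop_ex b gamma M u : bounded_coercive b gamma M -> exists w, mulop M (u, w).
Proof.
move=> [mM bM _].
have [w00 E00] := L2_mul u.1 (mM 0 0) (bM 0 0).
have [w01 E01] := L2_mul u.2 (mM 0 1) (bM 0 1).
have [w10 E10] := L2_mul u.1 (mM 1 0) (bM 1 0).
have [w11 E11] := L2_mul u.2 (mM 1 1) (bM 1 1).
exists (w00 + w01, w10 + w11); apply/mulopP; split => /=.
  apply: aeS2 (L2_addE w00 w01) (aeI E00 E01) => x H H' Ix.
  by have [<- <-] := H' Ix; rewrite H.
apply: aeS2 (L2_addE w10 w11) (aeI E10 E11) => x H H' Ix.
by have [<- <-] := H' Ix; rewrite H.
Qed.

Lemma mulop_uniq M u w w' : mulop M (u, w) -> mulop M (u, w') -> w = w'.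
Proof.
move=> /mulopP[a1 a2] /mulopP[b1 b2].
case: w w' a1 a2 b1 b2 => [w1 w2] [v1 v2] /= a1 a2 b1 b2.
congr (_, _); apply/L2_ext.
  by apply: aeS2 a1 b1 => x a b Ix; rewrite a// b.
by apply: aeS2 a2 b2 => x a b Ix; rewrite a// b.
Qed.

Lemma mulop_lin M (z : R[i]) u v u' v' : mulop M (u, u') -> mulop M (v, v') ->
  mulop M (z *: u + v, z *: u' + v').
Proof.
have linE (f g : L2 R) : \forall x \ae mu, I01 x -> L2_fun (z *: f + g) x = z * f x + g x.
  by apply: aeS2 (L2_addE (z *: f) g) (L2_scaleE z f) => x H H' Ix; rewrite H// H'.
move=> H1 H2; have F : Filter (almost_everywhere mu) by exact: ae_filter_ringOfSetsType.
have E1 := linE u.1 v.1; have E2 := linE u.2 v.2.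
have E3 := linE u'.1 v'.1; have E4 := linE u'.2 v'.2.
apply/mulopP; move/mulopP: H1 => [a1 a2]; move/mulopP: H2 => [b1 b2]; split => /=.
  apply: (filterS3 _ _ (aeI a1 b1)
   (aeI E1 E2) E3) => x A B C Ix.
  have [A1 A2] := A Ix; have [B1 B2] := B Ix.
  by rewrite C// A1 A2 B1 B2; ring.
apply: (filterS3 _ _ (aeI a2 b2)
   (aeI E1 E2) E4) => x A B C Ix.
have [A1 A2] := A Ix; have [B1 B2] := B Ix.
by rewrite C// A1 A2 B1 B2; ring.
Qed.

Lemma mulopB M u v u' v' : mulop M (u, u') -> mulop M (v, v') ->
  mulop M (u - v, u' - v').
Proof.
move=> h h'; have := mulop_lin (-1) h' h; rewrite !scaleN1r.
by rewrite [- v + u]addrC [- v' + u']addrC.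
Qed.

Lemma sip_int u v : sip u v =
  int01 (fun x => redot (u.1 x) (v.1 x) + redot (u.2 x) (v.2 x)).
Proof. by rewrite /sip /rip -int01D//; exact: rip_L1. Qed.

Lemma sip_L1 u v : L1 (fun x => redot (u.1 x) (v.1 x) + redot (u.2 x) (v.2 x)).
Proof. by apply: L1D; exact: rip_L1. Qed.

Lemma redotxx (z : R[i]) : redot z z = nsq z.
Proof. by rewrite /redot /nsq !expr2. Qed.

Lemma nsq_mul_le b (m n p q : R[i]) :
  `|cRe m| <= b /\ `|cIm m| <= b -> `|cRe n| <= b /\ `|cIm n| <= b ->
  nsq (m * p + n * q) <= 4 * b ^+ 2 * (nsq p + nsq q).
Proof.
case: m n p q => [m1 m2] [n1 n2] [p1 p2] [q1 q2]; rewrite /nsq /= => -[a1 a2] [a3 a4].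
have sq (t : R) : `|t| <= b -> t ^+ 2 <= b ^+ 2.
  by move=> tb; rewrite -[t ^+ 2]real_normK ?num_real// ler_sqr ?nnegrE// (le_trans _ tb).
move: (sq _ a1) (sq _ a2) (sq _ a3) (sq _ a4).
pose P := p1 ^+ 2 + p2 ^+ 2; pose Q := q1 ^+ 2 + q2 ^+ 2.
have [P0 Q0] : 0 <= P /\ 0 <= Q by rewrite !addr_ge0 ?sqr_ge0.
move=> h1 h2 h3 h4.
have k1 : (m1 ^+ 2 + m2 ^+ 2) * P <= 2 * b ^+ 2 * P by apply: ler_wpM2r => //; lra.
have k2 : (n1 ^+ 2 + n2 ^+ 2) * Q <= 2 * b ^+ 2 * Q by apply: ler_wpM2r => //; lra.
apply: (@le_trans _ _ (2 * ((m1 ^+ 2 + m2 ^+ 2) * P) + 2 * ((n1 ^+ 2 + n2 ^+ 2) * Q))); last first.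
  by rewrite -/P -/Q; lra.
rewrite /P /Q -subr_ge0.
pose A := m1 * p1 - m2 * p2 - (n1 * q1 - n2 * q2).
pose B := m1 * p2 + m2 * p1 - (n1 * q2 + n2 * q1).
rewrite (_ : _ - _ = A ^+ 2 + B ^+ 2); last by rewrite /A /B; ring.
by rewrite addr_ge0 ?sqr_ge0.
Qed.

Lemma mulop_bound b gamma M u w : 0 <= b -> bounded_coercive b gamma M ->
  mulop M (u, w) -> nrm w <= 3 * b * nrm u.
Proof.
move=> b0 [_ bM _] /mulopP[w1 w2].
have b9 : 4 * b ^+ 2 + 4 * b ^+ 2 <= (3 * b) ^+ 2.
  by rewrite exprMn; have := sqr_ge0 b; lra.
apply: nrm_le; first by rewrite !mulr_ge0 ?nrm_ge0.
rewrite exprMn sqr_nrm !sip_int -int01Z; last exact: sip_L1.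
apply: le_int01; [exact: sip_L1|apply: L1Z; exact: sip_L1|].
apply: aeS2 (aeI (aeI w1 w2) (aeI (bM 0 0) (bM 0 1))) (aeI (bM 1 0) (bM 1 1)).
move=> x H1 H2 Ix; have [[a1 a2] [a3 a4]] := H1 Ix; have [a5 a6] := H2 Ix.
rewrite !redotxx a1// a2//.
have := nsq_mul_le (u.1 x) (u.2 x) a3 a4.
have := nsq_mul_le (u.1 x) (u.2 x) a5 a6.
set P := nsq (u.1 x) + nsq (u.2 x) => h1 h2.
apply: le_trans (lerD h2 h1) _; rewrite -mulrDl.
have P0 : 0 <= P by rewrite !addr_ge0 ?sqr_ge0.
exact: ler_wpM2r.
Qed.

Lemma mulop_coercive b gamma M u w : bounded_coercive b gamma M ->
  mulop M (u, w) -> gamma * nrm u ^+ 2 <= sip w u.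
Proof.
move=> [_ _ cM] /mulopP[w1 w2].
rewrite sqr_nrm !sip_int -int01Z; last exact: sip_L1.
apply: le_int01; [apply: L1Z; exact: sip_L1|exact: sip_L1|].
apply: aeS2 (aeI w1 w2) cM => x a cMx Ix; have [a1 a2] := a Ix.
by rewrite !redotxx a1// a2//; exact: cMx.
Qed.

Lemma entry_L1 b gamma M i j : bounded_coercive b gamma M ->
  L1 (fun x => cRe (M x i j)) /\ L1 (fun x => cIm (M x i j)).
Proof.
move=> [mM bM _].
have L (f : R -> R) : measurable_fun I01 f -> (\forall x \ae mu, I01 x -> `|f x| <= b) -> L1 f.
  move=> mf fb; have := sqL2_mul mf fb (sqL2_cst 1).
  by under eq_fun do rewrite mulr1; exact: sqL2_L1.
by split; apply: L; [exact: (mM i j).1| |exact: (mM i j).2|];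
  apply: aeS (bM i j) => x H Ix; have [] := H Ix.
Qed.

Lemma bounded_coercive_av b gamma M : bounded_coercive b gamma M ->
  bounded_coercive b gamma (cst (av M)).
Proof.
move=> bc; have [mM bM cM] := bc.
have Lr i j := (entry_L1 i j bc).1; have Li i j := (entry_L1 i j bc).2.
have avE i j : av M i j = int01 (fun x => cRe (M x i j)) +i* int01 (fun x => cIm (M x i j)).
  by rewrite mxE.
have le_b f : L1 f -> (\forall x \ae mu, I01 x -> `|f x| <= b) -> `|int01 f| <= b.
  move=> Lf fb; apply: le_trans (le_norm_int01 Lf) _; rewrite -[leRHS]int01_cst.
  by apply: le_int01; [exact: L1_norm|exact: L1_cst|].
split.
- by move=> i j; split; exact: measurable_cst.
- move=> i j; apply: aeW => x _; rewrite /= avE /=; split; apply: le_b => //.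
    by apply: aeS (bM i j) => y H Iy; have [] := H Iy.
  by apply: aeS (bM i j) => y H Iy; have [] := H Iy.
- apply: aeW => x _ [p1 p2] [q1 q2]; rewrite /cst.
  set p := p1 +i* p2; set q := q1 +i* q2; pose Q y := qform (M y) p q.
  have QE y : Q y =
     (cRe p ^+ 2 + cIm p ^+ 2) * cRe (M y 0 0)
   + ((cRe p * cRe q + cIm p * cIm q) * cRe (M y 0 1)
   + ((cIm p * cRe q - cRe p * cIm q) * cIm (M y 0 1)
   + ((cRe p * cRe q + cIm p * cIm q) * cRe (M y 1 0)
   + ((cRe p * cIm q - cIm p * cRe q) * cIm (M y 1 0)
   + (cRe q ^+ 2 + cIm q ^+ 2) * cRe (M y 1 1))))).
    rewrite /Q /qform /redot /p /q.
    case: (M y 0 0) (M y 0 1) (M y 1 0) (M y 1 1) => [a1 a2] [b1 b2] [c1 c2] [d1 d2] /=.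
    by ring.
  have LQ : L1 Q.
    by rewrite (funext QE); do !apply: L1D; exact: L1Z.
  have -> : qform (av M) p q = int01 Q.
    rewrite (funext QE) !int01D ?int01Z//; do ?[by do ?apply: L1D; exact: L1Z].
    rewrite /qform /redot !avE; by rewrite /p /q /=; ring.
  rewrite -[leLHS]int01_cst; apply: le_int01; [exact: L1_cst|exact: LQ|].
  by apply: aeS cM => y H Iy; exact: H.
Qed.

End Multiplier.

(** * Inverses of the fibre operators *)

Lemma linear_of (K : pzRingType) (U V : lmodType K) (f : U -> V) :
  linear f -> exists g : {linear U -> V}, g =1 f.
Proof.
move=> lf; pose h := GRing.isLinear.Build K U V *:%R f lf.
pose g : {linear U -> V} := HB.pack f h.
by exists g.
Qed.

Section Fibre.
Context {R : realType}.
Local Notation mu := (@lebesgue_measure R).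
Local Notation I01 := (@I01 R).
Implicit Types (u v w g h f : L2sq R) (tau theta eps b gamma : R).
Implicit Types (M : R -> 'M[R[i]]_2).

Definition swap u : L2sq R := (u.2, u.1).

Lemma nrm0 : nrm (0 : L2sq R) = 0.
Proof. by rewrite /nrm /ipnorm (ip0l (@sipD R) (@sipZ R)) sqrtr0. Qed.

Lemma nrm_swap u : nrm (swap u) = nrm u.
Proof. by rewrite /nrm /ipnorm /sip addrC. Qed.

Lemma nrm_im (t : R) u : nrm ((0 +i* t) *: u) = `|t| * nrm u.
Proof. exact: (ipnorm_im (@sipC R) (@sipZ R) _ _ (@sip_im R)). Qed.

Lemma swap_skew (t : R) u : sip ((0 +i* t) *: swap u) u = 0.
Proof. by rewrite /sip /= rip_im ripC addNr. Qed.

Lemma AopP tau u g : Aop tau (u, g) <-> pergraph u (g - (0 +i* tau) *: swap u).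
Proof.
split.
  move=> [[g1 /= d1 E1] [g2 /= d2 E2]]; split => /=.
    by rewrite E1 addrK.
  by rewrite E2 addrK.
move=> [/= d1 d2]; split => /=.
  by exists (g.1 - (0 +i* tau) *: u.2); rewrite ?subrK.
by exists (g.2 - (0 +i* tau) *: u.1); rewrite ?subrK.
Qed.

Lemma Aop_skew tau u g : Aop tau (u, g) -> sip g u = 0.
Proof. by move=> /AopP/pergraph_skew; rewrite sipBl swap_skew subr0. Qed.

Lemma Aop_lin tau (z : R[i]) u v g h : Aop tau (u, g) -> Aop tau (v, h) ->
  Aop tau (z *: u + v, z *: g + h).
Proof.
move=> /AopP ug /AopP vh; apply/AopP.
have := pergraphD (pergraphZ z ug) vh; congr (pergraph _ _).
rewrite scalerBr scalerA [z * _]mulrC -scalerA addrACA -opprD -scalerDr.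
by [].
Qed.

Lemma AopB tau u v g h : Aop tau (u, g) -> Aop tau (v, h) ->
  Aop tau (u - v, g - h).
Proof.
move=> ug vh; have := Aop_lin (-1) vh ug; rewrite !scaleN1r.
by rewrite [- v + u]addrC [- h + g]addrC.
Qed.

Lemma fibre_lin M eps theta (z : R[i]) u v f h :
  fibre_op M eps theta (u, f) -> fibre_op M eps theta (v, h) ->
  fibre_op M eps theta (z *: u + v, z *: f + h).
Proof.
move=> [m [g /= [m1 g1 ->]]] [m' [g' /= [m2 g2 ->]]].
exists (z *: m + m'), (z *: g + g'); split => /=.
- exact: mulop_lin.
- exact: Aop_lin.
- rewrite scalerBr scalerDr opprD !scalerA [z * _]mulrC.
  by rewrite addrACA.
Qed.

(** Test the equation with [u]; the operator [A_tau] does not contribute. *)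
Lemma fibre_coercive b gamma M eps theta u f : bounded_coercive b gamma M ->
  fibre_op M eps theta (u, f) -> gamma * nrm u <= nrm f.
Proof.
move=> bc [m [g /= [mm /Aop_skew gu ->]]].
have := mulop_coercive bc mm.
have := sip_le (m - (eps^-1)%:C *: g) u; rewrite sipBl sipZ gu mulr0 subr0.
have := nrm_ge0 u; rewrite le_eqVlt => /predU1P[<- _ _|u0 h1 h2].
  by rewrite mulr0 nrm_ge0.
by rewrite -(ler_pM2r u0) -mulrA -expr2; apply: le_trans h2 h1.
Qed.

(** The term [i theta] of [A_tau / eps] is bounded and skew-symmetric. Adding it
    to the multiplier leaves the coercivity constant unchanged and reduces the
    claim to [tau = 0]. *)
Lemma fibre_solvable b gamma M eps theta f : 0 < gamma -> 0 <= b -> 0 < eps ->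
  bounded_coercive b gamma M -> exists u, fibre_op M eps theta (u, f).
Proof.
move=> gamma0 b0 e0 bc.
have [T TE] := choice (fun u => mulop_ex u bc).
have TB u v : T (u - v) = T u - T v.
  by apply: mulop_uniq (TE (u - v)) _; exact: mulopB.
pose T' u := T u - (0 +i* theta) *: swap u.
have [|||u [g [ug uE]]] := @coercive_solvable R T' (3 * b + `|theta|) gamma eps gamma0 e0 _ _ _ f.
- move=> u v; rewrite /T' TB (_ : swap (u - v) = swap u - swap v)//.
  by rewrite scalerBr subrBACA.
- move=> u; apply: le_trans (nrmB _ _) _; rewrite mulrDl lerD//.
    exact: mulop_bound bc (TE u).
  by rewrite nrm_im nrm_swap.
- by move=> u; rewrite /T' sipBl swap_skew subr0; exact: mulop_coercive bc (TE u).
exists u, (T u), (g + (0 +i* (eps * theta)) *: swap u); split => /=.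
- exact: TE.
- by apply/AopP; rewrite addrK.
- rewrite -uE /T' scalerDr scalerA opprD [- _ + - _]addrC addrA; congr (_ - _ *: _ - _).
  by apply/eqP; rewrite eq_complex /=; apply/andP; split; apply/eqP; field; rewrite gt_eqF.
Qed.

Lemma opnorm_le (S : L2sq R -> L2sq R) (a : R) :
  (forall f, nrm (S f) <= a * nrm f) -> 0 <= a -> (opnorm S <= a%:E)%E.
Proof.
move=> Sa a0; apply: ge_ereal_sup => _ [u /= u1 <-].
rewrite lee_fin L2sq_normE; apply: le_trans (Sa u) _.
by rewrite ler_piMr// -L2sq_normE.
Qed.

Lemma fibre_inverse b gamma M eps theta : 0 < gamma -> 0 <= b -> 0 < eps ->
  bounded_coercive b gamma M ->
  exists S : {linear L2sq R -> L2sq R}, is_bounded_inverse (fibre_op M eps theta) S.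
Proof.
move=> gamma0 b0 e0 bc.
have [T TE] := choice (fun f => fibre_solvable theta f gamma0 b0 e0 bc).
have uniq u v f : fibre_op M eps theta (u, f) -> fibre_op M eps theta (v, f) -> u = v.
  move=> uf vf; apply/eqP; rewrite -subr_eq0; apply/eqP/nrm_eq0/eqP.
  rewrite eq_le nrm_ge0 andbT -(ler_pM2l gamma0) mulr0.
  have := fibre_coercive bc (fibre_lin (-1) vf uf).
  rewrite !scaleN1r addNr [- v + u]addrC.
  by rewrite nrm0.
have lT : linear T.
  by move=> z f h; apply: uniq (TE _) _; exact: fibre_lin.
have [S SE] := linear_of lT; exists S; split.
  apply: (@le_lt_trans _ _ (gamma^-1)%:E); last exact: ltry.
  apply: opnorm_le; last by rewrite invr_ge0 ltW.
  by move=> f; rewrite SE ler_pdivlMl//; exact: fibre_coercive bc (TE f).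
move=> u f; rewrite SE; split=> [uf|->]; last exact: TE.
exact: uniq uf (TE f).
Qed.

End Fibre.

(** * Means and the spectral gap *)

Section Pi_bound.
Context {R : realType}.
Implicit Types x y : R.

Lemma norm_sin_le x : `|sin x| <= `|x|.
Proof.
wlog x0 : x / 0 <= x.
  move=> H; have [/H//|/ltW x0] := leP 0 x.
  by rewrite -normrN -sinN -[leRHS]normrN; apply: H; rewrite oppr_ge0.
move: x0; rewrite le_eqVlt => /predU1P[<-|x0]; first by rewrite sin0 normr0.
have [|c _] := @MVT R sin cos 0 x x0 (fun y _ => is_derive_sin y).
  by apply: continuous_subspaceT; exact: continuous_sin.
rewrite sin0 !subr0 => ->; rewrite normrM ler_piMl// ler_norml.
by rewrite cos_geN1 cos_le1.
Qed.

Lemma cos_ge_quadratic x : 1 - x ^+ 2 / 2 <= cos x.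
Proof.
have E : cos x = cos (x / 2) ^+ 2 *+ 2 - 1.
  by rewrite -cos_mulr2n; congr cos; rewrite mulr2n; lra.
have := cos2Dsin2 (x / 2); have := norm_sin_le (x / 2).
rewrite -ler_sqr ?nnegrE// !real_normK ?num_real// (_ : (x / 2) ^+ 2 = x ^+ 2 / 4); last by field.
by move=> h1 h2; lra.
Qed.

Lemma sin_ge_cubic x : 0 <= x -> x - x ^+ 3 / 6 <= sin x.
Proof.
rewrite le_eqVlt => /predU1P[<-|x0]; first by rewrite sin0; lra.
pose f (y : R) := sin y - y + y ^+ 3 / 6.
have df (y : R) : is_derive y (1 : R) f (cos y - 1 + y ^+ 2 / 2).
  by apply: is_derive_eq; rewrite /GRing.scale/=; field.
have [|c _] := @MVT R f (fun y => cos y - 1 + y ^+ 2 / 2) 0 x x0 (fun y _ => df y).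
  apply: continuous_subspaceT => y; apply: differentiable_continuous.
  by apply/derivable1_diffP.
rewrite {1 2}/f sin0 => E.
have : 0 <= (cos c - 1 + c ^+ 2 / 2) * (x - 0).
  by apply: mulr_ge0; [have := cos_ge_quadratic c; lra|lra].
by rewrite -E; lra.
Qed.

(** As [cos] is positive before [pi / 2], it is enough that [cos (sqrt 3) < 0];
    here [sqrt 3 = 2 y], and [sin y] is bounded below by the cubic Taylor
    polynomial. *)
Lemma pi_lt_sqrt12 : pi < Num.sqrt 12 :> R.
Proof.
pose y : R := Num.sqrt 12 / 4.
have y2 : y ^+ 2 = 3 / 4 by rewrite /y expr_div_n sqr_sqrtr//; field.
have y0 : 0 < y by rewrite divr_gt0// sqrtr_gt0.
have sy : 7 / 8 * y <= sin y.
  have := sin_ge_cubic (ltW y0).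
  by rewrite exprS y2; lra.
have cy : cos (y *+ 2) < 0.
  have h1 := cos2Dsin2 y.
  have h2 : 49 / 64 * (3 / 4) <= sin y ^+ 2.
    rewrite -y2 (_ : 49 / 64 * y ^+ 2 = (7 / 8 * y) ^+ 2); last by field.
    rewrite ler_sqr ?nnegrE//; lra.
  by rewrite cos_mulr2n; lra.
rewrite ltNge; apply/negP => h.
have yE : y *+ 2 = Num.sqrt 12 / 2 by rewrite /y -mulr_natr; field.
have : 0 <= cos (y *+ 2).
  rewrite yE; apply: cos_ge0_pihalf; have pi0 := pi_gt0 R.
  have s0 : 0 <= Num.sqrt 12 :> R by exact: sqrtr_ge0.
  by apply/andP; split; lra.
by rewrite leNgt cy.
Qed.

End Pi_bound.

Section Mean.
Context {R : realType}.
Local Notation mu := (@lebesgue_measure R).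
Local Notation I01 := (@I01 R).
Local Notation N := (ipnorm (@rip R)).
Implicit Types (u v g : L2 R) (c d z : R[i]) (tau : R).

Lemma cst_sqintegrable c : (fun _ : R => c) \in sqintegrable.
Proof.
rewrite inE; split; first by split; exact: measurable_cst.
rewrite integral_cst//; last exact: mI01.
by rewrite [X in (_ * X)%E]I01_measure mule1 ltry.
Qed.

Definition cstL2 c : L2 R := L2_class (MkL2fun (cst_sqintegrable c)).

Definition mean u : R[i] := int01 (fun x => cRe (u x)) +i* int01 (fun x => cIm (u x)).

Lemma cstL2E c : \forall x \ae mu, I01 x -> cstL2 c x = c.
Proof. exact: L2_fun_class. Qed.

Lemma ReL1 u : L1 (fun x => cRe (u x)). Proof. exact: sqL2_L1 (Re_sqL2 u). Qed.

Lemma ImL1 u : L1 (fun x => cIm (u x)). Proof. exact: sqL2_L1 (Im_sqL2 u). Qed.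

Lemma mean_ae u (f : R -> R[i]) : L1 (fun x => cRe (f x)) -> L1 (fun x => cIm (f x)) ->
  (\forall x \ae mu, I01 x -> u x = f x) ->
  mean u = int01 (fun x => cRe (f x)) +i* int01 (fun x => cIm (f x)).
Proof.
move=> Lr Li uf; rewrite /mean; congr (_ +i* _).
  apply: ae_int01; [exact: L1_measurable (ReL1 u)|exact: L1_measurable|].
  by apply: aeS uf => x uf Ix; rewrite uf.
apply: ae_int01; [exact: L1_measurable (ImL1 u)|exact: L1_measurable|].
by apply: aeS uf => x uf Ix; rewrite uf.
Qed.

Lemma mean_cst c : mean (cstL2 c) = c.
Proof.
rewrite (mean_ae _ _ (cstL2E c)); [|exact: L1_cst|exact: L1_cst].
by rewrite !int01_cst; case: c.
Qed.

Lemma meanD u v : mean (u + v) = mean u + mean v.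
Proof.
have RE : (fun x => cRe (u x + v x)) = fun x => cRe (u x) + cRe (v x).
  by apply/funext => x; rewrite raddfD.
have IE : (fun x => cIm (u x + v x)) = fun x => cIm (u x) + cIm (v x).
  by apply/funext => x; rewrite raddfD.
have [ru rv iu iv] := And4 (ReL1 u) (ReL1 v) (ImL1 u) (ImL1 v).
rewrite (mean_ae (f := fun x => u x + v x)) ?RE ?IE; [|exact: L1D|exact: L1D|exact: L2_addE].
by rewrite !int01D.
Qed.

Lemma meanZ z u : mean (z *: u) = z * mean u.
Proof.
have RE : (fun x => cRe (z * u x)) = fun x => cRe z * cRe (u x) - cIm z * cIm (u x).
  by apply/funext => x; case: (z) (u x) => [a b] [c d].
have IE : (fun x => cIm (z * u x)) = fun x => cRe z * cIm (u x) + cIm z * cRe (u x).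
  by apply/funext => x; case: (z) (u x) => [a b] [c d].
have [ru iu] := (ReL1 u, ImL1 u).
rewrite (mean_ae (f := fun x => z * u x)) ?RE ?IE.
- rewrite int01B ?int01D ?int01Z//; do ?exact: L1Z.
  by rewrite /mean; case: (z) => a b.
- by apply: L1B; exact: L1Z.
- by apply: L1D; exact: L1Z.
- exact: L2_scaleE.
Qed.

Lemma meanN u : mean (- u) = - mean u.
Proof. by rewrite -scaleN1r meanZ mulN1r. Qed.

Lemma cstL2D c d : cstL2 (c + d) = cstL2 c + cstL2 d.
Proof.
apply/L2_ext; apply: aeS2 (aeI (cstL2E c) (cstL2E d)) (aeI (cstL2E (c + d)) (L2_addE (cstL2 c) (cstL2 d))).
by move=> x H H' Ix; have [a b] := H Ix; have [-> ->] := H' Ix; rewrite a b.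
Qed.

Lemma cstL2Z z c : cstL2 (z * c) = z *: cstL2 c.
Proof.
apply/L2_ext; apply: aeS2 (cstL2E c) (aeI (cstL2E (z * c)) (L2_scaleE z (cstL2 c))).
by move=> x a H' Ix; have [-> ->] := H' Ix; rewrite a.
Qed.

Lemma cstL2_0 : cstL2 0 = 0.
Proof. by rewrite -(mul0r 0) cstL2Z scale0r. Qed.

Lemma dper_cst c : dper (cstL2 c, 0).
Proof.
have z0 : \forall x \ae mu, I01 x -> (0 : L2 R) x = 0.
  by rewrite -cstL2_0; exact: cstL2E.
have prim00 (f : R -> R) (x : R) : L1 f -> (\forall x \ae mu, I01 x -> f x = 0) ->
    I01 x -> prim f x = 0.
  move=> Lf f0 Ix; rewrite (ae_prim Lf (L1_cst 0) f0) ?I01_cc//.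
  by rewrite prim_cst ?mul0r ?I01_cc.
have rz : \forall x \ae mu, I01 x -> cRe ((0 : L2 R) x) = 0.
  by apply: aeS z0 => x H Ix; rewrite H.
have iz : \forall x \ae mu, I01 x -> cIm ((0 : L2 R) x) = 0.
  by apply: aeS z0 => x H Ix; rewrite H.
have int0 (f : R -> R) : L1 f -> (\forall x \ae mu, I01 x -> f x = 0) -> int01 f = 0.
  by move=> Lf f0; rewrite (ae_int01 (L1_measurable Lf) (L1_measurable (L1_cst 0)) f0) int01_cst.
apply/dperP; split; (split; first by apply: int0 => //; (exact: ReL1 || exact: ImL1)).
  exists (cRe c); apply: aeS (cstL2E c) => x H Ix.
  by rewrite H// (prim00 _ _ (ReL1 0) rz Ix) addr0.
exists (cIm c); apply: aeS (cstL2E c) => x H Ix.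
by rewrite H// (prim00 _ _ (ImL1 0) iz Ix) addr0.
Qed.

Lemma dper_mean u g : dper (u, g) -> mean g = 0.
Proof. by move=> /dperP[[gr _] [gi _]]; rewrite /mean gr gi. Qed.

Lemma rip_cst u c : rip u (cstL2 c) = redot (mean u) c.
Proof.
rewrite /rip (@ae_int01 _ _ (fun x => cRe c * cRe (u x) + cIm c * cIm (u x))).
- have [ru iu] := (ReL1 u, ImL1 u); rewrite int01D ?int01Z//; do ?exact: L1Z.
  by rewrite /redot /mean /= mulrC [cIm c * _]mulrC.
- by apply: L1_measurable; exact: rip_L1.
- by apply: L1_measurable; apply: L1D; apply: L1Z; [exact: ReL1|exact: ImL1].
- by apply: aeS (cstL2E c) => x H Ix; rewrite H//; ring.
Qed.

Lemma rip_pythagoras u : let m := cstL2 (mean u) in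
  N u ^+ 2 = N (u - m) ^+ 2 + N m ^+ 2.
Proof.
move=> m; rewrite !(sqr_ipnorm (@rip_ge0 R)).
have B (a b w : L2 R) : rip (a - b) w = rip a w - rip b w.
  exact: (ipBl (@ripD R) (@ripZ R)).
rewrite B ripC B [rip m (u - m)]ripC B [rip m u]ripC !rip_cst mean_cst; ring.
Qed.

Lemma N_sub_mean u : N (u - cstL2 (mean u)) <= N u.
Proof.
rewrite -ler_sqr ?nnegrE ?ipnorm_ge0// [leRHS]rip_pythagoras.
by rewrite lerDl sqr_ge0.
Qed.

Lemma N_mean u : N (cstL2 (mean u)) <= N u.
Proof.
rewrite -ler_sqr ?nnegrE ?ipnorm_ge0// [leRHS]rip_pythagoras.
by rewrite lerDr sqr_ge0.
Qed.

Lemma dper_poincare u g : dper (u, g) -> mean u = 0 -> Num.sqrt 12 * N u <= N g.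
Proof.
move=> /dperP[ur ui]; rewrite /mean => -[mr mi].
rewrite -ler_sqr ?nnegrE ?mulr_ge0 ?ipnorm_ge0 ?sqrtr_ge0//.
rewrite exprMn sqr_sqrtr// !(sqr_ipnorm (@rip_ge0 R)).
have E w : rip w w = int01 (fun x => cRe (w x) ^+ 2) + int01 (fun x => cIm (w x) ^+ 2).
  rewrite -int01D; [|exact: (Re_sqL2 w).2|exact: (Im_sqL2 w).2].
  by congr int01; apply/funext => x; rewrite !expr2.
have := poincare (Re_sqL2 u) (Re_sqL2 g) ur mr.
have := poincare (Im_sqL2 u) (Im_sqL2 g) ui mi.
by rewrite !E; lra.
Qed.

Lemma N_im (t : R) u : N ((0 +i* t) *: u) = `|t| * N u.
Proof. exact: (ipnorm_im (@ripC R) (@ripZ R) _ _ (@rip_im R)). Qed.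

Lemma shift_mean tau u g : dper_shift tau (u, g) -> mean g = (0 +i* tau) * mean u.
Proof. by move=> [g' /dper_mean g0 /= ->]; rewrite meanD meanZ g0 add0r. Qed.

(** For a quasi-momentum of modulus at most [pi] the term [i tau] is dominated
    by the derivative on functions of mean zero. *)
Lemma shift_poincare tau u g : `|tau| <= pi -> dper_shift tau (u, g) ->
  (Num.sqrt 12 - pi) * N (u - cstL2 (mean u)) <= N g.
Proof.
move=> taupi ug; have mg := shift_mean ug; move: ug => [g' /= du gE].
set v := u - _.
have dv : dper (v, g').
  by have := dperD du (dper_cst (- mean u)); rewrite addr0 -[- mean u]mulN1r cstL2Z scaleN1r.
have mv : mean v = 0 by rewrite /v meanD meanN mean_cst subrr.
have g'E : g' = (g - cstL2 (mean g)) - (0 +i* tau) *: v.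
  rewrite mg cstL2Z /v scalerBr opprB addrA subrK gE addrK//.
have := dper_poincare dv mv; rewrite [in N g']g'E => H.
have B (a b : L2 R) : N (a - b) <= N a + N b.
  exact: (ipnormB (@ripC R) (@ripD R) (@ripZ R) (@rip_ge0 R)).
rewrite mulrBl lerBlDr; apply: le_trans H _; apply: le_trans (B _ _) _.
rewrite N_im; apply: lerD; first exact: N_sub_mean.
by rewrite ler_wpM2r ?ipnorm_ge0.
Qed.

End Mean.

(** * The estimate *)

Section Estimate.
Context {R : realType}.
Local Notation mu := (@lebesgue_measure R).
Local Notation I01 := (@I01 R).
Local Notation N := (ipnorm (@rip R)).
Implicit Types (u v w g h f p m : L2sq R) (tau theta eps b gamma : R).
Implicit Types (M : R -> 'M[R[i]]_2).

Definition avg u : L2sq R := (cstL2 (mean u.1), cstL2 (mean u.2)).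

Lemma avgD u v : avg (u + v) = avg u + avg v.
Proof. by rewrite /avg /= !meanD !cstL2D. Qed.

Lemma avgZ (z : R[i]) u : avg (z *: u) = z *: avg u.
Proof. by rewrite /avg /= !meanZ !cstL2Z. Qed.

Lemma avgB u v : avg (u - v) = avg u - avg v.
Proof. by rewrite -scaleN1r avgD avgZ scaleN1r. Qed.

Lemma avgK u : avg (avg u) = avg u.
Proof. by rewrite /avg /= !mean_cst. Qed.

Lemma nrm_avg u : nrm (avg u) <= nrm u.
Proof.
rewrite -ler_sqr ?nnegrE ?nrm_ge0// !nrm_sqr.
by apply: lerD; rewrite ler_sqr ?nnegrE ?ipnorm_ge0// N_mean.
Qed.

Lemma Aop_avg tau u g : Aop tau (u, g) -> Aop tau (avg u, avg g).
Proof.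
move=> [/= s2 s1]; split => /=; exists 0; rewrite /= ?add0r; first exact: dper_cst.
- by rewrite (shift_mean s2) cstL2Z.
- exact: dper_cst.
- by rewrite (shift_mean s1) cstL2Z.
Qed.

(** On functions of mean zero the derivative is bounded below by [sqrt 12], and
    the term [i tau] costs at most [pi], whatever the quasi-momentum. *)
Definition gap : R := Num.sqrt 12 - pi.

Lemma gap_gt0 : 0 < gap.
Proof. by rewrite subr_gt0 pi_lt_sqrt12. Qed.

Lemma le_of_sqr_sum (k a b c d m n : R) : 0 <= k -> 0 <= a -> 0 <= b ->
  0 <= m -> 0 <= n -> m ^+ 2 = a ^+ 2 + b ^+ 2 -> n ^+ 2 = c ^+ 2 + d ^+ 2 ->
  k * a <= d -> k * b <= c -> k * m <= n.
Proof.
move=> k0 a0 b0 m0 n0 mE nE ad bc.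
have [ka kb] : 0 <= k * a /\ 0 <= k * b by rewrite !mulr_ge0.
rewrite -ler_sqr ?nnegrE ?mulr_ge0// exprMn mE nE mulrDr -!exprMn addrC.
by apply: lerD; rewrite ler_sqr ?nnegrE// ?(le_trans kb bc) ?(le_trans ka ad).
Qed.

Lemma Aop_poincare tau u g : `|tau| <= pi -> Aop tau (u, g) ->
  gap * nrm (u - avg u) <= nrm g.
Proof.
move=> taupi [/= s2 s1].
exact: (le_of_sqr_sum (ltW gap_gt0) (ipnorm_ge0 _ _) (ipnorm_ge0 _ _) (nrm_ge0 _)
  (nrm_ge0 _) (nrm_sqr (u - avg u)) (nrm_sqr g)
  (shift_poincare taupi s1) (shift_poincare taupi s2)).
Qed.

Lemma mulop_avg b gamma M u m : bounded_coercive b gamma M ->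
  mulop M (avg u, m) -> mulop (cst (av M)) (avg u, avg m).
Proof.
move=> bc /mulopP[/= m1 m2].
have Lr i j := (entry_L1 i j bc).1; have Li i j := (entry_L1 i j bc).2.
have key (c d : R[i]) i (w : L2 R) :
    (\forall x \ae mu, I01 x -> w x = M x i 0 * c + M x i 1 * d) ->
    mean w = av M i 0 * c + av M i 1 * d.
  case: c d => [c1 c2] [d1 d2] wE.
  have RE : (fun x => cRe (M x i 0 * (c1 +i* c2) + M x i 1 * (d1 +i* d2))) =
      fun x => (c1 * cRe (M x i 0) + (- c2) * cIm (M x i 0)) +
               (d1 * cRe (M x i 1) + (- d2) * cIm (M x i 1)).
    by apply/funext => x; case: (M x i 0) (M x i 1) => [a1 a2] [b1 b2] /=; ring.
  have IE : (fun x => cIm (M x i 0 * (c1 +i* c2) + M x i 1 * (d1 +i* d2))) =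
      fun x => (c2 * cRe (M x i 0) + c1 * cIm (M x i 0)) +
               (d2 * cRe (M x i 1) + d1 * cIm (M x i 1)).
    by apply/funext => x; case: (M x i 0) (M x i 1) => [a1 a2] [b1 b2] /=; ring.
  have LZD (a c : R) j : L1 (fun x => a * cRe (M x i j) + c * cIm (M x i j)).
    by apply: L1D; exact: L1Z.
  rewrite (mean_ae (f := fun x => M x i 0 * (c1 +i* c2) + M x i 1 * (d1 +i* d2)))//; last 2 first.
  - by rewrite RE; apply: L1D.
  - by rewrite IE; apply: L1D.
  rewrite RE IE !int01D ?int01Z//; do ?exact: L1Z.
  rewrite !mxE /cintegral -!/(int01 _).
  by apply/eqP; rewrite eq_complex /=; apply/andP; split; apply/eqP; rewrite /int01; ring.
have cE c := @cstL2E R c.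
have mE1 : mean m.1 = av M 0 0 * mean u.1 + av M 0 1 * mean u.2.
  apply: key; apply: aeS2 m1 (aeI (cE (mean u.1)) (cE (mean u.2))) => x H H' Ix.
  by have [a c] := H' Ix; rewrite H// a c.
have mE2 : mean m.2 = av M 1 0 * mean u.1 + av M 1 1 * mean u.2.
  apply: key; apply: aeS2 m2 (aeI (cE (mean u.1)) (cE (mean u.2))) => x H H' Ix.
  by have [a c] := H' Ix; rewrite H// a c.
apply/mulopP; split => /=.
  apply: aeS2 (cE (mean m.1)) (aeI (cE (mean u.1)) (cE (mean u.2))) => x H H' Ix.
  by have [a c] := H' Ix; rewrite H// a c mE1.
apply: aeS2 (cE (mean m.2)) (aeI (cE (mean u.1)) (cE (mean u.2))) => x H H' Ix.
by have [a c] := H' Ix; rewrite H// a c mE2.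
Qed.

Lemma mulop_scalar (a : R) u : mulop (cst (a%:C)%:M) (u, a%:C *: u).
Proof.
apply/mulopP; split => /=.
  by apply: aeS (L2_scaleE a%:C u.1) => x H Ix; rewrite H// !mxE /= mulr1n mulr0n mul0r addr0.
by apply: aeS (L2_scaleE a%:C u.2) => x H Ix; rewrite H// !mxE /= mulr1n mulr0n mul0r add0r.
Qed.

Lemma bounded_coercive_scalar (a : R) : 0 <= a ->
  bounded_coercive a a (cst (a%:C)%:M).
Proof.
move=> a0; split.
- by move=> i j; split; exact: measurable_cst.
- move=> i j; apply: aeW => x _; rewrite !mxE; case: (i == j); rewrite ?mulr1n ?mulr0n /=.
    by rewrite normr0 ger0_norm.
  by rewrite normr0.
- apply: aeW => x _ p q; rewrite /qform /cst !mxE /= mulr1n mulr0n !mul0r addr0 add0r.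
  case: p q => [p1 p2] [q1 q2]; rewrite /redot /nsq /=.
  by rewrite le_eqVlt; apply/orP; left; apply/eqP; ring.
Qed.

(** The corrector: as [f] has mean zero, so has [z] by uniqueness, and the
    Poincare inequality makes [z] of order [eps]. *)
Lemma corrector b gamma eps theta f : 0 < gamma -> 0 < eps ->
  `|eps * theta| <= pi -> avg f = 0 ->
  exists z g, [/\ Aop (eps * theta) (z, g), f = gamma%:C *: z - (eps^-1)%:C *: g &
    gap * nrm z <= 2 * eps * nrm f].
Proof.
move=> gamma0 e0 taupi f0; have bc := bounded_coercive_scalar (ltW gamma0).
have [z zf] := fibre_solvable theta f gamma0 (ltW gamma0) e0 bc.
have [mz [g /= [mmz zg fE]]] := zf.
have mzE := mulop_uniq mmz (mulop_scalar gamma z); rewrite {}mzE {mmz mz} in fE.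
exists z, g; split => //.
have z0 : avg z = 0.
  apply/nrm_eq0/eqP; rewrite eq_le nrm_ge0 andbT -(ler_pM2l gamma0) mulr0.
  have -> : 0 = nrm (avg f).
    by rewrite f0 nrm0.
  apply: (fibre_coercive bc (eps := eps) (theta := theta)).
  exists (gamma%:C *: avg z), (avg g); split => /=.
  - exact: mulop_scalar.
  - exact: Aop_avg.
  - by rewrite fE avgB !avgZ.
have := Aop_poincare taupi zg; rewrite z0 subr0 => /le_trans; apply.
have gE : g = eps%:C *: (gamma%:C *: z - f).
  rewrite fE opprB addrC subrK scalerA -rmorphM divff ?gt_eqF// scale1r//.
rewrite gE nrmZ gtr0_norm//.
have := nrmB (gamma%:C *: z) f; rewrite nrmZ gtr0_norm//.
have := fibre_coercive bc zf; move=> h1 h2.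
rewrite -mulrA [2 * _]mulrC -mulrA ler_pM2l//; lra.
Qed.

(** With [P] the average and [M0] the averaged coefficient, the difference
    [u - u0] solves the equation for [M] with right-hand side [(M0 - M) u0].
    The part [(M0 - M) (u0 - P u0)] is of order [eps] by the Poincare inequality.
    The part [(M0 - M) (P u0)] is not small but has mean zero, and is removed by
    the corrector [z]; what remains of it is of the size of [z]. *)
Lemma homogenization_estimate b gamma M eps theta u u0 f :
  0 < gamma -> 0 <= b -> 0 < eps -> `|eps * theta| <= pi ->
  bounded_coercive b gamma M ->
  fibre_op M eps theta (u, f) -> fibre_op (cst (av M)) eps theta (u0, f) ->
  let t := 3 * b / gamma in
  nrm (u - u0) <= gap^-1 * (6 * t ^+ 2 + 10 * t) * eps * nrm f.
Proof.
move=> gamma0 b0 e0 taupi bc uf u0f; pose B := 3 * b; pose t := B / gamma; rewrite /= -/B -/t.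
have bc0 := bounded_coercive_av bc.
have [m0 [g0 /= [mm0 ug0 fE0]]] := u0f.
have [mu0 mmu0] := mulop_ex u0 bc.
have [mp mmp] := mulop_ex (avg u0) bc.
have mmp0 := mulop_avg bc mmp; set mp0 := avg mp in mmp0.
have B0 : 0 <= B by rewrite mulr_ge0.
have k0 := gap_gt0.
have u0b : gamma * nrm u0 <= nrm f := fibre_coercive bc0 u0f.
have mpb : nrm mp <= B * nrm u0.
  by apply: le_trans (mulop_bound b0 bc mmp) _; rewrite ler_wpM2l// nrm_avg.
have mp0b : nrm mp0 <= B * nrm u0.
  by apply: le_trans (mulop_bound b0 bc0 mmp0) _; rewrite ler_wpM2l// nrm_avg.
have np0 : avg (mp0 - mp) = 0 by rewrite avgB /mp0 avgK subrr.
have [z [gz [zg npE zb]]] := corrector b gamma0 e0 taupi np0.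
have [mz mmz] := mulop_ex z bc.
set Q := nrm (u0 - avg u0).
have Qb : gap * Q <= eps * ((B / gamma + 1) * nrm f).
  apply: le_trans (Aop_poincare taupi ug0) _.
  have -> : g0 = eps%:C *: (m0 - f).
    by rewrite fE0 opprB addrC subrK scalerA -rmorphM divff ?gt_eqF// scale1r.
  rewrite nrmZ gtr0_norm// ler_pM2l// mulrDl mul1r.
  apply: le_trans (nrmB _ _) _; rewrite lerD2r.
  apply: le_trans (mulop_bound b0 bc0 mm0) _; rewrite -/B -mulrA ler_wpM2l//.
  by rewrite ler_pdivlMl.
pose r := (m0 - mp0) - (mu0 - mp) - mz + gamma%:C *: z.
have er : fibre_op M eps theta (u - u0 - z, r).
  have [m [g /= [mm ug fE]]] := uf.
  exists (m - mu0 - mz), (g - g0 - gz); split => /=.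
  - by apply: (mulopB _ mmz); exact: mulopB.
  - by apply: (AopB _ zg); exact: AopB.
  - have E : (eps^-1)%:C *: g = m - f by rewrite fE opprB addrC subrK.
    have E0 : (eps^-1)%:C *: g0 = m0 - f by rewrite {1}fE0 opprB addrC subrK.
    have Ez : (eps^-1)%:C *: gz = gamma%:C *: z - (mp0 - mp).
      by rewrite {1}npE opprB addrC subrK.
    rewrite !scalerBr E E0 {}Ez.
    have -> : m - f - (m0 - f) = m - m0 by rewrite opprB addrA subrK.
    rewrite [RHS]subrBACA [m - mu0 - (m - m0)]subrBACA subrr sub0r opprB opprB.
    rewrite /r [m0 - mp0 - _]subrBACA.
    by rewrite !addrA [LHS]addrAC; congr (_ - _); rewrite [LHS]addrAC.
have eb := fibre_coercive bc er.
have rb : nrm r <= 2 * B * Q + (B + gamma) * nrm z.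
  have r1 : nrm (m0 - mp0) <= B * Q.
    exact: mulop_bound b0 bc0 (mulopB mm0 mmp0).
  have r2 : nrm (mu0 - mp) <= B * Q.
    exact: mulop_bound b0 bc (mulopB mmu0 mmp).
  have r3 : nrm mz <= B * nrm z by exact: mulop_bound b0 bc mmz.
  have r4 := nrmZ gamma z; rewrite gtr0_norm// in r4.
  apply: le_trans (nrmD _ _) _; rewrite r4 [(B + gamma) * _]mulrDl addrA lerD2r.
  apply: le_trans (nrmB _ _) _; apply: lerD r3; apply: le_trans (nrmB _ _) _.
  by rewrite (_ : 2 * B * Q = B * Q + B * Q); [exact: lerD|ring].
have zb' : gap * nrm z <= eps * (4 * t * nrm f).
  apply: le_trans zb _; rewrite -mulrA mulrCA ler_pM2l//.
  have tf : B * nrm u0 <= t * nrm f.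
    by rewrite /t -mulrA ler_wpM2l// ler_pdivlMl.
  have npb := le_trans (nrmB mp0 mp) (le_trans (lerD mp0b mpb) (lerD tf tf)).
  by move: (nrm (mp0 - mp)) (nrm f) npb => n a; lra.
have ez : nrm (u - u0) <= nrm (u - u0 - z) + nrm z.
  by rewrite -{1}(subrK z (u - u0)); exact: nrmD.
have h1 : nrm (u - u0) <= 2 * t * Q + (t + 2) * nrm z.
  have BE : B = t * gamma by rewrite /t divfK ?gt_eqF.
  rewrite -(ler_pM2l gamma0).
  have := ler_wpM2l (ltW gamma0) ez; move: eb rb; rewrite BE.
  by lra.
have a0 := nrm_ge0 f.
have t0 : 0 <= t by rewrite divr_ge0// ltW.
rewrite -!mulrA ler_pdivlMl//.
apply: le_trans (ler_wpM2l (ltW k0) h1) _.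
have Qb' : 2 * t * (gap * Q) <= 2 * t * (eps * ((t + 1) * nrm f)).
  by rewrite ler_wpM2l// mulr_ge0.
have zb2 : (t + 2) * (gap * nrm z) <= (t + 2) * (eps * (4 * t * nrm f)).
  by rewrite ler_wpM2l// addr_ge0.
by move: Qb' zb2; lra.
Qed.

End Estimate.

(** * Coefficients in the class *)

Section Resolvent.
Context {R : realType}.
Local Notation mu := (@lebesgue_measure R).
Local Notation I01 := (@I01 R).
Implicit Types (b gamma : R) (M : R -> 'M[R[i]]_2).

Definition rate (t : R) : R := (@gap R)^-1 * (6 * t ^+ 2 + 10 * t).

Lemma rate_gt0 t : 0 < t -> 0 < rate t.
Proof.
move=> t0; rewrite mulr_gt0 ?invr_gt0 ?gap_gt0// addr_gt0 ?mulr_gt0// exprn_gt0//.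
Qed.

Lemma resolvent_estimate_bounded b gamma M : 0 < gamma -> 0 <= b ->
  bounded_coercive b gamma M -> resolvent_estimate M 1 (rate (3 * b / gamma)).
Proof.
move=> gamma0 b0 bc eps theta /andP[e0 _] [t /= tQ thetaE].
have taupi : `|eps * theta| <= pi.
  rewrite -thetaE mulrA divff ?gt_eqF// mul1r ler_norml.
  by move: tQ; rewrite /Qprime /= in_itv/= => /andP[-> /ltW ->].
have [S SE] := fibre_inverse theta gamma0 b0 e0 bc.
have [S0 S0E] := fibre_inverse theta gamma0 b0 e0 (bounded_coercive_av bc).
exists S, S0; split => //.
apply: opnorm_le => [f|]; last first.
  rewrite mulr_ge0 ?(ltW e0)// mulr_ge0 ?invr_ge0 ?(ltW gap_gt0)//.
  by rewrite addr_ge0 ?mulr_ge0 ?sqr_ge0 ?invr_ge0 ?(ltW gamma0).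
have /= h := homogenization_estimate gamma0 b0 e0 taupi bc
  ((SE.2 (S f) f).2 erefl) ((S0E.2 (S0 f) f).2 erefl).
exact: h.
Qed.

Lemma lebesgue_measureT_gt0 : (0 < mu [set: R])%E.
Proof.
apply: (@lt_le_trans _ _ (mu (@Defs.I01 R))); first by rewrite I01_measure.
by apply: le_measure; rewrite ?inE//; exact: mI01.
Qed.

Lemma finite_normyP (f : R -> R) : finite_norm mu +oo%E f <->
  exists a, \forall x \ae mu, `|f x| <= a.
Proof.
rewrite /finite_norm unlock /= lebesgue_measureT_gt0; split.
  move=> h; have : (0 <= ess_sup mu (abse \o (EFin \o f)))%E.
    apply: ess_sup_gee; first exact: lebesgue_measureT_gt0.
    by apply: aeW => x; exact: abse_ge0.
  move: h; case E : (ess_sup _ _) => [a| |]// _ _.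
  exists a; have : (ess_sup mu (abse \o (EFin \o f)) <= a%:E)%E by rewrite E.
  by move/ess_supP; apply: aeS => x; rewrite lee_fin.
move=> [a fa]; apply: (@le_lt_trans _ _ a%:E); last exact: ltry.
by apply/ess_supP; apply: aeS fa => x; rewrite lee_fin.
Qed.

Lemma ReIm_le_cnorm (z : R[i]) : `|cRe z| <= cnorm z /\ `|cIm z| <= cnorm z.
Proof.
have n0 : 0 <= cnorm z by case: z => a b; exact: sqrtr_ge0.
split; rewrite -ler_sqr ?nnegrE// real_normK ?num_real// sqr_cnorm.
  by rewrite lerDl sqr_ge0.
by rewrite lerDr sqr_ge0.
Qed.

Lemma Mclass_bounded gamma M : Mclass gamma M ->
  exists2 b, 0 < b & bounded_coercive b gamma M.
Proof.
move=> [LM psd].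
have [a aE] : exists a : 'I_2 -> 'I_2 -> R, forall i j, \forall x \ae mu,
    `|cRe (M x i j)| <= a i j /\ `|cIm (M x i j)| <= a i j.
  have H i j : exists c : R, \forall x \ae mu,
      `|cRe (M x i j)| <= c /\ `|cIm (M x i j)| <= c.
    have [_ /finite_normyP[c cE] _] := LM i j; exists c.
    apply: aeS cE => x xc; have [h1 h2] := ReIm_le_cnorm (M x i j).
    have n0 : cnorm (M x i j) <= c by rewrite (le_trans (ler_norm _) xc).
    by split; [exact: le_trans h1 n0|exact: le_trans h2 n0].
  have H' i : exists c : 'I_2 -> R, forall j, \forall x \ae mu,
      `|cRe (M x i j)| <= c j /\ `|cIm (M x i j)| <= c j.
    by have [c cE] := choice (H i); exists c.
  by have [a aE] := choice H'; exists a.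
pose b := 1 + \sum_(i < 2) \sum_(j < 2) `|a i j|.
have ab i j : a i j <= b.
  rewrite /b (bigD1 i)//= (bigD1 j)//=.
  have s1 : 0 <= \sum_(k < 2 | k != j) `|a i k| by exact: sumr_ge0.
  have s2 : 0 <= \sum_(k < 2 | k != i) \sum_(l < 2) `|a k l|.
    by apply: sumr_ge0 => k _; exact: sumr_ge0.
  have := ler_norm (a i j); lra.
exists b.
  rewrite /b ltr_pwDl// sumr_ge0// => i _; exact: sumr_ge0.
split.
- by move=> i j; have [[m1 m2] _ _] := LM i j; split; exact: measurable_funTS.
- move=> i j; apply: aeS (aE i j) => x [h1 h2] _.
  by split; [exact: le_trans h1 (ab i j)|exact: le_trans h2 (ab i j)].
- by apply: aeS psd => x /psdmxP.
Qed.

Lemma resolvent_estimate_Mclass gamma M : 0 < gamma -> Mclass gamma M ->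
  exists eps' K : R, [/\ 0 < eps', 0 < K & resolvent_estimate M eps' K].
Proof.
move=> gamma0 /Mclass_bounded[b b0 bc].
exists 1, (rate (3 * b / gamma)); split => //.
  by apply: rate_gt0; rewrite divr_gt0// mulr_gt0.
exact: resolvent_estimate_bounded (ltW b0) bc.
Qed.

End Resolvent.

(** * The fractional coefficients *)

Section Power.
Context {R : realType}.
Implicit Types (a s t nu xi : R).

(** The modulus and, below, the argument of [nu + i xi] for [nu > 0]. *)
Definition modz nu xi : R := cnorm (nu +i* xi).
Definition argz nu xi : R := atan (xi / nu).

Lemma modz_ge nu xi : 0 < nu -> nu <= modz nu xi.
Proof.
move=> nu0; rewrite /modz -ler_sqr ?nnegrE ?(ltW nu0) ?sqrtr_ge0//.
by rewrite sqr_cnorm /= lerDl sqr_ge0.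
Qed.

Lemma modz_gt0 nu xi : 0 < nu -> 0 < modz nu xi.
Proof. by move=> nu0; apply: lt_le_trans (modz_ge xi nu0). Qed.

Lemma modz_cos nu xi : 0 < nu -> modz nu xi * cos (argz nu xi) = nu.
Proof.
move=> nu0; rewrite /argz cos_atan.
have E : modz nu xi = nu * Num.sqrt (1 + (xi / nu) ^+ 2).
  rewrite /modz /= -[nu in nu * _]ger0_norm ?(ltW nu0)// -sqrtr_sqr -sqrtrM ?sqr_ge0//.
  by congr Num.sqrt; field; rewrite gt_eqF.
rewrite E -mulrA divff ?mulr1// gt_eqF// sqrtr_gt0.
by rewrite ltr_pwDl// sqr_ge0.
Qed.

Lemma modz_sin nu xi : 0 < nu -> modz nu xi * sin (argz nu xi) = xi.
Proof.
move=> nu0; have c0 : cos (argz nu xi) != 0.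
  by have := modz_cos xi nu0; apply: contra_eq_neq => ->; rewrite mulr0 lt_eqF.
have : tan (argz nu xi) = xi / nu by rewrite /argz atanK.
rewrite /tan => /(congr1 (fun s => s * cos (argz nu xi))); rewrite divfK// => ->.
by rewrite mulrCA modz_cos// divfK// gt_eqF.
Qed.

Lemma cos_scaled_arg s nu xi : 0 <= s < 1 ->
  cos (s * (pi / 2)) <= cos (s * argz nu xi).
Proof.
move=> /andP[s0 s1]; have pi0 := pi_gt0 R.
rewrite -(cos_norm (s * argz _ _)) normrM (ger0_norm s0).
have ta : `|argz nu xi| <= pi / 2.
  by rewrite ler_norml /argz; have := atan_gtNpi2 (xi / nu); have := atan_ltpi2 (xi / nu); lra.
have sp : s * (pi / 2) <= pi by nra.
have sta : s * `|argz nu xi| <= s * (pi / 2) by rewrite ler_wpM2l.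
move: sta; rewrite le_eqVlt => /predU1P[->//|sta]; apply: ltW.
rewrite ltr_cos// in_itv/=; first by rewrite mulr_ge0//= (le_trans (ltW sta)).
by rewrite mulr_ge0// divr_ge0// ltW.
Qed.

Lemma cos_scaled_pihalf_gt0 s : 0 <= s < 1 -> 0 < cos (s * (pi / 2) : R).
Proof.
move=> /andP[s0 s1]; apply: cos_gt0_pihalf; have pi0 := pi_gt0 R.
by apply/andP; split; nra.
Qed.

(** The real part of [z ^ alpha]. For [alpha < 1] the argument of [z ^ alpha]
    stays away from [pi / 2]; for [alpha = 1] the real part is [nu] itself. *)
Lemma Re_pow_ge alpha : 0 < alpha <= 1 -> exists2 k, 0 < k <= 1 &
  forall nu xi, 0 < nu ->
    k * nu `^ alpha <= modz nu xi `^ alpha * cos (alpha * argz nu xi).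
Proof.
move=> /andP[a0]; rewrite le_eqVlt => /predU1P[->|a1].
  exists 1 => [|nu xi nu0]; first by rewrite ltr01 lexx.
  by rewrite mul1r !powRr1 ?mul1r ?modz_cos// ?(ltW nu0)// ltW// modz_gt0.
have a01 : 0 <= alpha < 1 by rewrite ltW.
exists (cos (alpha * (pi / 2))) => [|nu xi nu0].
  by rewrite cos_scaled_pihalf_gt0//= cos_le1.
rewrite mulrC; apply: ler_pM; rewrite ?powR_ge0 ?(ltW (cos_scaled_pihalf_gt0 _))//.
  by apply: ge0_ler_powR; rewrite ?nnegrE ?(ltW a0) ?(ltW nu0) ?modz_ge// ltW// modz_gt0.
exact: cos_scaled_arg.
Qed.

End Power.

Section Fractional.
Context {R : realType}.
Local Notation mu := (@lebesgue_measure R).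
Local Notation I01 := (@Defs.I01 R).
Context (C D : R -> R) (alpha nu0 c Cm Dm : R).
Context (alpha01 : 0 < alpha <= 1) (nu00 : 0 < nu0) (c0 : 0 < c)
  (mC : measurable_fun setT C) (mD : measurable_fun setT D)
  (C0 : \forall x \ae mu, 0 <= C x) (D0 : \forall x \ae mu, 0 <= D x)
  (Cb : \forall x \ae mu, `|C x| <= Cm) (Db : \forall x \ae mu, `|D x| <= Dm)
  (pC : ae_periodic C) (pD : ae_periodic D)
  (cCD : \forall x \ae mu, c <= C x + D x * nu0 `^ alpha).

Lemma Mxi_entries nu xi x (i j : 'I_2) : Mxi C D alpha nu xi x i j =
  if i == j then
    (nu +i* xi) * (if i == 0 then 1 else
      ((C x)%:C + (D x)%:C * cpow_right (nu +i* xi) alpha)^-1)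
  else 0.
Proof.
rewrite /Mxi !mxE; case: (i == j); first by rewrite mulr1n.
by rewrite mulr0n mulr0.
Qed.

Lemma cpowE nu xi : cpow_right (nu +i* xi) alpha =
  (modz nu xi `^ alpha * cos (alpha * argz nu xi)) +i*
  (modz nu xi `^ alpha * sin (alpha * argz nu xi)).
Proof. by []. Qed.

(** Real part, imaginary part and squared modulus of the denominator. *)
Definition dRe nu xi x := C x + D x * (modz nu xi `^ alpha * cos (alpha * argz nu xi)).
Definition dIm nu xi x := D x * (modz nu xi `^ alpha * sin (alpha * argz nu xi)).
Definition dsq nu xi x := dRe nu xi x ^+ 2 + dIm nu xi x ^+ 2.

Lemma quotE nu xi x :
  (nu +i* xi) * ((C x)%:C + (D x)%:C * cpow_right (nu +i* xi) alpha)^-1 =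
  ((nu * dRe nu xi x + xi * dIm nu xi x) / dsq nu xi x) +i*
  ((xi * dRe nu xi x - nu * dIm nu xi x) / dsq nu xi x).
Proof.
rewrite cpowE (_ : (C x)%:C + _ = dRe nu xi x +i* dIm nu xi x); last first.
  by apply/eqP; rewrite eq_complex /= /dRe /dIm; apply/andP; split; apply/eqP; ring.
have [w0|w0] := eqVneq (dRe nu xi x +i* dIm nu xi x : R[i]) 0.
  move: (w0) => /eqP; rewrite eq_complex /= => /andP[/eqP a /eqP b].
  by rewrite w0 invr0 mulr0 a b !mulr0 addr0 subr0 !mul0r.
have d0 : dRe nu xi x ^+ 2 + dIm nu xi x ^+ 2 != 0.
  apply: contra_neq w0 => /eqP; rewrite paddr_eq0 ?sqr_ge0// !sqrf_eq0.
  by move=> /andP[/eqP -> /eqP ->].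
apply: (mulIf w0); rewrite mulfVK// /dsq.
by apply/eqP; rewrite eq_complex /=; apply/andP; split; apply/eqP; field.
Qed.

Lemma dRe_ge : exists2 k, 0 < k & forall nu xi, nu0 <= nu ->
  \forall x \ae mu, k <= dRe nu xi x.
Proof.
have [k /andP[k0 k1] kE] := Re_pow_ge alpha01.
exists (k * c) => [|nu xi nu0nu]; first exact: mulr_gt0.
have nupos : 0 < nu by exact: lt_le_trans nu0nu.
have h := kE nu xi nupos.
have a0 : 0 <= alpha by case/andP : alpha01 => /ltW.
have pw : nu0 `^ alpha <= nu `^ alpha.
  by apply: ge0_ler_powR; rewrite ?nnegrE ?(ltW nu00) ?(ltW nupos).
apply: aeS2 (aeS2 _ C0 D0) cCD => [x H cx|x Cx Dx]; last exact: (conj Cx Dx).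
have [Cx Dx] := H; rewrite /dRe.
have := powR_ge0 nu0 alpha; set P := nu0 `^ alpha in pw cx * => P0.
move: h; set Z := modz nu xi `^ alpha * _ => h.
have h1 : k * P <= Z by apply: le_trans h; rewrite ler_pM2l.
have h2 : D x * (k * P) <= D x * Z by rewrite ler_wpM2l.
have h3 : k * c <= k * (C x + D x * P) by rewrite ler_pM2l.
have h4 : k * C x <= C x by rewrite ler_piMl.
by lra.
Qed.

Lemma Mxi_bound : exists2 beta, 0 < beta & forall nu xi, nu0 <= nu ->
  \forall x \ae mu, forall i j,
    `|cRe (Mxi C D alpha nu xi x i j)| <= (nu + `|xi|) * beta /\
    `|cIm (Mxi C D alpha nu xi x i j)| <= (nu + `|xi|) * beta.
Proof.
have [k k0 kE] := dRe_ge; exists (1 + k^-1) => [|nu xi nu0nu].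
  by rewrite addr_gt0// invr_gt0.
have nupos : 0 < nu by exact: lt_le_trans nu0nu.
apply: aeS (kE nu xi nu0nu) => x kx i j.
have Z0 : 0 <= nu + `|xi| by rewrite addr_ge0// ltW.
have ik0 : 0 <= k^-1 by rewrite invr_ge0 ltW.
rewrite Mxi_entries; case: (i == j); last by rewrite /= normr0 mulr_ge0// addr_ge0.
case: (i == 0).
  rewrite mulr1 /= ger0_norm ?(ltW nupos)//.
  have : nu + `|xi| <= (nu + `|xi|) * (1 + k^-1) by rewrite ler_peMr// lerDl.
  have := normr_ge0 xi; lra.
rewrite quotE.
have d0 : 0 < dsq nu xi x.
  by rewrite /dsq ltr_pwDl ?sqr_ge0// exprn_gt0// (lt_le_trans k0).
have kd : k ^+ 2 <= dsq nu xi x.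
  apply: (@le_trans _ _ (dRe nu xi x ^+ 2)); last by rewrite /dsq lerDl sqr_ge0.
  by rewrite ler_sqr ?nnegrE ?(ltW k0) ?(le_trans (ltW k0) kx).
have nz : nu ^+ 2 + xi ^+ 2 <= (nu + `|xi|) ^+ 2.
  rewrite sqrrD real_normK ?num_real// lerD2r lerDl.
  by rewrite mulrn_wge0// mulr_ge0// ltW.
have key p : p ^+ 2 <= (nu ^+ 2 + xi ^+ 2) * dsq nu xi x ->
    `|p / dsq nu xi x| <= (nu + `|xi|) * (1 + k^-1).
  move=> pd; apply: (@le_trans _ _ ((nu + `|xi|) * k^-1)); last first.
    by rewrite ler_wpM2l// lerDr.
  rewrite ler_pdivlMr// -ler_sqr ?nnegrE ?mulr_ge0 ?(ltW k0)//.
  rewrite exprMn real_normK ?num_real// expr_div_n.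
  apply: le_trans nz; rewrite mulrAC ler_pdivrMr ?exprn_gt0//.
  apply: (@le_trans _ _ (p ^+ 2 * dsq nu xi x)).
    by rewrite ler_wpM2l// sqr_ge0.
  by rewrite [leRHS]mulrA ler_pM2r.
split; apply: key; rewrite /dsq -subr_ge0.
  rewrite (_ : _ - _ = (nu * dIm nu xi x - xi * dRe nu xi x) ^+ 2); last by ring.
  exact: sqr_ge0.
rewrite (_ : _ - _ = (nu * dRe nu xi x + xi * dIm nu xi x) ^+ 2); last by ring.
exact: sqr_ge0.
Qed.

Lemma Mxi_measurable nu xi i j : cmeasurable setT (fun x => Mxi C D alpha nu xi x i j).
Proof.
have mRe : measurable_fun setT (dRe nu xi).
  by apply: measurable_funD => //; apply: measurable_funM.
have mIm : measurable_fun setT (dIm nu xi) by apply: measurable_funM.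
have mV : measurable_fun setT (fun x => (dsq nu xi x)^-1).
  rewrite (_ : (fun x => _) = fun x => dsq nu xi x `^ (-1)); last first.
    by apply/funext => x; rewrite powR_inv1// /dsq addr_ge0 ?sqr_ge0.
  apply: (measurableT_comp (measurable_powR _)).
  by apply: measurable_funD; exact: measurable_funX.
have mZ (a : R) (f : R -> R) : measurable_fun setT f -> measurable_fun setT (fun x => a * f x).
  by move=> mf; exact: measurable_funM.
rewrite (_ : (fun x => _) = fun x => if i == j then
    if i == 0 then nu +i* xi else
  ((nu * dRe nu xi x + xi * dIm nu xi x) / dsq nu xi x) +i*
  ((xi * dRe nu xi x - nu * dIm nu xi x) / dsq nu xi x) else 0); last first.
  apply/funext => x; rewrite Mxi_entries; case: (i == j) => //.
  by case: (i == 0); rewrite ?mulr1 ?quotE.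
case: (i == j); last by split; exact: measurable_cst.
case: (i == 0); first by split; exact: measurable_cst.
split => /=; apply: measurable_funM => //.
  by apply: measurable_funD; exact: mZ.
by apply: measurable_funB; exact: mZ.
Qed.

Lemma cnorm_le (z : R[i]) : cnorm z <= `|cRe z| + `|cIm z|.
Proof.
have n0 : 0 <= cnorm z by case: z => a b; exact: sqrtr_ge0.
rewrite -ler_sqr ?nnegrE ?addr_ge0// sqr_cnorm sqrrD !real_normK ?num_real//.
by rewrite lerD2r lerDl mulrn_wge0// mulr_ge0.
Qed.

Lemma Mxi_Linfty nu xi i j : nu0 <= nu ->
  Linfty_per (fun x => Mxi C D alpha nu xi x i j).
Proof.
move=> nu0nu; split; first exact: Mxi_measurable.
  have [beta _ bE] := Mxi_bound; apply/finite_normyP.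
  exists ((nu + `|xi|) * beta + (nu + `|xi|) * beta).
  apply: aeS (bE nu xi nu0nu) => x /(_ i j)[h1 h2].
  rewrite ger0_norm; first by apply: le_trans (cnorm_le _) _; exact: lerD.
  by case: (Mxi _ _ _ _ _ _ _ _) => a b; exact: sqrtr_ge0.
by apply: aeS2 pC pD => x a b; rewrite !Mxi_entries a b.
Qed.

(** The numerator of the real part of the lower right entry is
    [nu C + D |z| ^ (1 + alpha) cos ((1 - alpha) arg z)], where the cosine is
    bounded below because [alpha > 0]. It dominates the squared modulus of the
    denominator, which is at most [2 C ^ 2 + 2 D ^ 2 |z| ^ (2 alpha)], since [C]
    and [D] are bounded and [|z| ^ alpha] is at most of order [|z|]. *)
Lemma Mxi_coercive : exists2 gamma, 0 < gamma & forall nu xi, nu0 <= nu ->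
  \forall x \ae mu, forall p q,
    gamma * (nsq p + nsq q) <= qform (Mxi C D alpha nu xi x) p q.
Proof.
have [k k0 kE] := dRe_ge.
have /andP[a0 a1] := alpha01.
have s01 : 0 <= 1 - alpha < 1 by apply/andP; split; lra.
have [k' k'E] : exists k', k' = cos ((1 - alpha) * (pi / 2) : R) by eexists.
have k'0 : 0 < k' by rewrite k'E; exact: cos_scaled_pihalf_gt0.
pose Cp := Num.max Cm 0 + 1; pose Dp := Num.max Dm 0 + 1.
have [Cp1 Dp1] : 1 <= Cp /\ 1 <= Dp by rewrite /Cp /Dp !lerDr !le_max !lexx !orbT.
have CCp x : `|C x| <= Cm -> C x <= Cp.
  move=> h; rewrite /Cp (le_trans (ler_norm _))// (le_trans h)//.
  by rewrite (@le_trans _ _ (Num.max Cm 0)) ?le_max ?lexx// lerDl.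
have DDp x : `|D x| <= Dm -> D x <= Dp.
  move=> h; rewrite /Dp (le_trans (ler_norm _))// (le_trans h)//.
  by rewrite (@le_trans _ _ (Num.max Dm 0)) ?le_max ?lexx// lerDl.
pose rho := nu0 `^ (1 - alpha).
have rho0 : 0 < rho by exact: powR_gt0.
pose gamma := Num.min (nu0 / (2 * Cp)) (k' * rho / (2 * Dp)).
have [g1 g2] : gamma <= nu0 / (2 * Cp) /\ gamma <= k' * rho / (2 * Dp).
  by rewrite /gamma !ge_min !lexx !orbT.
have gamma0 : 0 < gamma by rewrite lt_min !divr_gt0 ?mulr_gt0//; lra.
exists gamma => // nu xi nu0nu.
have nupos : 0 < nu by exact: lt_le_trans nu0nu.
set z := modz nu xi; set t := argz nu xi; set r := z `^ alpha.
have zpos : 0 < z := modz_gt0 xi nupos.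
have r0 : 0 <= r by exact: powR_ge0.
have rz : r * rho <= z.
  have E : z = r * z `^ (1 - alpha).
    rewrite /r -powRD; last by rewrite (gt_eqF zpos) implybT.
    by rewrite addrC subrK powRr1// ltW.
  rewrite [leRHS]E ler_wpM2l//; apply: ge0_ler_powR; rewrite ?nnegrE ?(ltW nu00) ?(ltW zpos)//.
    by case/andP : s01.
  exact: le_trans nu0nu (modz_ge xi nupos).
have ct : k' <= cos ((1 - alpha) * t) by rewrite k'E; exact: cos_scaled_arg.
have zc : z * cos t = nu := modz_cos xi nupos.
have zs : z * sin t = xi := modz_sin xi nupos.
have g3 : gamma * (2 * Cp) <= nu0 by rewrite -ler_pdivlMr// mulr_gt0//; lra.
have g4 : gamma * (2 * Dp) <= k' * rho by rewrite -ler_pdivlMr// mulr_gt0//; lra.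
have CD0 : \forall x \ae mu, 0 <= C x /\ 0 <= D x by apply: aeS2 C0 D0.
have CDb : \forall x \ae mu, `|C x| <= Cm /\ `|D x| <= Dm by apply: aeS2 Cb Db.
have CDE : \forall x \ae mu, (0 <= C x /\ 0 <= D x) /\ (`|C x| <= Cm /\ `|D x| <= Dm).
  by apply: aeS2 CD0 CDb.
apply: aeS2 CDE (kE nu xi nu0nu) => x [[Cx Dx] [Cbx Dbx]] kx p q.
have d0 : 0 < dsq nu xi x.
  by rewrite /dsq ltr_pwDl ?sqr_ge0// exprn_gt0// (lt_le_trans k0).
have num : nu * dRe nu xi x + xi * dIm nu xi x =
    nu * C x + D x * r * z * cos ((1 - alpha) * t).
  have -> : (1 - alpha) * t = t - alpha * t by ring.
  rewrite cosB /dRe /dIm -/z -/t -/r -{1}zc -{1}zs -zc.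
  ring.
have lower : gamma * dsq nu xi x <= nu * dRe nu xi x + xi * dIm nu xi x.
  rewrite num.
  have cs : cos (alpha * t) <= 1 by exact: cos_le1.
  have cs2 := cos2Dsin2 (alpha * t).
  have dE : dsq nu xi x <= 2 * C x ^+ 2 + 2 * (D x * r) ^+ 2.
    rewrite /dsq /dRe /dIm -/z -/t -/r.
    rewrite (_ : _ + _ = C x ^+ 2 + 2 * (C x * (D x * r)) * cos (alpha * t) +
       (D x * r) ^+ 2 * (cos (alpha * t) ^+ 2 + sin (alpha * t) ^+ 2)); last ring.
    rewrite cs2 mulr1.
    have : 0 <= C x * (D x * r) by rewrite !mulr_ge0.
    have : C x * (D x * r) * cos (alpha * t) <= C x * (D x * r).
      by rewrite ler_piMr// !mulr_ge0.
    have := sqr_ge0 (C x - D x * r); nra.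
  have b1 : gamma * (2 * C x ^+ 2) <= nu * C x.
    have : gamma * (2 * C x) <= nu.
      apply: le_trans nu0nu; apply: le_trans g3.
      by rewrite ler_pM2l// ler_pM2l// CCp.
    by move=> /(ler_wpM2r Cx); rewrite expr2; lra.
  have b2 : gamma * (2 * (D x * r) ^+ 2) <= D x * r * z * k'.
    have Dr0 : 0 <= D x * r by rewrite mulr_ge0.
    have h1 : gamma * (2 * (D x * r)) <= z * k'.
      have : gamma * (2 * D x) <= k' * rho.
        by apply: le_trans g4; rewrite ler_pM2l// ler_pM2l// DDp.
      move=> /(ler_wpM2r r0); have := ler_wpM2l (ltW k'0) rz; lra.
    have := ler_wpM2l Dr0 h1; rewrite expr2; lra.
  have b3 : D x * r * z * k' <= D x * r * z * cos ((1 - alpha) * t).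
    by rewrite ler_wpM2l// !mulr_ge0// ltW.
  have := ler_wpM2l (ltW gamma0) dE; rewrite mulrDr; lra.
have E00 : Mxi C D alpha nu xi x 0 0 = nu +i* xi by rewrite Mxi_entries /= mulr1.
have E01 : Mxi C D alpha nu xi x 0 1 = 0 by rewrite Mxi_entries.
have E10 : Mxi C D alpha nu xi x 1 0 = 0 by rewrite Mxi_entries.
have E11 : Mxi C D alpha nu xi x 1 1 =
  ((nu * dRe nu xi x + xi * dIm nu xi x) / dsq nu xi x) +i*
  ((xi * dRe nu xi x - nu * dIm nu xi x) / dsq nu xi x) by rewrite Mxi_entries /= quotE.
rewrite /qform E00 E01 E10 E11 !mul0r addr0 add0r.
have redotM (w s : R[i]) : redot (w * s) s = cRe w * nsq s.
  by case: w s => [w1 w2] [s1 s2]; rewrite /redot /nsq /=; ring.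
rewrite !redotM /= mulrDr.
have nsq0 (s : R[i]) : 0 <= nsq s by rewrite addr_ge0 ?sqr_ge0.
apply: lerD; apply: ler_wpM2r => //.
  have : nu0 / (2 * Cp) <= nu0.
    by rewrite ler_pdivrMr; [apply: ler_peMr; [exact: ltW|lra]|lra].
  lra.
by rewrite ler_pdivlMr.
Qed.

Lemma Mxi_Mclass : exists2 gamma, 0 < gamma & forall nu xi, nu0 <= nu ->
  Mclass gamma (Mxi C D alpha nu xi).
Proof.
have [gamma gamma0 gE] := Mxi_coercive; exists gamma => // nu xi nu0nu.
split; first by move=> i j; exact: Mxi_Linfty.
by apply: aeS (gE nu xi nu0nu) => x h; apply/psdmxP.
Qed.

(** The constant of the estimate is quadratic in the bound of the coefficient,
    which is linear in [xi]. *)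
Lemma Mxi_rate gamma nu : 0 < gamma -> nu0 <= nu ->
  (forall xi, Mclass gamma (Mxi C D alpha nu xi)) ->
  exists2 kappa, 0 < kappa & forall xi, exists eps' K : R,
    [/\ 0 < eps', 0 < K, K <= kappa * (xi ^+ 2 + 1) &
      resolvent_estimate (Mxi C D alpha nu xi) eps' K].
Proof.
move=> gamma0 nu0nu cls; have nupos : 0 < nu by exact: lt_le_trans nu0nu.
have [beta beta0 bE] := Mxi_bound.
pose s := 3 * ((nu + 1) * beta) / gamma.
have s0 : 0 < s by rewrite divr_gt0// !mulr_gt0// addr_gt0.
have G0 : 0 < (@gap R)^-1 by rewrite invr_gt0 gap_gt0.
exists ((@gap R)^-1 * (22 * s ^+ 2 + 5)) => [|xi].
  by rewrite mulr_gt0// addr_gt0// mulr_gt0// exprn_gt0.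
pose b := (nu + `|xi|) * beta.
have b0 : 0 < b by rewrite mulr_gt0// ltr_pwDl.
have bc : bounded_coercive b gamma (Mxi C D alpha nu xi).
  have [LM psd] := cls xi; split.
  - by move=> i j; have [[m1 m2] _ _] := LM i j; split; exact: measurable_funTS.
  - by move=> i j; apply: aeS (bE nu xi nu0nu) => x h _; exact: h.
  - by apply: aeS psd => x /psdmxP.
exists 1, (rate (3 * b / gamma)); split => //.
- by apply: rate_gt0; rewrite divr_gt0// mulr_gt0.
- rewrite /rate -[leRHS]mulrA ler_pM2l//.
  set t := 3 * b / gamma.
  have t0 : 0 <= t by rewrite divr_ge0 ?(ltW gamma0)// mulr_ge0// ltW.
  have ts : t <= s * (1 + `|xi|).
    rewrite /t /s ler_pdivrMr// mulrAC divfK ?gt_eqF// /b.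
    have := mulr_ge0 (ltW nupos) (normr_ge0 xi) => h.
    have : (nu + `|xi|) * beta <= (nu + 1) * (1 + `|xi|) * beta.
      by rewrite ler_pM2r//; lra.
    lra.
  have t2 : t ^+ 2 <= s ^+ 2 * (1 + `|xi|) ^+ 2.
    by rewrite -(exprMn _ s) ler_sqr ?nnegrE// (le_trans t0 ts).
  have x2 : (1 + `|xi|) ^+ 2 <= 2 * (xi ^+ 2 + 1).
    by rewrite -[xi ^+ 2]real_normK ?num_real//; have := sqr_ge0 (1 - `|xi|); lra.
  have s2 : s ^+ 2 * (1 + `|xi|) ^+ 2 <= s ^+ 2 * (2 * (xi ^+ 2 + 1)).
    by rewrite ler_wpM2l// sqr_ge0.
  have := sqr_ge0 (1 - t); have := sqr_ge0 xi; lra.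
- exact: resolvent_estimate_bounded (ltW b0) bc.
Qed.

End Fractional.

Theorem theorem3p2 (R : realType) :
  (forall (gamma : R) (M : R -> 'M[R[i]]_2), 0 < gamma -> Mclass gamma M ->
    exists eps' K : R, [/\ 0 < eps', 0 < K & resolvent_estimate M eps' K])
  /\
  (forall (alpha nu0 c : R) (C D : R -> R),
    0 < alpha <= 1 -> 0 < nu0 -> 0 < c ->
    C \in Lfun (@lebesgue_measure R) +oo%E ->
    D \in Lfun (@lebesgue_measure R) +oo%E ->
    (\forall x \ae (@lebesgue_measure R), 0 <= C x) ->
    (\forall x \ae (@lebesgue_measure R), 0 <= D x) ->
    ae_periodic C -> ae_periodic D ->
    (\forall x \ae (@lebesgue_measure R), c <= C x + D x * nu0 `^ alpha) ->
    let admissible (mu gamma : R) :=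
      [/\ nu0 <= mu, 0 < gamma &
        forall nu xi : R, mu < nu -> Mclass gamma (Mxi C D alpha nu xi)] in
    (exists mu gamma : R, admissible mu gamma) /\
    (forall mu gamma nu : R, admissible mu gamma -> mu < nu ->
      exists2 kappa : R, 0 < kappa &
        forall xi : R, exists eps' K : R,
          [/\ 0 < eps', 0 < K, K <= kappa * (xi ^+ 2 + 1) &
            resolvent_estimate (Mxi C D alpha nu xi) eps' K])).
Proof.
split=> [gamma M gamma0 clsM|alpha nu0 c C D alpha01 nu00 c0].
  exact: resolvent_estimate_Mclass gamma0 clsM.
move=> LC LD C0 D0 pC pD cCD /=.
have bounded (f : R -> R) : f \in Lfun (@lebesgue_measure R) +oo%E ->
    measurable_fun setT f /\
    exists a, \forall x \ae (@lebesgue_measure R), `|f x| <= a.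
  move=> Lf; split; first by have := sub_Lfun_mfun Lf; rewrite inE.
  by apply/finite_normyP; have := sub_Lfun_finLfun Lf; rewrite inE.
have [mC [Cm Cb]] := bounded _ LC; have [mD [Dm Db]] := bounded _ LD.
split.
  have [gamma gamma0 cls] :=
    Mxi_Mclass alpha01 nu00 c0 mC mD C0 D0 Cb Db pC pD cCD.
  exists nu0, gamma; split => // nu xi nu0nu.
  exact: cls (ltW nu0nu).
move=> mu gamma nu [nu0mu gamma0 cls] munu.
apply: (Mxi_rate alpha01 nu00 c0 C0 D0 cCD gamma0).
  exact: le_trans nu0mu (ltW munu).
by move=> xi; exact: cls.
Qed.
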